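(* Let $(M,g)$ be a closed (compact, without boundary), connected, orientable Riemannian surface. Fix $x_0\in M$ and, for $\varepsilon>0$, let $\Gamma_\varepsilon:=B_\varepsilon(x_0)$ be the geodesic ball centred at $x_0$ of geodesic radius $\varepsilon$. Let $\mathbb{E}[\tau_{\Gamma_\varepsilon}\mid X_0=x]$ be the mean first-passage time to $\Gamma_\varepsilon$ of the Brownian motion $X_t$ on $M$ generated by $\Delta_g$, started at $x$. (i) For each $x\notin B_\varepsilon(x_0)$, the mean first-passage time satisfies, as $\varepsilon\to 0$, $$\mathbb{E}[\tau_{\Gamma_\varepsilon}\mid X_0=x] = -\frac{|M|}{2\pi}\log\varepsilon + |M|\,P_{-4}(x_0,x_0) - |M|\,E(x,x_0) + r_\varepsilon(x) + O(\varepsilon\log\varepsilon),$$ for some function $r_\varepsilon$ such that $\|r_\varepsilon\|_{C(K)}\le C_K\,\varepsilon$ for any compact $K\subset M$ for which $K\cap\Gamma_\varepsilon=\emptyset$ (with $C_K$ depending on $K$ but not on $\varepsilon$). (ii) Let $M_\varepsilon = M\setminus\Gamma_\varepsilon$. Then the spatial average of the mean first-passage time satisfies, as $\varepsilon\to0$, $$\frac{1}{|M_\varepsilon|}\int_{M_\varepsilon}\mathbb{E}[\tau_{\Gamma_\varepsilon}\mid X_0=y]\,dvol_g(y) = -\frac{|M|}{2\pi}\log\varepsilon + |M|\,P_{-4}(x_0,x_0) + O(\varepsilon\log\varepsilon).$$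
   Context: $dvol_g$ is the Riemannian volume form, $d_g$ the geodesic distance, and $|M|$, $|M_\varepsilon|$ are Riemannian volumes with respect to $g$. $\Delta_g=-d^*d$ is the (negative) Laplace–Beltrami operator. $X_t$ is the Brownian motion on $M$ with generator $\Delta_g$, and $\tau_{\Gamma_\varepsilon}:=\inf\{t\ge 0: X_t\in\Gamma_\varepsilon\}$. The mean first-passage time $u_\varepsilon(x)=\mathbb{E}[\tau_{\Gamma_\varepsilon}\mid X_0=x]$ is known to be the solution of $\Delta_g u_\varepsilon=-1$ on $M_\varepsilon$, $u_\varepsilon=0$ on $\partial\Gamma_\varepsilon$. The Green function $E(x,y)$ on $M$ is defined by $$\Delta_g E(x,y) = -\delta_y(x)+\frac{1}{|M|},\quad E(x,y)=E(y,x),\quad \int_M E(x,y)\,dvol_g(y)=0.$$ It is known that near the diagonal $E(x,y)=-\frac{1}{2\pi}\log d_g(x,y)+P_{-4}(x,y)$ for some $P_{-4}\in C^1(M\times M)$ which is smooth off the diagonal $\{x=y\}$; $P_{-4}(x_0,x_0)$ is the value of this function at $(x_0,x_0)$. The notation $O(\varepsilon\log\varepsilon)$ means a quantity bounded in absolute value by $C\varepsilon|\log\varepsilon|$ for all sufficiently small $\varepsilon>0$. *)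

(* Defs.v *)
From HB Require Import structures.
From mathcomp Require Import all_boot all_order all_algebra.
From mathcomp Require Import all_classical all_reals all_analysis.

Set Implicit Arguments.
Unset Strict Implicit.
Unset Printing Implicit Defensive.

Import Order.TTheory GRing.Theory Num.Theory.
Import numFieldNormedType.Exports.

Local Open Scope classical_set_scope.
Local Open Scope ring_scope.

(* The set U is meant to be open and V finite-dimensional, in which case this
   is the usual C^k: continuity of the iterated directional derivatives. *)
Fixpoint Ck (R : realType) (V W : normedModType R) (k : nat)
    (U : set V) (f : V -> W) : Prop :=
  (forall x, U x -> {for x, continuous f}) /\
  match k with
  | 0%N => True
  | k'.+1 => forall v : V,
      (forall x, U x -> derivable f x v) /\ Ck k' U (fun x => 'D_v f x)
  end.

Definition smooth (R : realType) (V W : normedModType R)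
    (U : set V) (f : V -> W) : Prop := forall k, Ck k U f.

Definition coord (R : realType) (i : 'I_2) (u : R * R) : R :=
  if i == 0 then u.1 else u.2.

Definition basis (R : realType) (j : 'I_2) : R * R :=
  ((j == 0)%:R, (j != 0)%:R).

Definition jac (R : realType) (F : R * R -> R * R) (u : R * R) : 'M[R]_2 :=
  \matrix_(i, j) 'D_(basis R j) (fun v => coord i (F v)) u.

(* [cmap] is only meaningful on [cdom], and [cinv] on the image of [cdom]. *)
Record chart (R : realType) (M : topologicalType) := Chart {
  cdom : set M ;
  cmap : M -> R * R ;
  cinv : R * R -> M }.

Definition cimg (R : realType) (M : topologicalType) (c : chart R M) :
  set (R * R) := cmap c @` cdom c.

Definition is_chart (R : realType) (M : topologicalType) (c : chart R M) :=
  [/\ open (cdom c),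
      open (cimg c),
      (forall p, cdom c p -> cinv c (cmap c p) = p),
      (forall p, cdom c p -> {for p, continuous (cmap c)}) &
      (forall u, cimg c u -> {for u, continuous (cinv c)})].

Definition transition (R : realType) (M : topologicalType) (c c' : chart R M)
  (u : R * R) : R * R := cmap c' (cinv c u).

Definition compatible (R : realType) (M : topologicalType)
    (c c' : chart R M) : Prop :=
  smooth (cmap c @` (cdom c `&` cdom c')) (transition c c').

Definition smooth_atlas (R : realType) (M : topologicalType)
    (A : set (chart R M)) : Prop :=
  [/\ (forall c, A c -> is_chart c),
      (forall p, exists2 c, A c & cdom c p) &
      (forall c c', A c -> A c' -> compatible c c')].

(* Second countability is not required here: it follows from compactness,
   which is a separate hypothesis.  [chart_at] selects a chart of the atlas
   around each point; [metric c u] is the matrix of the components g_ij at the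
   point of coordinates [u] in the chart [c]. *)
Record riemannian_surface (R : realType) (M : topologicalType) := {
  atlas : set (chart R M) ;
  chart_at : M -> chart R M ;
  metric : chart R M -> R * R -> 'M[R]_2 ;
  surface_hausdorff : hausdorff_space M ;
  atlasP : smooth_atlas atlas ;
  chart_atP : forall p, atlas (chart_at p) /\ cdom (chart_at p) p ;
  metric_smooth : forall c, atlas c ->
    forall i j, smooth (cimg c) (fun u => metric c u i j) ;
  metric_sym : forall c u, atlas c -> cimg c u ->
    (metric c u)^T = metric c u ;
  metric_pos : forall c u, atlas c -> cimg c u ->
    forall v : 'cV[R]_2, v != 0 -> 0 < (v^T *m metric c u *m v) 0 0 ;
  metric_change : forall c c' p, atlas c -> atlas c' ->
    cdom c p -> cdom c' p ->
    let J := jac (transition c c') (cmap c p) in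
    metric c (cmap c p) = J^T *m metric c' (cmap c' p) *m J }.

Definition orientable (R : realType) (M : topologicalType)
    (S : riemannian_surface R M) : Prop :=
  exists A : set (chart R M),
    [/\ smooth_atlas A,
        (forall c c', atlas S c -> A c' -> compatible c c' /\ compatible c' c) &
        (forall c c' p, A c -> A c' -> cdom c p -> cdom c' p ->
           0 < \det (jac (transition c c') (cmap c p)))].

Definition smooth_fun (R : realType) (M : topologicalType)
    (S : riemannian_surface R M) (f : M -> R) : Prop :=
  forall c, atlas S c -> smooth (cimg c) (f \o cinv c).

(* Regularity of a function of two points on an open subset D of M x M. *)
Definition Ck2 (R : realType) (M : topologicalType)
    (S : riemannian_surface R M) (k : nat) (D : set (M * M))
    (F : M -> M -> R) : Prop :=
  forall c c', atlas S c -> atlas S c' ->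
    Ck k
      [set z : (R * R) * (R * R) |
        [/\ cimg c z.1, cimg c' z.2 & D (cinv c z.1, cinv c' z.2)]]
      (fun z => F (cinv c z.1) (cinv c' z.2)).

Definition offdiag (M : Type) : set (M * M) := [set z | z.1 <> z.2].

Definition vdensity (R : realType) (M : topologicalType)
    (S : riemannian_surface R M) (c : chart R M) (u : R * R) : R :=
  Num.sqrt (\det (metric S c u)).

Definition gradient (R : realType) (M : topologicalType)
    (S : riemannian_surface R M) (c : chart R M) (f : M -> R) (u : R * R) :
    'cV[R]_2 :=
  invmx (metric S c u) *m \col_j 'D_(basis R j) (f \o cinv c) u.

Definition divergence (R : realType) (M : topologicalType)
    (S : riemannian_surface R M) (c : chart R M) (V : R * R -> 'cV[R]_2)
    (u : R * R) : R :=
  (vdensity S c u)^-1 *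
  \sum_(i < 2) 'D_(basis R i) (fun v => vdensity S c v * V v i 0) u.

(* The negative Laplace-Beltrami operator - d^* d = div grad; on C^2 functions
   the value does not depend on the chart selected. *)
Definition laplacian (R : realType) (M : topologicalType)
    (S : riemannian_surface R M) (f : M -> R) (p : M) : R :=
  divergence S (chart_at S p) (gradient S (chart_at S p) f)
    (cmap (chart_at S p) p).

Definition segment_length (R : realType) (M : topologicalType)
    (S : riemannian_surface R M) (c : chart R M) (s : R -> R * R) : R :=
  (\int[lebesgue_measure]_(t in `[0%R, 1%R])
     let v := \col_i coord i ('D_1 s t) in
     Num.sqrt ((v^T *m metric S c (s t) *m v) 0 0))%R.

(* [curve_length S p q L]: some piecewise C^1 curve from p to q, cut into C^1
   pieces each lying in the domain of a chart, has length L. *)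
Inductive curve_length (R : realType) (M : topologicalType)
    (S : riemannian_surface R M) : M -> M -> R -> Prop :=
| curve_nil p : curve_length S p p 0
| curve_cons p c (s : R -> R * R) L :
    atlas S c -> Ck 1 [set: R] s ->
    (forall t, 0 <= t <= 1 -> cimg c (s t)) ->
    curve_length S p (cinv c (s 0)) L ->
    curve_length S p (cinv c (s 1)) (L + segment_length S c s).

Definition geodesic_dist (R : realType) (M : topologicalType)
    (S : riemannian_surface R M) (p q : M) : R :=
  inf [set L | curve_length S p q L].

Definition geodesic_ball (R : realType) (M : topologicalType)
    (S : riemannian_surface R M) (p : M) (eps : R) : set M :=
  [set q | geodesic_dist S p q < eps].

Notation borel M := (g_sigma_algebraType (@open M)).

(* dvol_g = sqrt(det g) du^1 du^2 in every chart. *)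
Definition is_volume (R : realType) (M : ptopologicalType)
    (S : riemannian_surface R M) (vol : {measure set (borel M) -> \bar R}) :=
  forall c (A : set (borel M)), atlas S c -> measurable A -> A `<=` cdom c ->
    vol A = (\int[lebesgue_measure \x lebesgue_measure]_(u in cmap c @` A)
               (vdensity S c u)%:E)%E.

(* The distributional equation determines E(., y) only almost everywhere;
   smoothness off the diagonal fixes the pointwise representative.  The values
   on the diagonal are irrelevant. *)
Definition is_green (R : realType) (M : ptopologicalType)
    (S : riemannian_surface R M) (vol : {measure set (borel M) -> \bar R})
    (E : M -> M -> R) : Prop :=
  [/\ (forall k, Ck2 S k (@offdiag M) E),
      (forall y, vol.-integrable [set: borel M] (fun x => (E x y)%:E)),
      (forall (f : M -> R) y, smooth_fun S f ->
         (\int[vol]_x (E x y * laplacian S f x))%R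
         = - f y + (fine (vol setT))^-1 * (\int[vol]_x f x)%R),
      (forall x y, E x y = E y x) &
      (forall x, (\int[vol]_y E x y)%R = 0)].

Definition is_regular_part (R : realType) (M : topologicalType)
    (S : riemannian_surface R M) (E P : M -> M -> R) : Prop :=
  [/\ Ck2 S 1 [set: M * M] P,
      (forall k, Ck2 S k (@offdiag M) P) &
      exists N : set (M * M),
        [/\ open N, (forall x, N (x, x)) &
            forall x y, N (x, y) -> x <> y ->
              E x y = - (2 * pi)^-1 * ln (geodesic_dist S x y) + P x y]].

Definition history (R : realType) (M : ptopologicalType) (Omega : Type)
    (X : R -> Omega -> M) (s : R) : set (set Omega) :=
  <<s [set A | exists r (B : set (borel M)),
         [/\ 0 <= r <= s, measurable B & A = X r @^-1` B]] >>.

(* Brownian motion on M: a Markov process with continuous paths, started at x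
   under [P x], whose transition semigroup f |-> (x |-> E_x f(X_t)) has the
   (full, not halved) Laplacian as generator on C^oo(M).  Only times t >= 0
   matter. *)
Definition is_brownian (R : realType) (M : ptopologicalType)
    (S : riemannian_surface R M) (d : measure_display)
    (Omega : measurableType d) (P : R.-pker (borel M) ~> Omega)
    (X : R -> Omega -> M) : Prop :=
  [/\ (forall t, 0 <= t ->
         measurable_fun [set: Omega] (X t : Omega -> borel M)),
      (forall w, {within `[0, +oo[, continuous (fun t => X t w)}),
      (forall x, P x [set w | X 0 w = x] = 1%E),
      (forall x s t A (B : set (borel M)), 0 <= s -> 0 <= t ->
         history X s A -> measurable B ->
         P x (A `&` X (s + t) @^-1` B)
         = (\int[P x]_(w in A) P (X s w) (X t @^-1` B))%E) &
      (forall f : M -> R, smooth_fun S f -> forall eta : R, 0 < eta ->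
         \forall t \near 0^'+, forall x,
           `|((\int[P x]_w f (X t w))%R - f x) / t - laplacian S f x|
           <= eta)].

(* The infimum of the empty set is +oo: G is never visited. *)
Definition hitting_time (R : realType) (M Omega : Type)
    (X : R -> Omega -> M) (G : set M) (w : Omega) : \bar R :=
  ereal_inf [set t%:E | t in [set t | 0 <= t /\ G (X t w)]].

Definition mfpt (R : realType) (M : ptopologicalType) (d : measure_display)
    (Omega : measurableType d) (P : R.-pker (borel M) ~> Omega)
    (X : R -> Omega -> M) (G : set M) (x : M) : \bar R :=
  (\int[P x]_w hitting_time X G w)%E.

Definition O_eps_log_eps (R : realType) (e : R -> R) : Prop :=
  exists C : R, \forall eps \near 0^'+, `|e eps| <= C * (eps * `|ln eps|).

(* Main.v *)
(* The function v = - |M| E(x0, .) is smooth away from x0, where its Laplacian is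
   -1: tested against bump functions supported in a chart, the distributional
   equation for E becomes a pointwise one. Near x0,
   v = (|M| / 2 pi) log d(x0, .) - |M| P(x0, x0) + O(d). Let w(eps) be the value of
   the leading terms at d = eps. Cutting v off slightly below w(eps) gives a
   function f, smooth on the whole of M, which equals v outside the ball of radius
   eps and w(eps) + O(eps) inside it.
     Brownian motion is known only through the Markov property and the uniform
   convergence of (E_x f(X_t) - f(x)) / t on C^oo(M), so Dynkin's formula for f is
   proved by discretisation: along the times k h, the expectation of f telescopes
   and bounds the expected first grid time spent in the ball; for h = 2^-n these
   grid times decrease to the hitting time, because the ball is open and the paths
   are continuous. Hence E_x[tau] = v(x) - w(eps) + O(eps), uniformly in x outside
   the ball, which is (i).
     For (ii), E(x0, .) has mean zero, so its integral over the complement of the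
   ball is minus its integral over the ball. The latter is O(eps log eps), because
   log (eps / d) is at most log 2 times the number of dyadic balls of radius
   eps / 2^j containing the point, and a ball of radius r has volume O(r). *)
Require Import Defs.
From HB Require Import structures.
From mathcomp Require Import all_boot all_order all_algebra.
From mathcomp Require Import all_classical all_reals all_analysis.
From mathcomp Require Import measurable_realfun.
From mathcomp Require Import ring lra.

Set Implicit Arguments.
Unset Strict Implicit.
Unset Printing Implicit Defensive.

Import Order.TTheory GRing.Theory Num.Theory.
Import numFieldNormedType.Exports.

Local Open Scope classical_set_scope.
Local Open Scope ring_scope.

(** * Iterated directional derivatives *)

(** Three data are given only in weak form, and each shapes a part of the proof. [laplacian] is
    computed in a chart selected at each point, so its independence of the chart has to come first;
    it rests on Piola's identity and the symmetry of second derivatives. [geodesic_dist] is an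
    infimum of curve lengths; it is compared with coordinates from below by testing curves against
    compactly supported functions with bounded gradient, which also keeps the ends of short curves
    inside the chart. That the area is positive and finite is read off the equation for [E], tested
    against a constant. The cutoff may be crude because the expected hitting time is squeezed
    between f(x) minus an upper bound and f(x) minus a lower bound of f on the ball: only the range
    of f there enters, not its derivatives. Cutting off by values works because v tends to minus
    infinity at x0. The level lies below w(eps) by a multiple of eps, since just outside the ball v
    may dip under w(eps) by the error of the expansion. *)

Section lines.
Context {R : realType} {V W : normedModType R}.
Implicit Types (f : V -> W).

(** Reduces every direction to one real variable, where the library's chain rule and mean value
    theorem live. *)
Lemma is_derive_line f (x v : V) (l : W) :
  is_derive x v f l <-> is_derive (0 : R) 1 (fun h : R => f (h *: v + x)) l.
Proof.
have E : 'D_v f x = 'D_1 (fun h : R => f (h *: v + x)) 0.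
  rewrite /derive; congr (lim (_ @ 0^')); apply/funext => h /=.
  by rewrite addr0 scale0r add0r [_%:A]mulr1.
split=> [[fx <-]|[fx <-]]; apply: DeriveDef; rewrite ?E//.
- exact: (derivable1P f x v).1.
- exact: (derivable1P f x v).2.
Qed.

End lines.

Lemma is_derive_line_at {R : realType} {V W : normedModType R} (f : V -> W) (x v : V) (t : R) (l : W) :
  is_derive (t *: v + x) v f l ->
  is_derive t 1 (fun h : R => f (h *: v + x)) l.
Proof.
move=> /is_derive_line H; apply/is_derive_line.
rewrite (_ : (fun h : R => f ((h *: (1 : R^o) + t) *: v + x)) =
  (fun h : R => f (h *: v + (t *: v + x)))) //.
by apply/funext => h; rewrite [_ *: 1]mulr1 scalerDl addrA.
Qed.

Lemma nearN_P {R : realType} {V : normedModType R} (x : V) (P : V -> Prop) :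
  nbhs x P <-> exists2 r, 0 < r & forall y, `|y - x| < r -> P y.
Proof.
split=> [/nbhs_normP[r /= r0 H]|[r r0 H]].
  by exists r => // y yr; apply: H; rewrite /ball_ /= distrC.
by apply/nbhs_normP; exists r => // y; rewrite /ball_ /= distrC; exact: H.
Qed.

Lemma continuous_at_P {R : realType} {V W : normedModType R} (x : V) (f : V -> W) :
  {for x, continuous f} <-> forall e, 0 < e ->
    exists2 r, 0 < r & forall y, `|y - x| < r -> `|f y - f x| < e.
Proof.
split=> [/cvgrPdist_lt H e e0|H].
  have /nearN_P[r r0 Hr] := H e e0.
  by exists r => // y /Hr; rewrite distrC.
apply/cvgrPdist_lt => e e0; have [r r0 Hr] := H e e0.
by apply/nearN_P; exists r => // y /Hr; rewrite distrC.
Qed.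

Lemma near_eq_continuous_at {T W : topologicalType} (f g : T -> W) (x : T) :
  {near x, f =1 g} -> {for x, continuous f} -> {for x, continuous g}.
Proof.
move=> E cf; have fg := nbhs_singleton E.
have K : f @ x --> g x by rewrite -fg.
by apply: cvg_trans K; apply: near_eq_cvg; apply: filterS E => y ->.
Qed.

Section plane.
Context {R : realType}.
Implicit Types (f : R * R -> R) (U : set (R * R)).

Definition linform (a b : R) (h : R * R) : R := a * h.1 + b * h.2.

Lemma linform_is_linear a b : linear (linform a b).
Proof.
move=> k u v; rewrite /linform /= !mulrDr.
by rewrite -!scalerAr addrACA -scalerDr.
Qed.
HB.instance Definition _ a b :=
  GRing.isLinear.Build R (R * R)%type R _ (linform a b) (linform_is_linear a b).

Lemma linform_continuous a b : continuous (linform a b).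
Proof.
move=> h; apply: cvgD; apply: cvgM; try exact: cvg_cst; first exact: cvg_fst.
exact: cvg_snd.
Qed.

Lemma is_deriveZv {V : normedModType R} (f : V -> R) (x v : V) (k l : R) :
  is_derive x v f l -> is_derive x (k *: v) f (k * l).
Proof.
move=> /is_derive_line H; apply/is_derive_line.
rewrite (_ : (fun h : R => f (h *: (k *: v) + x)) =
  (fun h : R => f (h *: v + x)) \o (fun h : R => h * k)); last first.
  by apply/funext => h /=; rewrite scalerA.
rewrite mulrC; apply: is_derive1_comp; first by rewrite mul0r.
have -> : (fun h : R => h * k) = (k \*o (id : R -> R)).
  by apply/funext => h /=; rewrite mulrC.
apply: DeriveDef; first by apply: derivableM.
by rewrite deriveMl// derive_id mulr1.
Qed.

Lemma MVT_line {V : normedModType R} (f : V -> R) (x v : V) :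
  (forall t, 0 <= t <= 1 -> derivable f (t *: v + x) v) ->
  exists2 t, 0 <= t <= 1 & f (v + x) - f x = 'D_v f (t *: v + x).
Proof.
move=> df.
have dg (t : R) : 0 <= t <= 1 ->
    is_derive t 1 (fun h : R => f (h *: v + x)) ('D_v f (t *: v + x)).
  by move=> t01; apply: is_derive_line_at; apply: DeriveDef => //; exact: df.
have [||c c01] := @MVT R (fun h : R => f (h *: v + x))
    (fun t => 'D_v f (t *: v + x)) 0 1 ltr01.
- move=> t; rewrite in_itv/= => /andP[t0 t1]; apply: dg.
  by rewrite !ltW.
- apply: derivable_within_continuous => t; rewrite in_itv/= => t01.
  by have [] := dg t t01.
rewrite scale1r scale0r add0r subr0 mulr1 => E; exists c => //.
by move: c01; rewrite in_itv/= => /andP[? ?]; rewrite !ltW.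
Qed.

Notation e1 := (Defs.basis R 0).
Notation e2 := (Defs.basis R 1).

Lemma scale_e1 (a : R) : a *: e1 = (a, 0).
Proof. by congr pair; [exact: mulr1 | exact: mulr0]. Qed.

Lemma scale_e2 (a : R) : a *: e2 = (0, a).
Proof. by congr pair; [exact: mulr0 | exact: mulr1]. Qed.

Lemma plane_decomp (h : R * R) : h = h.1 *: e1 + h.2 *: e2.
Proof.
by rewrite scale_e1 scale_e2; case: h => a b; congr pair;
  rewrite /= ?addr0 ?add0r.
Qed.

Lemma norm_e2 (a : R) : `|a *: e2| = `|a|.
Proof. by rewrite scale_e2 prod_normE /= normr0; exact/max_idPr. Qed.

(** Walk from [x] along the second axis, then along the first, and apply the mean value theorem on
    each leg. *)
Lemma plane_increment f (x : R * R) (r : R) : 0 < r ->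
  (forall y, `|y - x| < r -> derivable f y e1 /\ derivable f y e2) ->
  forall h, `|h| < r -> exists y z,
    [/\ `|y - x| <= `|h|, `|z - x| <= `|h| &
    f (h + x) - f x = h.1 * 'D_e1 f y + h.2 * 'D_e2 f z].
Proof.
move=> r0 df h hr.
have n1 : `|h.1| <= `|h| by rewrite prod_normE /= le_max lexx.
have n2 : `|h.2| <= `|h| by rewrite prod_normE /= le_max lexx orbT.
have nt (k t : R) : 0 <= t <= 1 -> `|t * k| <= `|k|.
  move=> /andP[t0 t1]; rewrite normrM ger0_norm//.
  by rewrite ler_piMl.
have b1 t : 0 <= t <= 1 ->
    `|t *: (h.1 *: e1) + (h.2 *: e2 + x) - x| <= `|h|.
  move=> t01; rewrite addrA addrK scalerA scale_e1 scale_e2 prod_normE /= add0r addr0.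
  by rewrite ge_max n2 (le_trans (nt _ _ t01)).
have b2 t : 0 <= t <= 1 -> `|t *: (h.2 *: e2) + x - x| <= `|h|.
  move=> t01; rewrite addrK scalerA norm_e2.
  by rewrite (le_trans (nt _ _ t01)).
have D1 y : `|y - x| <= `|h| -> is_derive y (h.1 *: e1) f (h.1 * 'D_e1 f y).
  move=> yh; apply: is_deriveZv; apply: DeriveDef => //.
  by apply: (df _ _).1; apply: le_lt_trans hr.
have D2 y : `|y - x| <= `|h| -> is_derive y (h.2 *: e2) f (h.2 * 'D_e2 f y).
  move=> yh; apply: is_deriveZv; apply: DeriveDef => //.
  by apply: (df _ _).2; apply: le_lt_trans hr.
have [t t01 Et] := @MVT_line _ f (h.2 *: e2 + x) (h.1 *: e1)
  (fun t t01 => let: DeriveDef H _ := D1 _ (b1 t t01) in H).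
have [s s01 Es] := @MVT_line _ f x (h.2 *: e2)
  (fun t t01 => let: DeriveDef H _ := D2 _ (b2 t t01) in H).
exists (t *: (h.1 *: e1) + (h.2 *: e2 + x)), (s *: (h.2 *: e2) + x).
split; [exact: b1 | exact: b2 |].
have [_ <-] := D1 _ (b1 _ t01); have [_ <-] := D2 _ (b2 _ s01).
by rewrite {1}(plane_decomp h) -addrA -Et -Es [RHS]addrA subrK.
Qed.

(** By [plane_increment] the increment is given by partial derivatives at nearby points; their
    continuity at [x] makes the error of each leg at most [e / 2] times the norm of the step. *)
Lemma C1_is_diff f (x : R * R) :
  (\forall y \near x, derivable f y e1 /\ derivable f y e2) ->
  {for x, continuous ('D_e1 f)} -> {for x, continuous ('D_e2 f)} ->
  differentiable f x /\ 'd f x = linform ('D_e1 f x) ('D_e2 f x) :> (_ -> _).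
Proof.
move=> df c1 c2; set L := linform _ _.
have K : f \o shift x = cst (f x) + L +o_ (0 : R * R) id.
  apply/eqaddoP => _/posnumP[e].
  have e2_gt0 : 0 < e%:num / 2 by [].
  have [r1 r10 B1] := (continuous_at_P _ _).1 c1 _ e2_gt0.
  have [r2 r20 B2] := (continuous_at_P _ _).1 c2 _ e2_gt0.
  have [r3 r30 B3] := (nearN_P _ _).1 df.
  have [r [r0 rr1 rr2 rr3]] : exists r, [/\ 0 < r, r <= r1, r <= r2 & r <= r3].
    exists (Num.min r1 (Num.min r2 r3)).
    by rewrite !lt_min r10 r20 r30 !ge_min !lexx !orbT.
  apply/(nearN_P (0 : R * R)); exists r => // h; rewrite subr0 => hr.
  have [|y [z [yh zh E]]] := @plane_increment f x r r0 _ h hr.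
    by move=> y yr; apply: B3; apply: lt_le_trans rr3.
  rewrite /= fctE [X in `|X|](_ : _ =
    h.1 * ('D_e1 f y - 'D_e1 f x) + h.2 * ('D_e2 f z - 'D_e2 f x)); last first.
    rewrite opprD addrA E /L -[X in _ + X]/(- (_ * _ + _ * _)); ring.
  rewrite (splitr e%:num) mulrDl (le_trans (ler_normD _ _))// !normrM.
  apply: lerD; rewrite mulrC ler_pM//.
  - by apply/ltW/B1; apply: le_lt_trans yh _; apply: lt_le_trans rr1.
  - by rewrite prod_normE /= le_max lexx.
  - by apply/ltW/B2; apply: le_lt_trans zh _; apply: lt_le_trans rr2.
  - by rewrite prod_normE /= le_max lexx orbT.
have E := @diff_unique _ _ _ f L x (@linform_continuous _ _) K.
split=> //; apply/diff_locallyP; rewrite E; split=> //.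
exact: linform_continuous.
Qed.

End plane.

(** * Chain rule and stability of the classes C^k *)

Section chain.
Context {R : realType}.
Notation e1 := (Defs.basis R 0).
Notation e2 := (Defs.basis R 1).

Lemma is_derive_comp_real {V : normedModType R} (g : R -> R) (f : V -> R)
    (x v : V) (a b : R) :
  is_derive (f x) 1 g a -> is_derive x v f b ->
  is_derive x v (g \o f) (a * b).
Proof.
move=> dg /is_derive_line df; apply/is_derive_line.
have := @is_derive1_comp R g (fun h : R => f (h *: v + x)) 0 a b.
by rewrite scale0r add0r; apply.
Qed.

(** Directional derivatives of [f] alone do not compose along a curved path, hence the Fréchet
    differentiability of [f]; [T1] and [T2] matter only along one line. *)
Lemma is_derive_comp_plane {V : normedModType R} (f : R * R -> R)
    (T1 T2 : V -> R) (x v : V) (l1 l2 a b : R) :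
  differentiable f (T1 x, T2 x) ->
  'd f (T1 x, T2 x) = linform a b :> (_ -> _) ->
  is_derive x v T1 l1 -> is_derive x v T2 l2 ->
  is_derive x v (fun y => f (T1 y, T2 y)) (a * l1 + b * l2).
Proof.
move=> df Ef /is_derive_line d1 /is_derive_line d2; apply/is_derive_line.
set a1 := (fun h : R => T1 (h *: v + x)) in d1 *.
set a2 := (fun h : R => T2 (h *: v + x)) in d2 *.
have E1 : a1 0 = T1 x by rewrite /a1 scale0r add0r.
have E2 : a2 0 = T2 x by rewrite /a2 scale0r add0r.
have D1 : differentiable a1 0 by apply/derivable1_diffP; case: d1.
have D2 : differentiable a2 0 by apply/derivable1_diffP; case: d2.
have Dp := differentiable_pair D1 D2.
have Df : differentiable f (a1 0, a2 0) by rewrite E1 E2.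
have Dc := differentiable_comp Dp Df.
apply: DeriveDef; first exact/derivable1_diffP.
suff : 'D_1 (f \o (fun y => (a1 y, a2 y))) (0 : R) = a * l1 + b * l2 by [].
rewrite deriveE //; clearbody a1 a2; rewrite diff_comp //= diff_pair // E1 E2 Ef /linform /=.
by rewrite -!deriveE //; case: d1 => _ ->; case: d2 => _ ->.
Qed.

Section closure.
Context {V : normedModType R}.
Implicit Types (U : set V) (f g : V -> R) (k : nat).

Lemma Ck_continuous {W : normedModType R} U k (f : V -> W) x :
  Ck k U f -> U x -> {for x, continuous f}.
Proof. by case: k => [|k] [H _]; exact: H. Qed.

Lemma Ck_S {W : normedModType R} U k (f : V -> W) : Ck k.+1 U f -> Ck k U f.
Proof.
elim: k f => [|k IH] f [cf df]; split => // v.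
by have [H1 H2] := df v; split => //; exact: IH.
Qed.

Lemma Ck_le {W : normedModType R} U k n (f : V -> W) :
  (n <= k)%N -> Ck k U f -> Ck n U f.
Proof.
elim: k => [|k IH]; first by rewrite leqn0 => /eqP ->.
by rewrite leq_eqVlt => /orP[/eqP -> //|nk /Ck_S]; exact: IH.
Qed.

Lemma Ck_sub {W : normedModType R} U U' k (f : V -> W) : U' `<=` U ->
  Ck k U f -> Ck k U' f.
Proof.
move=> UU'; elim: k f => [|k IH] f [cf df]; split=> //.
- by move=> x /UU' /cf.
- by move=> x /UU' /cf.
- move=> v; have [H1 H2] := df v; split; first by move=> x /UU' /H1.
  exact: IH.
Qed.

(** Openness turns agreement on [U] into agreement near each of its points, which is what
    derivatives see. *)
Lemma Ck_eq {W : normedModType R} U k (f g : V -> W) : open U ->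
  (forall x, U x -> f x = g x) -> Ck k U f -> Ck k U g.
Proof.
move=> oU; elim: k f g => [|k IH] f g fg [cf df].
  split=> // x Ux; apply: near_eq_continuous_at (cf x Ux).
  by apply: filterS (open_nbhs_nbhs (conj oU Ux)) => y /fg.
split=> [x Ux|v].
  apply: near_eq_continuous_at (cf x Ux).
  by apply: filterS (open_nbhs_nbhs (conj oU Ux)) => y /fg.
have [H1 H2] := df v.
have nE x : U x -> {near x, f =1 g}.
  by move=> Ux; apply: filterS (open_nbhs_nbhs (conj oU Ux)) => y /fg.
split=> [x Ux|]; first by apply: near_eq_derivable (nE _ Ux) (H1 _ Ux).
by apply: IH H2 => x Ux; apply: near_eq_derive; exact: nE.
Qed.

Lemma Ck_cst {W : normedModType R} U k (c : W) : Ck k U (fun=> c).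
Proof.
elim: k c => [|k IH] c; split => //; try by move=> x _; exact: cst_continuous.
move=> v; split=> [x _|]; first exact: derivable_cst.
rewrite (_ : (fun x => 'D_v (fun=> c) x) = fun=> 0) //.
by apply/funext => x; rewrite derive_cst.
Qed.

Lemma CkD U k f g : open U -> Ck k U f -> Ck k U g ->
  Ck k U (fun x => f x + g x).
Proof.
move=> oU; elim: k f g => [|k IH] f g [cf df] [cg dg]; split => //;
  try by move=> x Ux; apply: continuousD; [exact: cf|exact: cg].
move=> v; have [f1 f2] := df v; have [g1 g2] := dg v.
split=> [x Ux|]; first exact: derivableD (f1 _ Ux) (g1 _ Ux).
apply: Ck_eq (IH _ _ f2 g2) => // x Ux.
by apply/esym; exact: deriveD (f1 _ Ux) (g1 _ Ux).
Qed.

Lemma CkM U k f g : open U -> Ck k U f -> Ck k U g ->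
  Ck k U (fun x => f x * g x).
Proof.
move=> oU; elim: k f g => [|k IH] f g Cf Cg; have [cf df] := Cf;
  have [cg dg] := Cg; split => //;
  try by move=> x Ux; apply: continuousM; [exact: cf|exact: cg].
move=> v; have [f1 f2] := df v; have [g1 g2] := dg v.
split=> [x Ux|]; first exact: derivableM (f1 _ Ux) (g1 _ Ux).
apply: Ck_eq (CkD oU (IH _ _ (Ck_S Cf) g2) (IH _ _ (Ck_S Cg) f2)) => // x Ux.
by apply/esym; exact: deriveM (f1 _ Ux) (g1 _ Ux).
Qed.

Lemma Ck_comp_real U (A : set R) k f (g : R -> R) : open U ->
  Ck k A g -> Ck k U f -> (forall x, U x -> A (f x)) ->
  Ck k U (g \o f).
Proof.
move=> oU + + UA; elim: k g => [|k IH] g Cg Cf; have [cf df] := Cf;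
  have [cg dg] := Cg; split=> //;
  try by move=> x Ux; apply: continuous_comp; [exact: cf|exact/cg/UA].
move=> v; have [f1 f2] := df v; have [g1 g2] := dg 1.
have D x : U x -> is_derive x v (g \o f) ('D_1 g (f x) * 'D_v f x).
  move=> Ux; apply: is_derive_comp_real; apply: DeriveDef => //.
    exact/g1/UA.
  exact: f1.
split=> [x Ux|]; first by case: (D x Ux).
apply: Ck_eq (CkM oU (IH _ g2 (Ck_S Cf)) f2) => // x Ux.
by have [_ ->] := D x Ux.
Qed.

End closure.

Lemma Ck1_diff (U : set (R * R)) k (f : R * R -> R) x : open U ->
  Ck k.+1 U f -> U x ->
  differentiable f x /\ 'd f x = linform ('D_e1 f x) ('D_e2 f x) :> (_ -> _).
Proof.
move=> oU [_ df] Ux; have [f1 f1'] := df e1; have [f2 f2'] := df e2.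
apply: C1_is_diff.
- apply: filterS (open_nbhs_nbhs (conj oU Ux)) => y Uy.
  by split; [exact: f1|exact: f2].
- exact: Ck_continuous f1' Ux.
- exact: Ck_continuous f2' Ux.
Qed.

Lemma Ck1_derive (U : set (R * R)) k (f : R * R -> R) x v : open U ->
  Ck k.+1 U f -> U x -> 'D_v f x = v.1 * 'D_e1 f x + v.2 * 'D_e2 f x.
Proof.
move=> oU Cf Ux; have [df E] := Ck1_diff oU Cf Ux.
by rewrite deriveE // E /linform mulrC (mulrC ('D_e2 f x)).
Qed.

Lemma Ck1_chain {V : normedModType R} (A : set (R * R)) k (f : R * R -> R)
    (T1 T2 : V -> R) x v (l1 l2 : R) :
  open A -> Ck k.+1 A f -> A (T1 x, T2 x) ->
  is_derive x v T1 l1 -> is_derive x v T2 l2 ->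
  is_derive x v (fun y => f (T1 y, T2 y))
    ('D_e1 f (T1 x, T2 x) * l1 + 'D_e2 f (T1 x, T2 x) * l2).
Proof.
move=> oA Cf Ax d1 d2; have [df E] := Ck1_diff oA Cf Ax.
exact: is_derive_comp_plane.
Qed.

(** The chain rule writes a derivative of the composite as a sum of products whose factors are
    composites with partial derivatives of [f], or derivatives of [T1] and [T2], all of one class
    less, so the induction on [k] closes. *)
Lemma Ck_comp_plane {V : normedModType R} (U : set V) (A : set (R * R)) k
    (f : R * R -> R) (T1 T2 : V -> R) : open U -> open A ->
  Ck k A f -> Ck k U T1 -> Ck k U T2 -> (forall x, U x -> A (T1 x, T2 x)) ->
  Ck k U (fun x => f (T1 x, T2 x)).
Proof.
move=> oU oA + + + UA; elim: k f => [|k IH] f Cf C1 C2.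
  split=> // x Ux.
  apply: (@continuous_comp _ _ _ (fun x => (T1 x, T2 x)) f x).
    exact: cvg_pair (C1.1 _ Ux) (C2.1 _ Ux).
  exact: Cf.1 _ (UA _ Ux).
have Cc : forall x, U x -> {for x, continuous (fun x => f (T1 x, T2 x))}.
  by move=> x; exact: Ck_continuous (IH _ (Ck_S Cf) (Ck_S C1) (Ck_S C2)).
split=> // v; have [_ dd1] := C1; have [_ dd2] := C2; have [_ df] := Cf.
have D x : U x -> is_derive x v (fun x => f (T1 x, T2 x))
   ('D_e1 f (T1 x, T2 x) * 'D_v T1 x + 'D_e2 f (T1 x, T2 x) * 'D_v T2 x).
  move=> Ux; apply: (Ck1_chain oA Cf (UA _ Ux)); apply: DeriveDef => //.
    exact: (dd1 v).1.
  exact: (dd2 v).1.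
split=> [x Ux|]; first by case: (D x Ux).
have P1 := CkM oU (IH _ (df e1).2 (Ck_S C1) (Ck_S C2)) (dd1 v).2.
have P2 := CkM oU (IH _ (df e2).2 (Ck_S C1) (Ck_S C2)) (dd2 v).2.
apply: Ck_eq (CkD oU P1 P2) => // x Ux.
by have [_ ->] := D x Ux.
Qed.

End chain.

Lemma dist_half {R : realFieldType} (a b c e : R) :
  `|a - b| < e / 2 -> `|a - c| < e / 2 -> `|b - c| <= e.
Proof.
move=> H1 H2; rewrite (splitr e) (_ : b - c = (a - c) - (a - b)); last by ring.
by rewrite (le_trans (ler_normB _ _))// lerD// ltW.
Qed.

(** * Symmetry of second derivatives *)

Section schwarz.
Context {R : realType} {V : normedModType R}.
#[local] Opaque derive.
Implicit Types (f : V -> R) (x v w : V).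

(** The mean value theorem twice: along [v] for the difference [G] of two translates of [f], then
    along [w] for ['D_v f]. *)
Lemma second_difference f x v w (h r : R) : 0 <= h ->
  h * (`|v| + `|w|) < r ->
  (forall y, `|y - x| < r -> derivable f y v) ->
  (forall y, `|y - x| < r -> derivable ('D_v f) y w) ->
  exists2 y, `|y - x| <= h * (`|v| + `|w|) &
   f (h *: w + (h *: v + x)) - f (h *: v + x) - (f (h *: w + x) - f x)
   = h * (h * 'D_w ('D_v f) y).
Proof.
move=> h0 hr dv dw.
have B s t : 0 <= s <= 1 -> 0 <= t <= 1 ->
    `|s *: (h *: w) + (t *: (h *: v) + x) - x| <= h * (`|v| + `|w|).
  move=> /andP[s0 s1] /andP[t0 t1].
  rewrite addrA addrK (le_trans (ler_normD _ _))// !normrZ !ger0_norm//.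
  by rewrite mulrDr addrC lerD// ler_piMl// mulr_ge0.
have B' s t : 0 <= s <= 1 -> 0 <= t <= 1 ->
    `|s *: (h *: w) + (t *: (h *: v) + x) - x| < r.
  by move=> *; apply: le_lt_trans hr; exact: B.
have i0 : 0 <= (0 : R) <= 1 by rewrite lexx ler01.
have i1 : 0 <= (1 : R) <= 1 by rewrite lexx ler01.
pose G y := f (h *: w + y) - f y.
have DG t : 0 <= t <= 1 -> is_derive (t *: (h *: v) + x) (h *: v) G
   (h * ('D_v f (h *: w + (t *: (h *: v) + x)) - 'D_v f (t *: (h *: v) + x))).
  move=> t01; apply: is_deriveZv; apply: is_deriveB; last first.
    by apply: derivableP; apply: dv; have := B' 0 t i0 t01; rewrite scale0r add0r.
  apply: (is_derive_line _ _ v _).2.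
  rewrite (_ : (fun k => _) = fun k : R =>
    f (k *: v + (h *: w + (t *: (h *: v) + x)))); last first.
    by apply/funext => k; rewrite addrCA.
  apply: (is_derive_line f _ v _).1; apply: derivableP; apply: dv.
  by have := B' 1 t i1 t01; rewrite scale1r.
have [|t t01 Et] := @MVT_line _ _ G x (h *: v).
  by move=> t /DG[].
have [|s s01 Es] := @MVT_line _ _ ('D_v f) (t *: (h *: v) + x) (h *: w).
  move=> s s01.
  by have [] := is_deriveZv h (derivableP (dw _ (B' _ _ s01 t01))).
exists (s *: (h *: w) + (t *: (h *: v) + x)); first exact: B.
rewrite -[LHS]/(G (h *: v + x) - G x) Et.
have [_ ->] := DG _ t01; congr (_ * _); rewrite Es.
by have [_ ->] := is_deriveZv h (derivableP (dw _ (B' _ _ s01 t01))).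
Qed.

(** The second difference is symmetric in [v] and [w], so the two mixed derivatives agree at two
    points [y] and [z] arbitrarily close to [x]; continuity carries the equality to [x]. *)
Lemma schwarz (U : set V) f x v w : open U -> Ck 2 U f -> U x ->
  'D_w ('D_v f) x = 'D_v ('D_w f) x.
Proof.
move=> oU [_ df] Ux.
have [fv [_ /(_ w)[fvw [/(_ _ Ux)cvw _]]]] := df v.
have [fw [_ /(_ v)[fwv [/(_ _ Ux)cwv _]]]] := df w.
have [r0 r00 Br] := (nearN_P _ _).1 (open_nbhs_nbhs (conj oU Ux)).
apply/eqP; rewrite -subr_eq0 -normr_eq0; apply/eqP/le_anti.
rewrite normr_ge0 andbT; apply/ler_addgt0Pr => e e0; rewrite add0r.
have e20 : 0 < e / 2 by rewrite divr_gt0.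
have [r1 r10 B1] := (continuous_at_P _ _).1 cvw _ e20.
have [r2 r20 B2] := (continuous_at_P _ _).1 cwv _ e20.
have [r [r_gt0 rr0 rr1 rr2]] : exists r, [/\ 0 < r, r <= r0, r <= r1 & r <= r2].
  exists (Num.min r0 (Num.min r1 r2)).
  by rewrite !lt_min r10 r20 r00 !ge_min !lexx !orbT.
have N0 : 0 < `|v| + `|w| + 1 by rewrite ltr_wpDl// addr_ge0.
(* The [+ 1] keeps the denominator positive when both directions vanish. *)
pose h := r / (`|v| + `|w| + 1).
have h0 : 0 < h by rewrite divr_gt0.
have hr : h * (`|v| + `|w|) < r.
  by rewrite /h mulrAC -mulrA gtr_pMr// ltr_pdivrMr// mul1r ltrDl.
have dB y : `|y - x| < r -> U y by move=> yr; apply: Br; exact: lt_le_trans rr0.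
have [||y yh Ey] := @second_difference f x v w h r (ltW h0) hr.
- by move=> y yr; apply/fv/dB.
- by move=> y yr; apply/fvw/dB.
have hr' : h * (`|w| + `|v|) < r by rewrite (addrC `|w|).
have [||z zh Ez] := @second_difference f x w v h r (ltW h0) hr'.
- by move=> z zr; apply/fw/dB.
- by move=> z zr; apply/fwv/dB.
have E : 'D_w ('D_v f) y = 'D_v ('D_w f) z.
  have hn0 : h != 0 by rewrite gt_eqF.
  have hI (a b S : R) : S = h * (h * a) -> S = h * (h * b) -> a = b.
    by move=> -> /(mulfI hn0)/(mulfI hn0).
  apply: hI Ey _; rewrite -Ez (addrCA (h *: v)).
  move: (f _) (f (h *: v + x)) (f (h *: w + x)) (f x) => a b c d; ring.
apply: (dist_half (B1 y _)); first exact: lt_le_trans (le_lt_trans yh hr) rr1.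
by rewrite E; apply: B2; exact: lt_le_trans (le_lt_trans zh hr') rr2.
Qed.

End schwarz.

(** * Smooth cutoff functions *)

Section components.
Context {R : realType}.

Lemma is_derive_fst {V : normedModType R} (T : V -> R * R) x v :
  derivable T x v -> is_derive x v (fun y => (T y).1) ('D_v T x).1.
Proof.
move=> dT.
have H : (fun h : R => h^-1 *: ((T (h *: v + x)).1 - (T x).1)) @ 0^' -->
    ('D_v T x).1.
  have H0 : (fun h : R => h^-1 *: (T (h *: v + x) - T x)) @ 0^' -->
    'D_v T x := dT.
  exact: (cvg_comp _ _ H0 (@cvg_fst _ _ _ _ _)).
apply: DeriveDef; first by apply/cvg_ex; exists ('D_v T x).1.
by apply: cvg_lim H.
Qed.

Lemma is_derive_snd {V : normedModType R} (T : V -> R * R) x v :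
  derivable T x v -> is_derive x v (fun y => (T y).2) ('D_v T x).2.
Proof.
move=> dT.
have H : (fun h : R => h^-1 *: ((T (h *: v + x)).2 - (T x).2)) @ 0^' -->
    ('D_v T x).2.
  have H0 : (fun h : R => h^-1 *: (T (h *: v + x) - T x)) @ 0^' -->
    'D_v T x := dT.
  exact: (cvg_comp _ _ H0 (@cvg_snd _ _ _ _ _)).
apply: DeriveDef; first by apply/cvg_ex; exists ('D_v T x).2.
by apply: cvg_lim H.
Qed.

Lemma Ck_fst {V : normedModType R} (U : set V) k (T : V -> R * R) : open U ->
  Ck k U T -> Ck k U (fun x => (T x).1).
Proof.
move=> oU; elim: k T => [|k IH] T CT; have [cT dT] := CT.
  split; last by [].
  move=> x Ux.
  apply: (@continuous_comp _ _ _ T fst).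
    exact: cT.
  exact: cvg_fst.
split=> [x Ux|v].
  apply: (@continuous_comp _ _ _ T fst); [exact: cT|exact: cvg_fst].
 have [d1 d2] := dT v; split=> [x Ux|].
  by have [] := is_derive_fst (d1 _ Ux).
apply: Ck_eq (IH _ d2) => // x Ux.
by have [_ ->] := is_derive_fst (d1 _ Ux).
Qed.

Lemma Ck_snd {V : normedModType R} (U : set V) k (T : V -> R * R) : open U ->
  Ck k U T -> Ck k U (fun x => (T x).2).
Proof.
move=> oU; elim: k T => [|k IH] T CT; have [cT dT] := CT.
  split; last by [].
  move=> x Ux.
  apply: (@continuous_comp _ _ _ T snd).
    exact: cT.
  exact: cvg_snd.
split=> [x Ux|v].
  apply: (@continuous_comp _ _ _ T snd); [exact: cT|exact: cvg_snd].
 have [d1 d2] := dT v; split=> [x Ux|].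
  by have [] := is_derive_snd (d1 _ Ux).
apply: Ck_eq (IH _ d2) => // x Ux.
by have [_ ->] := is_derive_snd (d1 _ Ux).
Qed.

Lemma slice_line {V W : normedModType R} (y : W) (x v : V) (h : R) :
  h *: ((0, v) : W * V) + (y, x) = (y, h *: v + x).
Proof. by rewrite -[LHS]/(h *: 0 + y, h *: v + x) scaler0 add0r. Qed.

Lemma derive_slice {V W Z : normedModType R} (F : W * V -> Z) y x v :
  'D_v (fun u => F (y, u)) x = 'D_((0, v) : W * V) F (y, x).
Proof.
rewrite /derive; congr (lim (_ @ 0^')); apply/funext => h /=.
by rewrite slice_line.
Qed.

Lemma derivable_slice {V W Z : normedModType R} (F : W * V -> Z) y x v :
  derivable F (y, x) ((0, v) : W * V) -> derivable (fun u => F (y, u)) x v.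
Proof.
rewrite /derivable => H; apply: (cvgP ('D_((0, v) : W * V) F (y, x))).
apply: cvg_trans H; rewrite /derive.
set a := (X in X @ _ `=>` _); set b := (X in _ `=>` X @ _).
suff -> : a = b by [].
apply/funext => h; rewrite /a /b /=.
by rewrite slice_line.
Qed.

#[local] Opaque derive.

(** A derivative of the slice along [v] is a derivative of [F] along [(0, v)]. This is how the joint
    regularity of the Green function and of its regular part passes to functions of the second
    point. *)
Lemma Ck_slice {V W Z : normedModType R} (D : set (W * V)) k (F : W * V -> Z) y :
  Ck k D F -> Ck k [set x | D (y, x)] (fun u => F (y, u)).
Proof.
elim: k F => [|k IH] F CF; have [cF dF] := CF.
  split; last by [].
  move=> x Dx; apply: (@continuous_comp _ _ _ (fun u => (y, u)) F).
    exact: cvg_pair (cvg_cst _) cvg_id.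
  exact: cF.
split=> [x Dx|v].
  apply: (@continuous_comp _ _ _ (fun u => (y, u)) F).
    exact: cvg_pair (cvg_cst _) cvg_id.
  exact: cF.
have [d1 d2] := dF (0, v); split=> [x Ux|].
  exact: derivable_slice (d1 _ Ux).
rewrite (_ : derive (fun u => F (y, u)) ^~ v =
  (fun u => 'D_((0, v) : W * V) F (y, u))); first exact: IH d2.
by apply/funext => x; rewrite derive_slice.
Qed.

(** For functions given by different formulas on different open sets, such as extensions by zero. *)
Lemma Ck_local {V W : normedModType R} (U : set V) k (f : V -> W) :
  (forall x, U x -> exists2 A, A x & Ck k A f) -> Ck k U f.
Proof.
elim: k f => [|k IH] f H.
  split; last by [].
  by move=> x /H[A Ax /Ck_continuous]; apply.
split=> [x /H[A Ax /Ck_continuous]|v]; first exact.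
split=> [x /H[A Ax [_ /(_ v)[df _]]]|]; first exact: df.
by apply: IH => x /H[A Ax [_ /(_ v)[_ Cf]]]; exists A.
Qed.

Lemma is_derive_cfst (x v : R * R) : is_derive x v (fun u : R * R => u.1) v.1.
Proof.
apply: (is_derive_line _ _ _ _).2.
have -> : (fun h : R => (h *: v + x).1) = (fun h : R => h * v.1) + cst x.1.
  by [].
rewrite -[X in is_derive _ _ _ X]addr0; apply: is_deriveD.
have -> : (fun h : R => h * v.1) = (v.1 \*o (id : R -> R)).
  by apply/funext => h /=; rewrite mulrC.
apply: DeriveDef; first by apply: derivableM.
by rewrite deriveMl// derive_id mulr1.
Qed.

Lemma is_derive_csnd (x v : R * R) : is_derive x v (fun u : R * R => u.2) v.2.
Proof.
apply: (is_derive_line _ _ _ _).2.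
have -> : (fun h : R => (h *: v + x).2) = (fun h : R => h * v.2) + cst x.2.
  by [].
rewrite -[X in is_derive _ _ _ X]addr0; apply: is_deriveD.
have -> : (fun h : R => h * v.2) = (v.2 \*o (id : R -> R)).
  by apply/funext => h /=; rewrite mulrC.
apply: DeriveDef; first by apply: derivableM.
by rewrite deriveMl// derive_id mulr1.
Qed.

Lemma Ck_cfst k (U : set (R * R)) : Ck k U (fun u : R * R => u.1).
Proof.
have c x : {for x, continuous (fun u : R * R => u.1)} by exact: cvg_fst.
case: k => [|k]; first by split; [move=> x _; exact: c|exact: I].
split; [by move=> x _; exact: c|move=> v].
split=> [x _|]; first by have [] := is_derive_cfst x v.
rewrite (_ : derive (fun u : R * R => u.1) ^~ v = fun=> v.1); first exact: Ck_cst.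
by apply/funext => x; have [_ ->] := is_derive_cfst x v.
Qed.

Lemma Ck_csnd k (U : set (R * R)) : Ck k U (fun u : R * R => u.2).
Proof.
have c x : {for x, continuous (fun u : R * R => u.2)} by exact: cvg_snd.
case: k => [|k]; first by split; [move=> x _; exact: c|exact: I].
split; [by move=> x _; exact: c|move=> v].
split=> [x _|]; first by have [] := is_derive_csnd x v.
rewrite (_ : derive (fun u : R * R => u.2) ^~ v = fun=> v.2); first exact: Ck_cst.
by apply/funext => x; have [_ ->] := is_derive_csnd x v.
Qed.

Lemma Ck_id k (U : set R) : Ck k U (id : R -> R).
Proof.
case: k => [|k]; first by split; [move=> x _; exact: cvg_id|exact: I].
split; [by move=> x _; exact: cvg_id|move=> v].
split=> [x _|]; first exact: derivable_id.
rewrite (_ : derive (id : R -> R) ^~ v = fun=> v); first exact: Ck_cst.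
by apply/funext => x; rewrite derive_id.
Qed.

Lemma derive_realE (f : R -> R) (x v : R) :
  derivable f x 1 -> is_derive x v f (v * 'D_1 f x).
Proof.
move=> df; have := is_deriveZv v (derivableP df).
by rewrite [v *: 1]mulr1.
Qed.

(** Bootstraps functions whose derivative is expressed through functions of the same family: the
    inverse, the square root and [flat]. *)
Lemma CkS_real k (U : set R) (f g : R -> R) : open U ->
  (forall x, U x -> is_derive x 1 f (g x)) -> Ck k U g -> Ck k.+1 U f.
Proof.
move=> oU df Cg; split=> [x Ux|v].
  by apply/differentiable_continuous/derivable1_diffP; case: (df x Ux).
have D x : U x -> is_derive x v f (v * g x).
  move=> Ux; have [d1 <-] := df x Ux; exact: derive_realE.
split=> [x Ux|]; first by case: (D x Ux).
apply: Ck_eq (CkM oU (Ck_cst U k v) Cg) => // x Ux.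
by have [_ ->] := D x Ux.
Qed.

Lemma open_pos : open [set x : R | 0 < x].
Proof. exact: open_gt. Qed.

Lemma Ck_inv k : Ck k [set x : R | 0 < x] (fun x : R => x^-1).
Proof.
elim: k => [|k IH]; first by split=> // x x0; apply: inv_continuous; rewrite gt_eqF.
apply: (CkS_real open_pos (g := fun x => - 1 * (x^-1 * x^-1))).
  move=> x x0; have xn0 : x != 0 by rewrite gt_eqF.
  apply: DeriveDef; first exact: (@derivableV _ _ id).
  rewrite (@deriveV _ _ id)// derive_id [LHS]mulr1 mulN1r; congr (- _).
  by rewrite -invfM -expr2.
by apply: CkM (Ck_cst _ _ _) _; [exact: open_pos|apply: CkM; [exact: open_pos| |]].
Qed.

Lemma Ck_sqrt k : Ck k [set x : R | 0 < x] (@Num.sqrt R).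
Proof.
elim: k => [|k IH]; first by split=> // x x0; apply: sqrt_continuous.
apply: (CkS_real open_pos (g := fun x => 2^-1 * ((fun x : R => x^-1) \o Num.sqrt) x)).
  move=> x x0; have := is_derive1_sqrt x0; rewrite /= invfM; exact.
apply: CkM (Ck_cst _ _ _) _; first exact: open_pos.
apply: Ck_comp_real (Ck_inv k) IH _; first exact: open_pos.
by move=> x /= x0; rewrite sqrtr_gt0.
Qed.

End components.

(** * Steps, cutoffs and bumps built from exp(-1/x) *)

Section smooth_step.
Context {R : realType}.
#[local] Opaque derive.

(** The polynomial factor makes the family stable under differentiation, see [is_derive_flat], so
    that one induction gives all orders. *)
Definition flat (p : {poly R}) (x : R) : R :=
  if 0 < x then p.[x^-1] * expR (- x^-1) else 0.

(** With y = 1/x, the exponential series gives y^(n+2) <= (n+2)! exp(y), which bounds each monomial.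
    Quadratic decay at 0 makes the difference quotient there tend to 0. *)
Lemma flat_bound (p : {poly R}) :
  exists2 C, 0 <= C & forall x, `|x| <= 1 -> `|flat p x| <= C * x ^+ 2.
Proof.
suff [C C0 HC] : exists2 C : R, 0 <= C & forall y : R, 1 <= y ->
    `|p.[y] * expR (- y)| <= C / y ^+ 2.
  exists C => // x x1; rewrite /flat; case: ifPn => x0; last first.
    by rewrite normr0 mulr_ge0// sqr_ge0.
  have /HC : 1 <= x^-1 by rewrite -invr1 lef_pV2 ?posrE// (le_trans (ler_norm _)).
  by rewrite exprVn invrK.
elim/poly_ind: p => [|p c _].
  by exists 0 => // y _; rewrite horner0 mul0r normr0 mul0r.
set q := p * 'X + c%:P; rewrite -[q]coefK.
rewrite poly_def; elim: (size q) => [|n [C C0 IH]].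
  by exists 0 => // y _; rewrite big_ord0 horner0 mul0r normr0 mul0r.
exists (C + `|q`_n| * (n.+2)`!%:R).
  by rewrite addr_ge0// mulr_ge0.
move=> y y1; rewrite big_ord_recr/= hornerD mulrDl mulrDl.
rewrite (le_trans (ler_normD _ _))// lerD// ?IH//.
rewrite hornerZ hornerXn -mulrA normrM -mulrA ler_wpM2l//.
have y0 : 0 < y by apply: lt_le_trans y1.
rewrite ger0_norm; last by rewrite mulr_ge0 ?expR_ge0 ?exprn_ge0// ltW.
rewrite ler_pdivlMr ?exprn_gt0// mulrAC -exprD addn2 expRN ler_pdivrMr ?expR_gt0//.
have := @expR_ge1Dxn _ y n.+1 (ltW y0).
move=> H; have {}H : y ^+ n.+2 / (n.+2)`!%:R <= expR y.
  by apply: le_trans H; rewrite lerDr.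
by rewrite mulrC -ler_pdivrMr// ltr0n fact_gt0.
Qed.

Lemma is_derive_flat (p : {poly R}) (x : R) :
  is_derive x 1 (flat p) (flat ('X^2 * (p - p^`())) x).
Proof.
have [x0|x0|->] := ltgtP x 0.
- rewrite {2}/flat ltNge (ltW x0)/=.
  apply: (@near_eq_is_derive _ _ _ (cst 0)) (is_derive_cst _ _ _).
  have : \forall y \near x, y < 0 by exact: lt_nbhsl.
  by apply: filterS => y y0; rewrite /flat ltNge (ltW y0).
- rewrite {2}/flat x0.
  apply: (@near_eq_is_derive _ R R (fun x => p.[x^-1] * expR (- x^-1))).
    have : \forall y \near x, 0 < y by exact: lt_nbhsr.
    by apply: filterS => y y0; rewrite /flat y0.
  have xn0 : x != 0 by rewrite gt_eqF.
  have di : is_derive x 1 (fun x : R => x^-1) (- x ^- 2).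
    apply: DeriveDef; first exact: (@derivableV _ _ id).
    by rewrite (@deriveV _ _ id)// derive_id [LHS]mulr1.
  have dp : is_derive x 1 (horner p \o (fun x => x^-1)) (p^`().[x^-1] * - x ^- 2).
    exact: is_derive1_comp.
  have dn : is_derive x 1 (fun x : R => - x^-1) (- - x ^- 2).
    exact: is_deriveN.
  have de : is_derive x 1 (expR \o (fun x => - x^-1)) (expR (- x^-1) * - - x ^- 2).
    exact: is_derive1_comp.
  have [H1 H2] := @is_deriveM _ _ _ _ x 1 _ _ dp de.
  apply: DeriveDef; first exact: H1.
  rewrite [LHS]H2 /= !hornerE /= /GRing.scale /= -exprVn; ring.
rewrite {2}/flat ltxx.
have f0 : flat p 0 = 0 by rewrite /flat ltxx.
have [C C0 HC] := flat_bound p.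
have H : (fun h : R => h^-1 *: (flat p (h *: 1 + 0) - flat p 0)) @ 0^' --> (0 : R).
  apply/cvgrPdist_le => e e0; near=> h.
  rewrite sub0r normrN f0 subr0 addr0 [h *: 1]mulr1 normrM normfV.
  have hn0 : h != 0 by near: h; exact: nbhs_dnbhs_neq.
  rewrite mulrC ler_pdivrMr ?normr_gt0//.
  have h1 : `|h| <= 1 by near: h; apply: dnbhs0_le.
  rewrite (le_trans (HC _ h1))// -real_normK ?num_real// expr2 mulrA.
  rewrite ler_wpM2r//.
  have hC : `|h| <= e / (C + 1).
    by near: h; apply: dnbhs0_le; rewrite divr_gt0// ltr_wpDl.
  rewrite (le_trans (ler_wpM2l C0 hC))// mulrCA ler_piMr// ?ltW//.
  by rewrite ltr_pdivrMr ?ltr_wpDl// mul1r ltrDl.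
apply: DeriveDef; first exact: (cvgP _ H).
by apply: cvg_lim H.
Unshelve. all: by end_near. Qed.

Lemma Ck_flat k (p : {poly R}) : Ck k [set: R] (flat p).
Proof.
elim: k p => [|k IH] p.
  split; last by [].
  move=> x _; apply/differentiable_continuous/derivable1_diffP.
  by have [] := is_derive_flat p x.
by apply: CkS_real (IH _); [exact: openT|move=> x _; exact: is_derive_flat].
Qed.

Definition bump0 := flat 1.

Lemma bump0_ge0 x : 0 <= bump0 x.
Proof.
rewrite /bump0 /flat; case: ifP => // _.
by rewrite hornerE mul1r expR_ge0.
Qed.

Lemma bump0_gt0 x : (0 < bump0 x) = (0 < x).
Proof.
rewrite /bump0 /flat; case: ifP => _; last by rewrite ltxx.
by rewrite hornerE mul1r expR_gt0.
Qed.

Lemma bump0_eq0 x : x <= 0 -> bump0 x = 0.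
Proof. by rewrite leNgt /bump0 /flat => /negbTE ->. Qed.

Lemma bump0_denom x : 0 < bump0 x + bump0 (1 - x).
Proof.
have [x0|x0] := ltP 0 x.
  by rewrite ltr_pwDl ?bump0_gt0 ?bump0_ge0.
rewrite ltr_wpDl ?bump0_gt0 ?bump0_ge0// subr_gt0.
by apply: le_lt_trans x0 _.
Qed.

Definition step (x : R) := bump0 x / (bump0 x + bump0 (1 - x)).

Lemma step_eq0 x : x <= 0 -> step x = 0.
Proof. by move=> x0; rewrite /step bump0_eq0// mul0r. Qed.

Lemma step_eq1 x : 1 <= x -> step x = 1.
Proof.
move=> x1; have := bump0_denom x; rewrite /step (@bump0_eq0 (1 - x)) ?subr_le0//.
by rewrite addr0 => x0; rewrite divff// gt_eqF.
Qed.

Lemma step_itv x : 0 <= step x <= 1.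
Proof.
rewrite /step divr_ge0 ?bump0_ge0// ?(ltW (bump0_denom x))//=.
by rewrite ler_pdivrMr ?bump0_denom// mul1r lerDl bump0_ge0.
Qed.

Lemma Ck_affine k (a b : R) : Ck k [set: R] (fun x => a * x + b).
Proof.
apply: CkD (Ck_cst _ _ _); first exact: openT.
by apply: CkM; [exact: openT|exact: Ck_cst|exact: Ck_id].
Qed.

Lemma Ck_comp_affine k (f : R -> R) (a b : R) : Ck k [set: R] f ->
  Ck k [set: R] (fun x => f (a * x + b)).
Proof.
by move=> Cf; apply: Ck_comp_real Cf (Ck_affine k a b) _ => //; exact: openT.
Qed.

Lemma Ck_step k : Ck k [set: R] step.
Proof.
have C1 : Ck k [set: R] (fun x => bump0 (1 - x)).
  have := Ck_comp_affine (-1) 1 (Ck_flat k 1).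
  by under eq_fun do rewrite mulN1r addrC.
apply: CkM; [exact: openT|exact: Ck_flat|].
apply: (@Ck_comp_real _ _ _ [set x : R | 0 < x] k
  (fun x => bump0 x + bump0 (1 - x)) (fun x => x^-1)).
- exact: openT.
- exact: Ck_inv.
- by apply: CkD => //; [exact: openT|exact: Ck_flat].
- by move=> x _; exact: bump0_denom.
Qed.

(** A smooth stand-in for the maximum of [b] and [s]: it is the identity above [b] and equals [b]
    below [b - e]. In between it may fall below [b], but not below [s]. *)
Definition cutoff (b e s : R) : R := b + (s - b) * step ((s - b) / e + 1).

Lemma cutoff_id b e s : 0 < e -> b <= s -> cutoff b e s = s.
Proof.
move=> e0 bs; rewrite /cutoff step_eq1 ?mulr1; first by rewrite addrC subrK.
by rewrite lerDr divr_ge0 ?subr_ge0// ltW.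
Qed.

Lemma cutoff_cst b e s : 0 < e -> s <= b - e -> cutoff b e s = b.
Proof.
move=> e0 bs; rewrite /cutoff step_eq0 ?mulr0 ?addr0//.
by rewrite -lerBrDr sub0r ler_pdivrMr// mulN1r lerBlDl.
Qed.

Lemma cutoff_le b e s : 0 < e -> s <= b -> b - e <= cutoff b e s <= b.
Proof.
move=> e0 sb; have [se|se] := leP s (b - e).
  by rewrite cutoff_cst// lexx andbT lerBlDr lerDl ltW.
rewrite /cutoff; have /andP[s0 s1] := step_itv ((s - b) / e + 1).
have sb0 : s - b <= 0 by rewrite subr_le0.
apply/andP; split; last by rewrite gerDl mulr_le0_ge0.
rewrite lerD2l (@le_trans _ _ (s - b))//; first by rewrite lerBrDr addrC ltW.
by rewrite -[leLHS]mulr1 ler_wnM2l.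
Qed.

Lemma Ck_cutoff k b e : Ck k [set: R] (cutoff b e).
Proof.
apply: CkD (Ck_cst _ _ _) _; first exact: openT.
apply: CkM; first exact: openT.
  have := Ck_affine k 1 (- b); by under eq_fun do rewrite mul1r.
have := Ck_comp_affine (e^-1) (1 - b / e) (Ck_step k).
apply: Ck_eq; first exact: openT.
by move=> x _; congr step; rewrite mulrBl [in RHS]addrAC addrA mulrC -addrA (addrC 1).
Qed.

Definition bumpR (a r t : R) := bump0 (t - a + r) * bump0 (a + r - t).

Lemma Ck_bumpR k a r : Ck k [set: R] (bumpR a r).
Proof.
apply: CkM; first exact: openT.
  have := Ck_comp_affine 1 (- a + r) (Ck_flat k 1).
  by under eq_fun do rewrite mul1r addrA.
have := Ck_comp_affine (-1) (a + r) (Ck_flat k 1).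
by under eq_fun do rewrite mulN1r addrC.
Qed.

Lemma bumpR_ge0 a r t : 0 <= bumpR a r t.
Proof. by rewrite mulr_ge0 ?bump0_ge0. Qed.

Lemma bumpR_gt0 (a r t : R) : `|t - a| < r -> 0 < bumpR a r t.
Proof.
rewrite ltr_distlC => /andP[h1 h2].
have A : 0 < t - a + r by lra.
have B : 0 < a + r - t by lra.
by rewrite /bumpR mulr_gt0// bump0_gt0.
Qed.

Lemma bumpR_eq0 (a r t : R) : r <= `|t - a| -> bumpR a r t = 0.
Proof.
rewrite leNgt ltr_distlC negb_and -!leNgt => /orP[h|h].
  by rewrite /bumpR mulrC bump0_eq0 ?mul0r//; lra.
by rewrite /bumpR bump0_eq0 ?mul0r//; lra.
Qed.

End smooth_step.

(** * Charts and the Laplace-Beltrami operator *)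

Section opposite.
Context {R : realType} {V : normedModType R}.

Lemma CkN (U : set V) k (f : V -> R) : open U -> Ck k U f ->
  Ck k U (fun x => - f x).
Proof.
move=> oU Cf; under eq_fun do rewrite -mulN1r.
by apply: CkM => //; exact: Ck_cst.
Qed.

Lemma CkB (U : set V) k (f h : V -> R) : open U -> Ck k U f -> Ck k U h ->
  Ck k U (fun x => f x - h x).
Proof. by move=> oU Cf Ch; apply: CkD => //; exact: CkN. Qed.

Lemma is_derive_mul (f h : V -> R) (x v : V) (df dh : R) :
  is_derive x v f df -> is_derive x v h dh ->
  is_derive x v (fun y => f y * h y) (f x * dh + h x * df).
Proof. exact: is_deriveM. Qed.

Lemma is_derive_sub (f h : V -> R) (x v : V) (df dh : R) :
  is_derive x v f df -> is_derive x v h dh ->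
  is_derive x v (fun y => f y - h y) (df - dh).
Proof. exact: is_deriveB. Qed.

Lemma is_derive_cmul (k : R) (f : V -> R) (x v : V) (df : R) :
  is_derive x v f df -> is_derive x v (fun y => k * f y) (k * df).
Proof. exact: is_deriveZ. Qed.

End opposite.

(** * Explicit formulas for 2x2 matrices *)

Section mat2.
Context {R : comUnitRingType}.
Implicit Types A : 'M[R]_2.

Lemma ord2P (P : 'I_2 -> Prop) : P 0 -> P 1 -> forall i, P i.
Proof.
move=> P0 P1 [[|[|//]] Hi]; first by rewrite (_ : Ordinal Hi = 0)//; exact: val_inj.
by rewrite (_ : Ordinal Hi = 1)//; exact: val_inj.
Qed.

Lemma sum2 (V : nmodType) (F : 'I_2 -> V) : \sum_(i < 2) F i = F 0 + F 1.
Proof.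
rewrite !big_ord_recl big_ord0 addr0; congr (_ + F _); exact: val_inj.
Qed.

Lemma det2 A : \det A = A 0 0 * A 1 1 - A 0 1 * A 1 0.
Proof.
rewrite (expand_det_row _ 0) sum2 /cofactor !det_mx11 !mxE /=.
rewrite !add0n expr0 expr1 mul1r mulN1r mulrN.
congr (_ * A _ _ - _ * A _ _); exact: val_inj.
Qed.

Lemma adj2 A : \adj A = \matrix_(i, j)
  if i == 0 then if j == 0 then A 1 1 else - A 0 1
  else if j == 0 then - A 1 0 else A 0 0.
Proof.
apply/matrixP => i j; rewrite !mxE /cofactor det_mx11 !mxE.
move: i j; apply: ord2P; apply: ord2P => /=;
  rewrite ?add0n ?addn0 ?expr0 ?expr1 ?mul1r ?mulN1r ?addn1 ?expr2 ?mulrNN ?mul1r;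
  congr (A _ _) || congr (- A _ _); exact: val_inj.
Qed.

Lemma invmx2 A (w : 'cV[R]_2) i : A \in unitmx ->
  (invmx A *m w) i 0 = (\det A)^-1 *
   (if i == 0 then A 1 1 * w 0 0 - A 0 1 * w 1 0
    else A 0 0 * w 1 0 - A 1 0 * w 0 0).
Proof.
move=> Au; rewrite /invmx Au adj2 -scalemxAl !mxE sum2 !mxE.
by move: i; apply: ord2P => /=; congr (_ * _); ring.
Qed.

End mat2.

Section change_of_chart_algebra.
Context {F : fieldType}.
Variables a1 a2 b1 b2 : F.

(** The identity det(J^T h J) = det(J)^2 det(h) in entries, where the rows of J, with entries [a1],
    [a2] and [b1], [b2], are the differentials of the two components of a transition map. *)
Lemma det_pullback (h00 h01 h10 h11 : F) :
  (a1 * (h00 * a1 + h01 * b1) + b1 * (h10 * a1 + h11 * b1)) *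
  (a2 * (h00 * a2 + h01 * b2) + b2 * (h10 * a2 + h11 * b2)) -
  (a1 * (h00 * a2 + h01 * b2) + b1 * (h10 * a2 + h11 * b2)) *
  (a2 * (h00 * a1 + h01 * b1) + b2 * (h10 * a1 + h11 * b1)) =
  (a1 * b2 - a2 * b1) ^+ 2 * (h00 * h11 - h01 * h10).
Proof. ring. Qed.

(** To be read with [n] = |det J| and [w] the density in the new chart: the flux of a function
    transforms by the adjugate of J, up to the sign of det J. *)
Lemma flux_pullback (h00 h01 h11 n w f1 f2 : F) : n != 0 -> w != 0 ->
  (n * w)^-1 *
  ((a2 * (h00 * a2 + h01 * b2) + b2 * (h01 * a2 + h11 * b2)) * (f1 * a1 + f2 * b1)
   - (a1 * (h00 * a2 + h01 * b2) + b1 * (h01 * a2 + h11 * b2)) * (f1 * a2 + f2 * b2)) =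
  (a1 * b2 - a2 * b1) / n *
  (b2 * (w^-1 * (h11 * f1 - h01 * f2)) - a2 * (w^-1 * (h00 * f2 - h01 * f1))) /\
  (n * w)^-1 *
  ((a1 * (h00 * a1 + h01 * b1) + b1 * (h01 * a1 + h11 * b1)) * (f1 * a2 + f2 * b2)
   - (a2 * (h00 * a1 + h01 * b1) + b2 * (h01 * a1 + h11 * b1)) * (f1 * a1 + f2 * b1)) =
  (a1 * b2 - a2 * b1) / n *
  (a1 * (w^-1 * (h00 * f2 - h01 * f1)) - b1 * (w^-1 * (h11 * f1 - h01 * f2))).
Proof. by move=> n0 w0; split; field; apply/andP. Qed.

(* Piola's identity: the columns of the adjugate of a Jacobian matrix are
   divergence free, by equality of the mixed derivatives m1 and m2. *)
Lemma piola (s v m1 m2 w0 w1 x1 x2 y1 y2 : F) :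
  s != 0 -> v != 0 -> a1 * b2 - a2 * b1 != 0 ->
  (s * (a1 * b2 - a2 * b1) * v)^-1 *
  (s * (b2 * (x1 * a1 + x2 * b1) + w0 * m2 - (a2 * (y1 * a1 + y2 * b1) + w1 * m1)) +
   s * (a1 * (y1 * a2 + y2 * b2) + w1 * m1 - (b1 * (x1 * a2 + x2 * b2) + w0 * m2))) =
  v^-1 * (x1 + y2).
Proof. by move=> s0 v0 J0; field; rewrite s0 v0 J0. Qed.

End change_of_chart_algebra.

Section charts.
Context {R : realType} {M : topologicalType} (S : riemannian_surface R M).
Implicit Types (c : chart R M).
#[local] Opaque derive.
Notation e1 := (Defs.basis R 0).
Notation e2 := (Defs.basis R 1).
Notation g := (metric S).

Lemma atlas_chart c : atlas S c -> is_chart c.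
Proof. by case: (atlasP S) => H _ _; exact: H. Qed.

Section one_chart.
Variable c : chart R M.
Hypothesis Ac : atlas S c.

Lemma cimg_open : open (cimg c). Proof. by case: (atlas_chart Ac). Qed.
Lemma cdom_open : open (cdom c). Proof. by case: (atlas_chart Ac). Qed.
Lemma cmapK p : cdom c p -> cinv c (cmap c p) = p.
Proof. by case: (atlas_chart Ac) => _ _ H _ _; exact: H. Qed.
Lemma cmap_continuous p : cdom c p -> {for p, continuous (cmap c)}.
Proof. by case: (atlas_chart Ac) => _ _ _ H _; exact: H. Qed.
Lemma cinv_continuous u : cimg c u -> {for u, continuous (cinv c)}.
Proof. by case: (atlas_chart Ac) => _ _ _ _ H; exact: H. Qed.
Lemma cimg_cmap p : cdom c p -> cimg c (cmap c p).
Proof. by move=> cp; exists p. Qed.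
Lemma cdom_cinv u : cimg c u -> cdom c (cinv c u).
Proof. by move=> [p cp <-]; rewrite cmapK. Qed.
Lemma cinvK u : cimg c u -> cmap c (cinv c u) = u.
Proof. by move=> [p cp <-]; rewrite cmapK. Qed.

Lemma open_chart_preimage (A : set M) : open A ->
  open [set u | cimg c u /\ A (cinv c u)].
Proof.
move=> oA; rewrite openE => u [cu Au].
have : \forall v \near u, A (cinv c v).
  by apply: (cinv_continuous cu); exact: open_nbhs_nbhs.
by apply: filterS2 (open_nbhs_nbhs (conj cimg_open cu)) => v; split.
Qed.

Lemma open_chart_image (A : set (R * R)) : open A ->
  open [set p | cdom c p /\ A (cmap c p)].
Proof.
move=> oA; rewrite openE => p [cp Ap].
have : \forall q \near p, A (cmap c q).
  by apply: (cmap_continuous cp); exact: open_nbhs_nbhs.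
by apply: filterS2 (open_nbhs_nbhs (conj cdom_open cp)) => v; split.
Qed.

End one_chart.

Definition overlap c c' : set (R * R) := [set u | cimg c u /\ cdom c' (cinv c u)].

Lemma overlapE c c' : atlas S c -> cmap c @` (cdom c `&` cdom c') = overlap c c'.
Proof.
move=> Ac; apply/seteqP; split=> u.
  by move=> [p [cp c'p] <-]; split; [exists p|rewrite cmapK].
by move=> [cu c'u]; exists (cinv c u); [split=> //; exact: cdom_cinv|rewrite cinvK].
Qed.

Lemma open_overlap c c' : atlas S c -> atlas S c' -> open (overlap c c').
Proof.
by move=> Ac Ac'; apply: open_chart_preimage => //; exact: cdom_open.
Qed.

Lemma transition_smooth c c' : atlas S c -> atlas S c' ->
  smooth (overlap c c') (transition c c').
Proof.
move=> Ac Ac'; rewrite -overlapE//; case: (atlasP S) => _ _; exact.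
Qed.

Lemma transitionK c c' u : atlas S c' -> overlap c c' u ->
  cinv c' (transition c c' u) = cinv c u.
Proof. by move=> Ac' [cu c'u]; rewrite /transition cmapK. Qed.

Lemma Ck_transition c c' k (A U : set (R * R)) (F : R * R -> R) :
  atlas S c -> atlas S c' -> open A -> open U -> U `<=` overlap c c' ->
  (forall u, U u -> A (transition c c' u)) -> Ck k A F ->
  Ck k U (fun u => F (transition c c' u)).
Proof.
move=> Ac Ac' oA oU UO UA CF.
have CT : Ck k U (transition c c') by apply: Ck_sub UO _; exact: transition_smooth.
have -> : (fun u => F (transition c c' u)) =
    (fun u => F ((transition c c' u).1, (transition c c' u).2)).
  by apply/funext => u; case: (transition c c' u).
apply: Ck_comp_plane oU oA CF (Ck_fst oU CT) (Ck_snd oU CT) _.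
by move=> u /UA; case: (transition c c' u).
Qed.

Lemma metric_symE c u i j : atlas S c -> cimg c u -> g c u i j = g c u j i.
Proof. by move=> Ac cu; rewrite -[in LHS](Defs.metric_sym Ac cu) mxE. Qed.

Definition quad (A : 'M[R]_2) (v : R * R) : R :=
  A 0 0 * v.1 ^+ 2 + (A 0 1 + A 1 0) * (v.1 * v.2) + A 1 1 * v.2 ^+ 2.

Lemma quadE (A : 'M[R]_2) (v : R * R) :
  ((\col_i Defs.coord i v)^T *m A *m \col_i Defs.coord i v) 0 0 = quad A v.
Proof.
rewrite !mxE sum2 !mxE !sum2 !mxE /Defs.coord /quad /=; ring.
Qed.

Lemma quad_pos c u v : atlas S c -> cimg c u -> v != 0 -> 0 < quad (g c u) v.
Proof.
move=> Ac cu v0; rewrite -quadE; apply: Defs.metric_pos => //.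
apply: contra v0 => /eqP/matrixP v0; apply/eqP.
have := v0 0 0; have := v0 1 0; rewrite !mxE /Defs.coord /=.
by case: v {v0} => a b /= -> ->.
Qed.

Lemma quad_ge0 c u v : atlas S c -> cimg c u -> 0 <= quad (g c u) v.
Proof.
move=> Ac cu; have [->|v0] := eqVneq v 0; last by apply/ltW/quad_pos.
by rewrite /quad /= !(expr0n, mulr0, mul0r) !addr0.
Qed.

Lemma metric00_gt0 c u : atlas S c -> cimg c u -> 0 < g c u 0 0.
Proof.
move=> Ac cu; have := @quad_pos c u (1, 0) Ac cu.
rewrite /quad /= expr1n !mulr0 expr0n mulr1 mulr0 !addr0; apply.
by apply/eqP => -[] /eqP; rewrite oner_eq0.
Qed.

(** At the vector (-g01, g00) the quadratic form equals g00 times the determinant. *)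
Lemma metric_det_gt0 c u : atlas S c -> cimg c u -> 0 < \det (g c u).
Proof.
move=> Ac cu; have g0 := metric00_gt0 Ac cu.
have := @quad_pos c u (- g c u 0 1, g c u 0 0) Ac cu.
rewrite det2 /quad /= (metric_symE 1 0)//.
set a := g c u 0 0 in g0 *; set b := g c u 0 1; set d := g c u 1 1.
rewrite (_ : a * (- b) ^+ 2 + _ + _ = a * (a * d - b * b)); last by ring.
by rewrite pmulr_rgt0//; apply; apply/eqP => -[_] /eqP; rewrite gt_eqF.
Qed.

Lemma metric_unit c u : atlas S c -> cimg c u -> g c u \in unitmx.
Proof. by move=> Ac cu; rewrite unitmxE unitfE gt_eqF// metric_det_gt0. Qed.

Lemma vdensity_gt0 c u : atlas S c -> cimg c u -> 0 < vdensity S c u.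
Proof. by move=> Ac cu; rewrite sqrtr_gt0 metric_det_gt0. Qed.

(* The smallest eigenvalue of a positive 2x2 matrix is at least its determinant
   divided by its trace. *)
Lemma quad_lower c u v : atlas S c -> cimg c u ->
  \det (g c u) * (v.1 ^+ 2 + v.2 ^+ 2) <= (g c u 0 0 + g c u 1 1) * quad (g c u) v.
Proof.
move=> Ac cu; rewrite det2 /quad (metric_symE 1 0)//.
set a := g c u 0 0; set b := g c u 0 1; set d := g c u 1 1.
(* By Cayley-Hamilton the difference is the squared Euclidean norm of g v. *)
rewrite -subr_ge0 (_ : _ - _ = (a * v.1 + b * v.2) ^+ 2 + (b * v.1 + d * v.2) ^+ 2).
  by rewrite addr_ge0 ?sqr_ge0.
ring.
Qed.

Lemma quad_upper (A : 'M[R]_2) (v : R * R) B : (forall i j, `|A i j| <= B) ->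
  quad A v <= 4 * B * `|v| ^+ 2.
Proof.
move=> AB.
have n1 : `|v.1| <= `|v| by rewrite prod_normE /= le_max lexx.
have n2 : `|v.2| <= `|v| by rewrite prod_normE /= le_max lexx orbT.
have B0 : 0 <= B by apply: le_trans (AB 0 0).
have K (a x y : R) : `|a| <= B -> `|x| <= `|v| -> `|y| <= `|v| ->
    a * (x * y) <= B * `|v| ^+ 2.
  move=> aB xv yv; rewrite (le_trans (ler_norm _))// !normrM expr2.
  by rewrite ler_pM// ?mulr_ge0// ler_pM.
rewrite /quad mulrDl !expr2.
have := K _ _ _ (AB 0 0) n1 n1; have := K _ _ _ (AB 0 1) n1 n2.
have := K _ _ _ (AB 1 0) n1 n2; have := K _ _ _ (AB 1 1) n2 n2.
rewrite !expr2; lra.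
Qed.

Lemma Ck_det c k : atlas S c -> Ck k (cimg c) (fun u => \det (g c u)).
Proof.
move=> Ac; have oC := cimg_open Ac; under eq_fun do rewrite det2.
have G i j : Ck k (cimg c) (fun u => g c u i j) by exact: Defs.metric_smooth.
by apply: CkB => //; apply: CkM => //; exact: G.
Qed.

Lemma Ck_vdensity c k : atlas S c -> Ck k (cimg c) (vdensity S c).
Proof.
move=> Ac.
apply: (@Ck_comp_real _ _ _ [set x : R | 0 < x] k (fun u => \det (g c u)) Num.sqrt).
- exact: cimg_open.
- exact: Ck_sqrt.
- exact: Ck_det.
- by move=> u cu; exact: metric_det_gt0.
Qed.

(** The Euclidean divergence of this field is the density times the Laplacian. *)
Definition flux c (f : M -> R) (i : 'I_2) (u : R * R) : R :=
  vdensity S c u * gradient S c f u i 0.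

Lemma divergence_flux c f u : divergence S c (gradient S c f) u =
  (vdensity S c u)^-1 * ('D_e1 (flux c f 0) u + 'D_e2 (flux c f 1) u).
Proof. by rewrite /divergence sum2. Qed.

(** The inverse metric is the adjugate over the determinant, and the density is the root of the
    determinant; together they leave one factor density^-1. *)
Lemma fluxE c f i u : atlas S c -> cimg c u ->
  flux c f i u = (vdensity S c u)^-1 *
   (if i == 0 then g c u 1 1 * 'D_e1 (f \o cinv c) u - g c u 0 1 * 'D_e2 (f \o cinv c) u
    else g c u 0 0 * 'D_e2 (f \o cinv c) u - g c u 1 0 * 'D_e1 (f \o cinv c) u).
Proof.
move=> Ac cu; rewrite /flux /gradient invmx2 ?metric_unit// mulrA.
have d0 := metric_det_gt0 Ac cu.
congr (_ * _); last by rewrite !mxE.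
rewrite /vdensity -[in X in _ * X](sqr_sqrtr (ltW d0)) expr2 invfM mulrA divff ?mul1r//.
by rewrite gt_eqF// sqrtr_gt0.
Qed.

Lemma Ck_flux c f i k (U : set (R * R)) : atlas S c -> open U -> U `<=` cimg c ->
  Ck k.+1 U (f \o cinv c) -> Ck k U (flux c f i).
Proof.
move=> Ac oU UC [_ Cf].
have G i' j' : Ck k U (fun u => g c u i' j').
  by apply: Ck_sub UC _; exact: Defs.metric_smooth.
have V1 : Ck k U (fun u => (vdensity S c u)^-1).
  apply: (@Ck_comp_real _ _ _ [set x : R | 0 < x] k (vdensity S c) (fun x => x^-1)) => //.
  - exact: Ck_inv.
  - by apply: Ck_sub UC _; exact: Ck_vdensity.
  - by move=> u /UC cu; exact: vdensity_gt0.
apply: (@Ck_eq _ _ _ _ _ (fun u => (vdensity S c u)^-1 *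
   (if i == 0 then g c u 1 1 * 'D_e1 (f \o cinv c) u - g c u 0 1 * 'D_e2 (f \o cinv c) u
    else g c u 0 0 * 'D_e2 (f \o cinv c) u - g c u 1 0 * 'D_e1 (f \o cinv c) u))) => //.
  by move=> u /UC cu; rewrite fluxE.
case: (i == 0); (apply: CkM => //); apply: CkB => //; apply: CkM => //;
  solve [exact: (Cf _).2 | exact: G].
Qed.

(** * Invariance of the Laplacian under change of chart *)

Section change_of_chart.
Variables (c c' : chart R M) (f : M -> R) (A : set (R * R)) (p : M).
Hypotheses (Ac : atlas S c) (Ac' : atlas S c') (cp : cdom c p) (c'p : cdom c' p).
Hypotheses (oA : open A) (AC : A `<=` cimg c') (Ap : A (cmap c' p))
  (Cf : Ck 2 A (f \o cinv c')).

Let T1 u := (transition c c' u).1.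
Let T2 u := (transition c c' u).2.
Let U : set (R * R) := overlap c c' `&` [set u | A (transition c c' u)].

Let oU : open U.
Proof.
rewrite openE => u [Ou Au].
have cT : {for u, continuous (transition c c')}.
  exact: (Ck_continuous (transition_smooth Ac Ac' 0) Ou).
have : \forall v \near u, A (transition c c' v).
  by apply: cT; exact: open_nbhs_nbhs.
by apply: filterS2 (open_nbhs_nbhs (conj (open_overlap Ac Ac') Ou)) => v; split.
Qed.

Let Up : U (cmap c p).
Proof. by split; [split; rewrite ?cmapK//; exact: cimg_cmap|rewrite /= /transition cmapK]. Qed.

Let CT1 k : Ck k U T1.
Proof.
apply: (@Ck_fst _ _ U k (transition c c') oU).
apply: (@Ck_sub _ _ _ (overlap c c') U); first by move=> u [].
exact: transition_smooth.
Qed.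

Let CT2 k : Ck k U T2.
Proof.
apply: (@Ck_snd _ _ U k (transition c c') oU).
apply: (@Ck_sub _ _ _ (overlap c c') U); first by move=> u [].
exact: transition_smooth.
Qed.

Let TE u : transition c c' u = (T1 u, T2 u).
Proof. by rewrite /T1 /T2; case: (transition c c' u). Qed.

Let derive_pullback (F : R * R -> R) u v : Ck 1 A F -> U u ->
  is_derive u v (fun w => F (transition c c' w))
   ('D_e1 F (transition c c' u) * 'D_v T1 u + 'D_e2 F (transition c c' u) * 'D_v T2 u).
Proof.
move=> CF Uu; have Au : A (T1 u, T2 u) by rewrite -TE; case: Uu.
under eq_fun do rewrite TE; rewrite TE.
apply: Ck1_chain oA CF Au _ _; apply: derivableP.
  by have [_ /(_ v)[H _]] := CT1 1; exact: H.
by have [_ /(_ v)[H _]] := CT2 1; exact: H.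
Qed.

Let df u v : U u -> 'D_v (f \o cinv c) u =
  'D_e1 (f \o cinv c') (transition c c' u) * 'D_v T1 u +
  'D_e2 (f \o cinv c') (transition c c' u) * 'D_v T2 u.
Proof.
move=> Uu; have [_ <-] := derive_pullback v (Ck_S Cf) Uu.
apply: near_eq_derive; apply: filterS (open_nbhs_nbhs (conj oU Uu)) => w [Ow _].
by rewrite /= transitionK.
Qed.

Let jacE u : jac (transition c c') u = \matrix_(i, j)
  (if i == 0 then 'D_(Defs.basis R j) T1 u else 'D_(Defs.basis R j) T2 u).
Proof.
by apply/matrixP => i j; rewrite !mxE; move: i; exact: ord2P.
Qed.

Let detJ (u : R * R) : R := 'D_e1 T1 u * 'D_e2 T2 u - 'D_e2 T1 u * 'D_e1 T2 u.

Let gE u : U u -> g c u = (jac (transition c c') u)^T *m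
  g c' (transition c c' u) *m jac (transition c c') u.
Proof.
move=> [[cu c'u] Au]; have := metric_change Ac Ac' (cdom_cinv Ac cu) c'u.
by rewrite /= !cinvK.
Qed.

Let UC u : U u -> cimg c u. Proof. by case=> -[]. Qed.
Let UC' u : U u -> cimg c' (transition c c' u). Proof. by move=> -[_ /AC]. Qed.

Let gcompE u : U u ->
  let h := g c' (transition c c' u) in
  let a1 := 'D_e1 T1 u in let a2 := 'D_e2 T1 u in
  let b1 := 'D_e1 T2 u in let b2 := 'D_e2 T2 u in
  [/\ g c u 0 0 = a1 * (h 0 0 * a1 + h 0 1 * b1) + b1 * (h 1 0 * a1 + h 1 1 * b1),
      g c u 0 1 = a1 * (h 0 0 * a2 + h 0 1 * b2) + b1 * (h 1 0 * a2 + h 1 1 * b2),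
      g c u 1 0 = a2 * (h 0 0 * a1 + h 0 1 * b1) + b2 * (h 1 0 * a1 + h 1 1 * b1) &
      g c u 1 1 = a2 * (h 0 0 * a2 + h 0 1 * b2) + b2 * (h 1 0 * a2 + h 1 1 * b2)].
Proof.
move=> Uu h a1 a2 b1 b2.
by split; rewrite gE// -mulmxA !mxE sum2 !mxE !sum2 jacE !mxE /=.
Qed.

Let detE u : U u -> \det (g c u) = detJ u ^+ 2 * \det (g c' (transition c c' u)).
Proof.
move=> Uu; have [E00 E01 E10 E11] := gcompE Uu.
by rewrite !det2 E00 E01 E10 E11; exact: det_pullback.
Qed.

Let detJ_neq0 u : U u -> detJ u != 0.
Proof.
move=> Uu; have := metric_det_gt0 Ac (UC Uu); rewrite detE//.
by apply: contraTneq => ->; rewrite expr0n mul0r ltxx.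
Qed.

Let vdE u : U u -> vdensity S c u = `|detJ u| * vdensity S c' (transition c c' u).
Proof.
by move=> Uu; rewrite /vdensity detE// sqrtrM ?sqr_ge0// sqrtr_sqr.
Qed.

Lemma fluxT u : U u ->
  flux c f 0 u = Num.sg (detJ u) * ('D_e2 T2 u * flux c' f 0 (transition c c' u)
    - 'D_e2 T1 u * flux c' f 1 (transition c c' u)) /\
  flux c f 1 u = Num.sg (detJ u) * ('D_e1 T1 u * flux c' f 1 (transition c c' u)
    - 'D_e1 T2 u * flux c' f 0 (transition c c' u)).
Proof.
move=> Uu; have cu := UC Uu; have c'u := UC' Uu.
have [E00 E01 E10 E11] := gcompE Uu.
have hs := metric_symE 1 0 Ac' c'u.
have J0 := detJ_neq0 Uu; have v0 := vdensity_gt0 Ac' c'u.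
have sgE : Num.sg (detJ u) = detJ u / `|detJ u|.
  by rewrite {2}[detJ u]numEsg mulfK// normr_eq0.
have n0 : `|detJ u| != 0 by rewrite normr_eq0.
have vn0 : vdensity S c' (transition c c' u) != 0 by rewrite gt_eqF.
rewrite !fluxE//= vdE// E00 E01 E10 E11 hs !df// sgE.
exact: flux_pullback.
Qed.

(** Transition maps may reverse orientation. Their Jacobian determinant is continuous and nonzero,
    so its sign is locally constant and can be pulled out of the derivatives. *)
Let sign_near : exists2 s : R, s * s = 1 &
  \forall u \near cmap c p, Num.sg (detJ u) = s.
Proof.
have CJ : Ck 0 U detJ.
  have [_ d1] := CT1 1; have [_ d2] := CT2 1.
  have D1 v : Ck 0 U ('D_v T1) := (d1 v).2.
  have D2 v : Ck 0 U ('D_v T2) := (d2 v).2.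
  exact: CkB oU (CkM oU (D1 e1) (D2 e2)) (CkM oU (D1 e2) (D2 e1)).
have cJ := Ck_continuous CJ Up.
have [Jp|Jp|Jp] := ltgtP (detJ (cmap c p)) 0; last 1 first.
- by have := detJ_neq0 Up; rewrite Jp eqxx.
- exists (-1); first by rewrite mulrNN mulr1.
  have : \forall u \near cmap c p, detJ u < 0.
    by apply: (cJ [set x | x < 0]); exact: lt_nbhsl.
  by apply: filterS => u /ltr0_sg.
- exists 1; first by rewrite mulr1.
  have : \forall u \near cmap c p, 0 < detJ u.
    by apply: (cJ [set x | 0 < x]); exact: lt_nbhsr.
  by apply: filterS => u /gtr0_sg.
Qed.

(** By [fluxT] the flux transforms by the adjugate of the Jacobian; differentiating this produces
    second derivatives of the transition map, which cancel by [schwarz] and [piola]. *)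
Lemma divergence_change : divergence S c (gradient S c f) (cmap c p) =
  divergence S c' (gradient S c' f) (cmap c' p).
Proof.
have [s ss sE] := sign_near.
have Tp : transition c c' (cmap c p) = cmap c' p by rewrite /transition cmapK.
have Uu := Up; rewrite !divergence_flux; move: sE Uu Tp.
set u := cmap c p => sE Uu Tp.
have CW i : Ck 1 A (flux c' f i) by apply: Ck_flux.
pose w i v := flux c' f i (transition c c' v).
have dw i v : is_derive u v (w i)
  ('D_e1 (flux c' f i) (cmap c' p) * 'D_v T1 u +
   'D_e2 (flux c' f i) (cmap c' p) * 'D_v T2 u).
  by rewrite -Tp; exact: derive_pullback.
have dT1 v v' : is_derive u v' (fun x => 'D_v T1 x) ('D_v' ('D_v T1) u).
  by apply: derivableP; have [_ /(_ v)[_ [_ /(_ v')[H _]]]] := CT1 2; exact: H.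
have dT2 v v' : is_derive u v' (fun x => 'D_v T2 x) ('D_v' ('D_v T2) u).
  by apply: derivableP; have [_ /(_ v)[_ [_ /(_ v')[H _]]]] := CT2 2; exact: H.
have E0 : \forall x \near u, flux c f 0 x =
    s * ('D_e2 T2 x * w 0 x - 'D_e2 T1 x * w 1 x).
  apply: filterS2 (open_nbhs_nbhs (conj oU Uu)) sE => x Vx sx.
  by rewrite (fluxT Vx).1 sx.
have E1 : \forall x \near u, flux c f 1 x =
    s * ('D_e1 T1 x * w 1 x - 'D_e1 T2 x * w 0 x).
  apply: filterS2 (open_nbhs_nbhs (conj oU Uu)) sE => x Vx sx.
  by rewrite (fluxT Vx).2 sx.
rewrite (near_eq_derive _ E0) (near_eq_derive _ E1).
have sw i : w i u = flux c' f i (cmap c' p) by rewrite /w Tp.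
have D0 := is_derive_cmul s
  (is_derive_sub (is_derive_mul (dT2 e2 e1) (dw 0 e1)) (is_derive_mul (dT1 e2 e1) (dw 1 e1))).
have D1 := is_derive_cmul s
  (is_derive_sub (is_derive_mul (dT1 e1 e2) (dw 1 e2)) (is_derive_mul (dT2 e1 e2) (dw 0 e2))).
case: D0 => _ ->; case: D1 => _ ->.
rewrite (schwarz e2 e1 oU (CT1 2) Uu) (schwarz e2 e1 oU (CT2 2) Uu) !sw.
have J0 := detJ_neq0 Uu.
have -> : vdensity S c u = s * detJ u * vdensity S c' (cmap c' p).
  rewrite vdE// Tp -(nbhs_singleton sE); congr (_ * _).
  exact: normrEsg.
have vn0 : vdensity S c' (cmap c' p) != 0.
  by rewrite gt_eqF//; apply: vdensity_gt0 => //; exact: cimg_cmap.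
have s0 : s != 0 by apply: contra_eq_neq ss => ->; rewrite mul0r eq_sym oner_eq0.
exact: piola.
Qed.

End change_of_chart.

End charts.

(** * Lengths of curves *)

Lemma pair_ext {A B : Type} (x y : A * B) : x.1 = y.1 -> x.2 = y.2 -> x = y.
Proof. by case: x; case: y => ? ? ? ? /= -> ->. Qed.

Lemma convex_lt {R : realFieldType} (t a b r : R) : 0 <= t -> t <= 1 ->
  a < r -> b < r -> (1 - t) * a + t * b < r.
Proof.
move=> t0 t1 ar br; have [->|tn0] := eqVneq t 0.
  by rewrite subr0 mul1r mul0r addr0.
have -> : r = (1 - t) * r + t * r by ring.
rewrite ler_ltD//; first by rewrite ler_wpM2l ?subr_ge0// ltW.
by rewrite ltr_pM2l// lt_neqAle eq_sym tn0.
Qed.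

Section unit_segment.
Context {R : realType}.
Implicit Types (f q : R -> R).
Notation mu := (@lebesgue_measure R).

Lemma within_unit f : (forall t : R, 0 <= t <= 1 -> {for t, continuous f}) ->
  {within `[0%R, 1%R], continuous f}.
Proof.
by move=> cf; apply: continuous_in_subspaceT => t; rewrite inE/= in_itv/=; exact: cf.
Qed.

Lemma integrable_unit f : (forall t : R, 0 <= t <= 1 -> {for t, continuous f}) ->
  mu.-integrable `[0%R, 1%R] (EFin \o f).
Proof.
move=> cf; apply: continuous_compact_integrable; first exact: segment_compact.
exact: within_unit.
Qed.

Lemma increment_le_Rintegral (phi dphi q : R -> R) :
  (forall t : R, 0 <= t <= 1 -> is_derive t 1 phi (dphi t)) ->
  (forall t : R, 0 <= t <= 1 -> {for t, continuous dphi}) ->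
  (forall t : R, 0 <= t <= 1 -> {for t, continuous q}) ->
  (forall t : R, 0 <= t <= 1 -> `|dphi t| <= q t) ->
  `|phi 1 - phi 0| <= \int[mu]_(t in `[0%R, 1%R]) q t.
Proof.
move=> dp cd cq dq.
have i0 : 0 <= (0 : R) <= 1 by rewrite lexx ler01.
have i1 : 0 <= (1 : R) <= 1 by rewrite lexx ler01.
have cp t : 0 <= t <= 1 -> {for t, continuous phi}.
  by move=> /dp[H _]; apply/differentiable_continuous/derivable1_diffP.
have -> : phi 1 - phi 0 = \int[mu]_(t in `[0%R, 1%R]) dphi t.
  rewrite /Rintegral (@continuous_FTC2 _ dphi phi 0 1 ltr01)//.
  - exact: within_unit.
  - split.
    + by move=> t; rewrite in_itv/= => /andP[t0 t1]; have [] := dp t; rewrite ?ltW.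
    + by apply: cvg_at_right_filter; exact: cp.
    + by apply: cvg_at_left_filter; exact: cp.
  - move=> t; rewrite in_itv/= => /andP[t0 t1]; rewrite derive1E.
    by have [|_ ->] := dp t; rewrite ?ltW.
apply: le_trans (le_normr_Rintegral _ (integrable_unit cd)) _ => //.
apply: le_Rintegral => //.
- apply: integrable_unit => t t01.
  by apply: continuous_comp (cd _ t01) _; exact: norm_continuous.
- exact: integrable_unit.
Qed.

Lemma Rintegral_unit_le q (B : R) :
  (forall t : R, 0 <= t <= 1 -> {for t, continuous q}) ->
  (forall t : R, 0 <= t <= 1 -> q t <= B) ->
  \int[mu]_(t in `[0%R, 1%R]) q t <= B.
Proof.
move=> cq qB; apply: (@le_trans _ _ (\int[mu]_(t in `[0%R, 1%R]) cst B t)).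
  apply: le_Rintegral => //; first exact: integrable_unit.
  by apply: integrable_unit => t _; exact: cst_continuous.
rewrite Rintegral_cst//= lebesgue_measure_itv/= lte_fin ltr01.
by rewrite sube0 /= mulr1.
Qed.

End unit_segment.

Section curves.
Context {R : realType} {M : topologicalType} (S : riemannian_surface R M).
Implicit Types (c : chart R M).
#[local] Opaque derive.
Notation e1 := (Defs.basis R 0).
Notation e2 := (Defs.basis R 1).
Notation g := (Defs.metric S).
Notation mu := (@lebesgue_measure R).

Definition gnorm c (u v : R * R) : R := Num.sqrt (quad (g c u) v).

Lemma gnorm_ge0 c u v : 0 <= gnorm c u v.
Proof. exact: sqrtr_ge0. Qed.

Lemma segment_lengthE c (s : R -> R * R) :
  segment_length S c s = \int[mu]_(t in `[0%R, 1%R]) gnorm c (s t) ('D_1 s t).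
Proof.
by rewrite /segment_length; apply: eq_Rintegral => t _; rewrite /= quadE.
Qed.

Lemma segment_length_ge0 c (s : R -> R * R) : 0 <= segment_length S c s.
Proof. by rewrite segment_lengthE; apply: Rintegral_ge0 => t _; exact: gnorm_ge0. Qed.

Lemma curve_length_ge0 p q L : curve_length S p q L -> 0 <= L.
Proof.
by elim=> // {}p c s L' _ _ _ _ L0; rewrite addr_ge0 ?segment_length_ge0.
Qed.

Lemma speed_continuous c (s : R -> R * R) (t : R) : atlas S c ->
  Ck 1 [set: R] s -> cimg c (s t) ->
  {for t, continuous (fun t => gnorm c (s t) ('D_1 s t))}.
Proof.
move=> Ac [cs ds] ct.
have G i j : {for t, continuous (fun t => g c (s t) i j)}.
  apply: (@continuous_comp _ _ _ s (fun u => g c u i j)); first exact: cs.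
  exact: (Ck_continuous (Defs.metric_smooth Ac i j 0) ct).
have [_ [cd _]] := ds 1.
have D1 : {for t, continuous (fun t => ('D_1 s t).1)}.
  apply: (@continuous_comp _ _ _ ('D_1 s) fst); first exact: cd.
  exact: cvg_fst.
have D2 : {for t, continuous (fun t => ('D_1 s t).2)}.
  apply: (@continuous_comp _ _ _ ('D_1 s) snd); first exact: cd.
  exact: cvg_snd.
apply: (@continuous_comp _ _ _ (fun t => quad (g c (s t)) ('D_1 s t)) Num.sqrt);
  last exact: sqrt_continuous.
apply: continuousD; [apply: continuousD|].
- apply: continuousM; [exact: G|exact: continuousM].
- apply: continuousM; [exact: continuousD (G _ _) (G _ _)|exact: continuousM].
- apply: continuousM; [exact: G|exact: continuousM].
Qed.

(** The gradient bound is integrated over each piece, and the pieces are added by induction on the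
    curve. A good choice of [F] turns this into a lower bound for lengths. *)
Lemma curve_lipschitz (F : M -> R) (K : R) : 0 <= K ->
  (forall c, atlas S c -> Ck 1 (cimg c) (F \o cinv c)) ->
  (forall c u v, atlas S c -> cimg c u ->
     `|'D_v (F \o cinv c) u| <= K * gnorm c u v) ->
  forall p q L, curve_length S p q L -> `|F q - F p| <= K * L.
Proof.
move=> K0 CF FK p q L; elim=> {p q L} [p|p c s L Ac Cs sc _ IH].
  by rewrite subrr normr0 mulr0.
rewrite mulrDr -(subrKA (F (cinv c (s 0)))) [leRHS]addrC.
rewrite (le_trans (ler_normD _ _))// lerD//.
have oC := cimg_open Ac; have [_ ds] := Cs; have [d1 _] := ds 1.
pose dphi t := 'D_e1 (F \o cinv c) (s t) * ('D_1 s t).1 +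
               'D_e2 (F \o cinv c) (s t) * ('D_1 s t).2.
have dphiE t : 0 <= t <= 1 -> dphi t = 'D_('D_1 s t) (F \o cinv c) (s t).
  by move=> t01; rewrite (Ck1_derive _ oC (CF _ Ac) (sc _ t01)) /dphi; congr (_ + _);
    rewrite mulrC.
have [_ dF] := CF c Ac.
rewrite segment_lengthE -RintegralZl//; last first.
  by apply: integrable_unit => t t01; apply: speed_continuous => //; exact: sc.
apply: (@increment_le_Rintegral _ (fun t => F (cinv c (s t))) dphi).
- move=> t t01.
  have -> : (fun t => F (cinv c (s t))) =
      (fun t => (F \o cinv c) ((s t).1, (s t).2)).
    by apply/funext => r /=; case: (s r).
  have := @Ck1_chain _ _ _ _ _ (fun t => (s t).1) (fun t => (s t).2) t 1
     ('D_1 s t).1 ('D_1 s t).2 oC (CF c Ac).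
  rewrite /dphi /=; case E : (s t) => [a b] /=; apply.
  + by rewrite -E; exact: sc.
  + by apply: is_derive_fst; exact: d1.
  + by apply: is_derive_snd; exact: d1.
- move=> t t01; have [_ [cd _]] := ds 1.
  have DF v : {for t, continuous (fun t => 'D_v (F \o cinv c) (s t))}.
    apply: (@continuous_comp _ _ _ s ('D_v (F \o cinv c))).
      by case: Cs => cs _; exact: cs.
    by have [_ [H _]] := dF v; apply: H; exact: sc.
  apply: continuousD; apply: continuousM.
  + exact: DF.
  + apply: (@continuous_comp _ _ _ ('D_1 s) fst); first exact: cd.
    exact: cvg_fst.
  + exact: DF.
  + apply: (@continuous_comp _ _ _ ('D_1 s) snd); first exact: cd.
    exact: cvg_snd.
- move=> t t01; apply: continuousM; first exact: cst_continuous.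
  by apply: speed_continuous => //; exact: sc.
- by move=> t t01; rewrite dphiE//; apply: FK => //; exact: sc.
Qed.

Definition line (u v : R * R) (t : R) : R * R := t *: v + u.

Lemma is_derive_lineC (u v : R * R) (t w : R) : is_derive t w (line u v) (w *: v).
Proof.
apply: (is_derive_line _ _ _ _).2.
have -> : (fun h : R => line u v (h *: w + t)) =
    (fun h : R => h *: (w *: v)) + cst (t *: v + u).
  by apply/funext => h; rewrite /line scalerDl -addrA -scalerA.
rewrite -[X in is_derive _ _ _ X]addr0; apply: is_deriveD.
apply: DeriveDef.
  by apply/derivable1_diffP; exact: differentiableZl.
rewrite deriveE; last exact: differentiableZl.
by rewrite diff_val scale1r.
Qed.

Lemma Ck_line k (u v : R * R) : Ck k [set: R] (line u v).
Proof.
have c t : {for t, continuous (line u v)}.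
  by apply/differentiable_continuous/derivable1_diffP; case: (is_derive_lineC u v t 1).
case: k => [|k]; first by split; [move=> x _; exact: c|exact: I].
split; [by move=> x _; exact: c|move=> w].
split=> [x _|]; first by case: (is_derive_lineC u v x w).
rewrite (_ : derive (line u v) ^~ w = fun=> w *: v); first exact: Ck_cst.
by apply/funext => x; case: (is_derive_lineC u v x w).
Qed.

Lemma line_norm (u v w : R * R) (r t : R) : 0 <= t <= 1 ->
  `|v - u| < r -> `|w - u| < r -> `|line v (w - v) t - u| < r.
Proof.
move=> /andP[t0 t1] vr wr.
have -> : line v (w - v) t - u = (1 - t) *: (v - u) + t *: (w - u).
  case: u v w {vr wr} => [u1 u2] [v1 v2] [w1 w2].
  apply: pair_ext.
    change (t * (w1 - v1) + v1 - u1 = (1 - t) * (v1 - u1) + t * (w1 - u1)); ring.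
  change (t * (w2 - v2) + v2 - u2 = (1 - t) * (v2 - u2) + t * (w2 - u2)); ring.
rewrite (le_lt_trans (ler_normD _ _))// !normrZ !ger0_norm ?subr_ge0//.
exact: convex_lt.
Qed.

Definition square (u : R * R) (r : R) : set (R * R) := [set v | `|v - u| <= r].

Lemma square_norm (u v : R * R) (r : R) :
  (`|v - u| <= r) = (`|v.1 - u.1| <= r) && (`|v.2 - u.2| <= r).
Proof. by rewrite prod_normE ge_max. Qed.

Lemma square_normlt (u v : R * R) (r : R) :
  (`|v - u| < r) = (`|v.1 - u.1| < r) && (`|v.2 - u.2| < r).
Proof. by rewrite prod_normE gt_max. Qed.

Lemma squareE (u : R * R) (r : R) :
  square u r = `[u.1 - r, u.1 + r] `*` `[u.2 - r, u.2 + r].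
Proof.
by apply/seteqP; split=> v; rewrite /square /= !in_itv /= square_norm !ler_distl;
  [move/andP|move=> [? ?]; apply/andP].
Qed.

Lemma compact_square u r : compact (square u r).
Proof. by rewrite squareE; apply: compact_setX; exact: segment_compact. Qed.

Lemma compact_bound {T : topologicalType} (A : set T) (f : T -> R) : compact A ->
  (forall u, A u -> {for u, continuous f}) ->
  exists2 B, 0 <= B & forall u, A u -> `|f u| <= B.
Proof.
move=> cA cf; have [A0|A0] := pselect (A !=set0); last first.
  by exists 0 => // u Au; exfalso; apply: A0; exists u.
have [|c _ Hc] := @compact_EVT_max _ R (fun u => `|f u|) A A0 cA.
  apply: continuous_in_subspaceT => u /set_mem Au.
  by apply: continuous_comp (cf _ Au) _; exact: norm_continuous.
by exists `|f c| => // u /mem_set; exact: Hc.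
Qed.

Lemma Ck1_gradient_bound (A U : set (R * R)) (f : R * R -> R) :
  open U -> A `<=` U -> compact A -> Ck 1 U f ->
  exists2 B, 0 <= B & forall u v, A u -> `|'D_v f u| <= B * `|v|.
Proof.
move=> oU AU cA Cf; have [_ df] := Cf.
have [_ [c1 _]] := df e1; have [_ [c2 _]] := df e2.
have [B1 B10 H1] := @compact_bound _ A ('D_e1 f) cA (fun u Au => c1 u (AU u Au)).
have [B2 B20 H2] := @compact_bound _ A ('D_e2 f) cA (fun u Au => c2 u (AU u Au)).
exists (B1 + B2); first exact: addr_ge0.
move=> u v Au; rewrite (Ck1_derive v oU Cf (AU u Au)).
rewrite (le_trans (ler_normD _ _))// !normrM mulrDl.
have n1 : `|v.1| <= `|v| by rewrite prod_normE /= le_max lexx.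
have n2 : `|v.2| <= `|v| by rewrite prod_normE /= le_max lexx orbT.
apply: lerD; rewrite mulrC.
  exact: (ler_pM (normr_ge0 _) (normr_ge0 _) (H1 _ Au) n1).
exact: (ler_pM (normr_ge0 _) (normr_ge0 _) (H2 _ Au) n2).
Qed.

Definition jacv c c' (u v : R * R) : R * R :=
  ('D_v (fun w => (transition c c' w).1) u, 'D_v (fun w => (transition c c' w).2) u).

Lemma Ck_transition1 c c' k : atlas S c -> atlas S c' ->
  Ck k (overlap c c') (fun w => (transition c c' w).1).
Proof.
move=> Ac Ac'; apply: (@Ck_fst _ _ _ _ (transition c c')).
  exact: open_overlap Ac Ac'.
exact: transition_smooth Ac Ac' k.
Qed.

Lemma Ck_transition2 c c' k : atlas S c -> atlas S c' ->
  Ck k (overlap c c') (fun w => (transition c c' w).2).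
Proof.
move=> Ac Ac'; apply: (@Ck_snd _ _ _ _ (transition c c')).
  exact: open_overlap Ac Ac'.
exact: transition_smooth Ac Ac' k.
Qed.

Lemma gnorm_change c c' u v : atlas S c -> atlas S c' -> overlap c c' u ->
  gnorm c u v = gnorm c' (transition c c' u) (jacv c c' u v).
Proof.
move=> Ac Ac' Ou; have oO := open_overlap Ac Ac'; have [cu c'u] := Ou.
rewrite /gnorm -!quadE; congr Num.sqrt.
have := metric_change Ac Ac' (cdom_cinv Ac cu) c'u.
rewrite /= (cinvK Ac cu) -/(transition c c' u) => ->.
have E : \col_i Defs.coord i (jacv c c' u v) =
   jac (transition c c') u *m \col_i Defs.coord i v :> 'cV[R]_2.
  apply/matrixP => i j; rewrite !mxE sum2 !mxE; move: i; apply: ord2P.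
    by rewrite /Defs.coord/= (Ck1_derive v oO (Ck_transition1 1 Ac Ac') Ou) mulrC
      [X in _ = _ + X]mulrC.
  by rewrite /Defs.coord/= (Ck1_derive v oO (Ck_transition2 1 Ac Ac') Ou) mulrC
      [X in _ = _ + X]mulrC.
by rewrite E trmx_mul !mulmxA.
Qed.

Lemma derive_transition c c' (B : R * R -> R) u v : atlas S c -> atlas S c' ->
  overlap c c' u -> Ck 1 [set: R * R] B ->
  'D_v (fun w => B (transition c c' w)) u = 'D_(jacv c c' u v) B (transition c c' u).
Proof.
move=> Ac Ac' Ou CB.
have := @Ck1_chain _ _ setT 0 B (fun w => (transition c c' w).1)
  (fun w => (transition c c' w).2) u v _ _ openT CB I
  (derivableP (((Ck_transition1 1 Ac Ac').2 v).1 _ Ou))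
  (derivableP (((Ck_transition2 1 Ac Ac').2 v).1 _ Ou)).
have -> : (fun y => B ((transition c c' y).1, (transition c c' y).2)) =
   (fun w => B (transition c c' w)) by apply/funext => w; case: (transition c c' w).
move=> [_ ->]; rewrite /jacv [RHS](Ck1_derive _ openT CB)//=.
by case: (transition c c' u) => a b /=; rewrite mulrC [X in _ + X]mulrC.
Qed.

Definition extend0 c (B : R * R -> R) (p : M) : R :=
  if `[< cdom c p >] then B (cmap c p) else 0.

Lemma extend0E c B p : cdom c p -> extend0 c B p = B (cmap c p).
Proof. by move=> cp; rewrite /extend0 asboolT. Qed.

(** * Extension by zero of a function supported in a chart *)

Section extension_by_zero.
Variables (c0 : chart R M) (u0 : R * R) (r : R) (B : R * R -> R).
Hypotheses (Ac0 : atlas S c0) (sq : square u0 r `<=` cimg c0)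
  (B0 : forall u, r <= `|u - u0| -> B u = 0).

Let closed_support : closed (cinv c0 @` square u0 r).
Proof.
apply: compact_closed; first exact: (surface_hausdorff S).
apply: (@continuous_compact _ _ (cinv c0) (square u0 r)); last exact: compact_square.
apply: continuous_in_subspaceT => u /set_mem /sq cu.
exact: cinv_continuous Ac0 u cu.
Qed.

Lemma extend0_out p : ~ (cinv c0 @` square u0 r) p -> extend0 c0 B p = 0.
Proof.
move=> np; rewrite /extend0; case: asboolP => // cp; apply: B0.
rewrite leNgt; apply/negP => /ltW lt; apply: np.
by exists (cmap c0 p); [exact: lt|rewrite (cmapK Ac0 cp)].
Qed.

Let out_nbhs c u : atlas S c -> cimg c u -> ~ cdom c0 (cinv c u) ->
  open [set v | cimg c v /\ (~` (cinv c0 @` square u0 r)) (cinv c v)] /\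
  [set v | cimg c v /\ (~` (cinv c0 @` square u0 r)) (cinv c v)] u.
Proof.
move=> Ac cu nc; split; first exact: (open_chart_preimage Ac (closed_openC closed_support)).
split=> // -[w /sq cw E]; apply: nc; rewrite -E; exact: cdom_cinv Ac0 _ cw.
Qed.

(** The support lies in the image of a compact square, which is closed since M is Hausdorff. Near a
    point outside the chart domain the extension therefore vanishes identically. *)
Lemma Ck_extend0 k c : atlas S c -> Ck k [set: R * R] B ->
  Ck k (cimg c) (extend0 c0 B \o cinv c).
Proof.
move=> Ac CB; apply: Ck_local => u cu.
have [d|d] := pselect (cdom c0 (cinv c u)).
  exists (overlap c c0) => //.
  apply: (@Ck_eq _ _ _ _ _ (fun u => B (transition c c0 u))).
  - exact: open_overlap Ac Ac0.
  - by move=> v [_ cv]; rewrite /= extend0E.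
  - by apply: (Ck_transition Ac Ac0 openT (open_overlap Ac Ac0) _ _ CB).
have [oV Vu] := out_nbhs Ac cu d.
exists [set v | cimg c v /\ (~` (cinv c0 @` square u0 r)) (cinv c v)] => //.
apply: (@Ck_eq _ _ _ _ _ (fun=> 0)) => //; last exact: Ck_cst.
by move=> v [_ nv]; rewrite /= extend0_out.
Qed.

(** Over the square the bound is the one in [c0], carried to [c] by [gnorm_change]; elsewhere the
    function vanishes near the point and so does its derivative. *)
Lemma extend0_gradient (K C : R) c u v : atlas S c -> cimg c u -> 0 <= K -> 0 <= C ->
  Ck 1 [set: R * R] B ->
  (forall w z, square u0 r w -> `|'D_z B w| <= K * `|z|) ->
  (forall w z, square u0 r w -> `|z| <= C * gnorm c0 w z) ->
  `|'D_v (extend0 c0 B \o cinv c) u| <= K * C * gnorm c u v.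
Proof.
move=> Ac cu K0 C0 CB HK HC.
have R0 : 0 <= K * C * gnorm c u v by rewrite !mulr_ge0// gnorm_ge0.
have zero (f : R * R -> R) w z : (\forall x \near w, 0 = f x) -> 'D_z f w = 0.
  by move=> /near_eq_derive <-; rewrite (derive_cst 0).
have [d|d] := pselect (cdom c0 (cinv c u)); last first.
  have [oV Vu] := out_nbhs Ac cu d.
  rewrite zero ?normr0//; apply: filterS (open_nbhs_nbhs (conj oV Vu)).
  by move=> w [_ nw]; rewrite /= extend0_out.
have Ou : overlap c c0 u by [].
rewrite (@near_eq_derive _ _ _ _ (fun w => B (transition c c0 w))); last first.
  apply: filterS (open_nbhs_nbhs (conj (open_overlap Ac Ac0) Ou)) => w [_ cw].
  by rewrite /= extend0E.
rewrite derive_transition// (gnorm_change v Ac Ac0 Ou).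
have [s|s] := pselect (square u0 r (transition c c0 u)).
  apply: le_trans (HK _ _ s) _; rewrite -mulrA ler_wpM2l//; exact: HC.
rewrite zero ?normr0 -?(gnorm_change v Ac Ac0 Ou)//.
have /negP := s; rewrite -ltNge => lt.
(* By the triangle inequality [B] vanishes on the ball of this radius. *)
apply/(nearN_P _ _).2; exists (`|transition c c0 u - u0| - r); first by rewrite subr_gt0.
move=> w; rewrite ltrBrDl => hw; rewrite B0//.
rewrite -(lerD2r `|w - transition c c0 u|) (le_trans (ltW hw))//.
rewrite -[in leLHS](subrKA w) -opprB addrC (le_trans (ler_normD _ _))//.
by rewrite normrN.
Qed.

End extension_by_zero.

Lemma near_bounded (f : R * R -> R) u : {for u, continuous f} ->
  \forall v \near u, `|f v| <= `|f u| + 1.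
Proof.
move=> /continuous_at_P /(_ _ ltr01)[r r0 H]; apply/nearN_P; exists r => // v /H.
move: (f v) (f u) => a b ab; rewrite -lerBlDl (le_trans _ (ltW ab))//.
exact: lerB_dist.
Qed.

(** Near [u0] the entries of the metric are bounded and its determinant stays above half its value,
    so [quad_upper] and [quad_lower] make the Riemannian and coordinate norms comparable. *)
Lemma chart_bounds c u0 : atlas S c -> cimg c u0 ->
  exists r B : R, [/\ 0 < r, 0 < B & forall u, `|u - u0| < r ->
    [/\ cimg c u, vdensity S c u <= B, forall v, gnorm c u v <= B * `|v| &
        forall v, `|v| <= B * gnorm c u v]].
Proof.
move=> Ac cu0.
have G i j := near_bounded (Ck_continuous (Defs.metric_smooth Ac i j 0) cu0).
have V := near_bounded (Ck_continuous (Ck_vdensity 0 Ac) cu0).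
have cdet := Ck_continuous (Ck_det 0 Ac) cu0.
have d0 := metric_det_gt0 Ac cu0.
pose d := \det (g c u0).
have D : \forall u \near u0, d / 2 < \det (g c u).
  by apply: (cdet [set x | d / 2 < x]); apply: lt_nbhsr; rewrite ltr_pdivrMr//
    mulr_natr mulr2n ltrDl.
pose A : R := \sum_(i < 2) \sum_(j < 2) (`|g c u0 i j| + 1).
have A0 : 0 <= A by apply: sumr_ge0 => i _; apply: sumr_ge0 => j _; rewrite addr_ge0.
have GA i j : `|g c u0 i j| + 1 <= A.
  rewrite /A (bigD1 i)//= (bigD1 j)//= -addrA lerDl addr_ge0//.
    by apply: sumr_ge0 => k _; rewrite addr_ge0.
  by apply: sumr_ge0 => k _; apply: sumr_ge0 => l _; rewrite addr_ge0.
pose m : R := (A + A) / (d / 2).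
have d20 : 0 < d / 2 by rewrite divr_gt0.
have m0 : 0 <= m by rewrite divr_ge0 ?addr_ge0// ltW.
(* A sum of nonnegative terms, so that one constant dominates all the bounds. *)
pose B := 1 + Num.sqrt (4 * A) + Num.sqrt m + (`|vdensity S c u0| + 1).
have BB : [/\ Num.sqrt (4 * A) <= B, Num.sqrt m <= B &
    `|vdensity S c u0| + 1 <= B] /\ 0 < B.
  have := normr_ge0 (vdensity S c u0).
  have := sqrtr_ge0 (4 * A); have := sqrtr_ge0 m; rewrite /B.
  move: (Num.sqrt (4 * A)) (Num.sqrt m) (`|vdensity S c u0|) => a b e a0 b0 e0.
  by split; [split|]; lra.
have [{}BB B_gt0] := BB.
have [r r0 Hr] := (nearN_P _ _).1 (filterI (filterI (filterI (G 0 0) (G 0 1))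
  (filterI (G 1 0) (G 1 1))) (filterI (filterI V D)
  (open_nbhs_nbhs (conj (cimg_open Ac) cu0)))).
exists r, B; split=> //.
move=> u /Hr[[[g00 g01] [g10 g11]] [[vB dB] cu]].
have gA i j : `|g c u i j| <= A.
  by apply: le_trans (GA i j); move: i j; apply: ord2P; apply: ord2P.
split=> //.
- apply: le_trans (ler_norm _) _; apply: le_trans vB _.
  by have [] := BB.
- move=> v; apply: (@le_trans _ _ (Num.sqrt (4 * A) * `|v|)); last first.
    by apply: ler_wpM2r => //; have [] := BB.
  rewrite -[X in _ * X]normr_id -sqrtr_sqr -sqrtrM ?mulr_ge0//.
  by apply: ler_wsqrtr; exact: quad_upper.
- move=> v; apply: (@le_trans _ _ (Num.sqrt m * gnorm c u v)); last first.
    apply: ler_wpM2r; first exact: gnorm_ge0.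
    by have [] := BB.
  rewrite /gnorm -sqrtrM// -[leLHS]normr_id -sqrtr_sqr; apply: ler_wsqrtr.
  rewrite /m mulrAC ler_pdivlMr//.
  have qq := quad_lower v Ac cu; have q0 := quad_ge0 v Ac cu.
  have v1 : `|v| ^+ 2 <= v.1 ^+ 2 + v.2 ^+ 2.
    rewrite prod_normE /= maxEle; case: ifP => _; rewrite real_normK ?num_real//.
      by rewrite lerDr sqr_ge0.
    by rewrite lerDl sqr_ge0.
  apply: le_trans (_ : (v.1 ^+ 2 + v.2 ^+ 2) * (d / 2) <= _).
    by rewrite ler_wpM2r// ltW.
  apply: le_trans (_ : \det (g c u) * (v.1 ^+ 2 + v.2 ^+ 2) <= _).
    by rewrite mulrC ler_wpM2r ?addr_ge0 ?sqr_ge0// ltW.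
  apply: le_trans qq _; rewrite ler_wpM2r// lerD//.
    by apply: le_trans (ler_norm _) _; exact: gA.
  by apply: le_trans (ler_norm _) _; exact: gA.
Qed.

(** The curve is prolonged by a straight segment in the chart, which stays in the convex coordinate
    ball where the speed is at most [B] times the coordinate speed. *)
Lemma curve_segment c u0 (r B : R) : atlas S c -> (forall u, `|u - u0| < r ->
    cimg c u /\ forall v, gnorm c u v <= B * `|v|) ->
  forall p L u u', `|u - u0| < r -> `|u' - u0| < r ->
  curve_length S p (cinv c u) L -> exists2 L', L' <= L + B * `|u' - u| &
    curve_length S p (cinv c u') L'.
Proof.
move=> Ac H p L u u' ur u'r pL; pose s := line u (u' - u).
have s0 : s 0 = u by rewrite /s /line scale0r add0r.
have s1 : s 1 = u' by rewrite /s /line scale1r subrK.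
have sr (t : R) : 0 <= t <= 1 -> `|s t - u0| < r.
  by move=> t01; apply: line_norm.
exists (L + segment_length S c s).
  rewrite lerD2l segment_lengthE; apply: Rintegral_unit_le => t t01.
    apply: speed_continuous => //; first exact: Ck_line.
    by have [] := H _ (sr _ t01).
  have [_ ->] := is_derive_lineC u (u' - u) t 1.
  by rewrite scale1r; have [_] := H _ (sr _ t01); apply.
rewrite -s1; apply: curve_cons => //; first exact: Ck_line.
- by move=> t /sr /H[].
- by rewrite s0.
Qed.

Lemma chart_ball_nbhs c x u0 (r : R) : atlas S c -> cdom c x -> u0 = cmap c x ->
  0 < r -> \forall y \near x, cdom c y /\ `|cmap c y - u0| < r.
Proof.
move=> Ac cx -> r0.
have O : open [set y | cdom c y /\ [set u | `|u - cmap c x| < r] (cmap c y)].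
  apply: (open_chart_image Ac); rewrite openE => u ur; apply/nearN_P.
  exists (r - `|u - cmap c x|); first by rewrite subr_gt0.
  move=> v; rewrite ltrBrDr; apply: le_lt_trans.
  by rewrite -[in leLHS](subrKA u) ler_normD.
by apply: open_nbhs_nbhs; split => //; split=> //=; rewrite subrr normr0.
Qed.

(** By chart segments the set of points reached from [p] is both open and closed. Without this,
    [geodesic_dist] could be the infimum of an empty set. *)
Lemma curve_reachable : connected [set: M] ->
  forall p q, exists L, curve_length S p q L.
Proof.
move=> cM p q; pose A := [set q | exists L, curve_length S p q L].
have chartP x : exists c u0 r B, [/\ atlas S c, cdom c x, u0 = cmap c x, 0 < r &
    forall u, `|u - u0| < r -> cimg c u /\ forall v, gnorm c u v <= B * `|v|].
  have [Ac cx] := chart_atP S x; set c := chart_at S x in Ac cx.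
  have [r [B [r0 B0 H]]] := chart_bounds Ac (cimg_cmap cx).
  by exists c, (cmap c x), r, B; split=> // u /H[].
have oA : open A.
  rewrite openE => x [L xL]; have [c [u0 [r [B [Ac cx E r0 H]]]]] := chartP x.
  apply: filterS (chart_ball_nbhs Ac cx E r0) => y [cy yr].
  have [||L' _ yL'] := @curve_segment c u0 r B Ac H p L u0 (cmap c y) _ yr.
  - by rewrite subrr normr0.
  - by rewrite E (cmapK Ac cx).
  - by exists L'; rewrite (cmapK Ac cy) in yL'.
have cA : closed A.
  move=> x clx; have [c [u0 [r [B [Ac cx E r0 H]]]]] := chartP x.
  have [y [[L yL] [cy yr]]] := clx _ (chart_ball_nbhs Ac cx E r0).
  have [||L' _ yL'] := @curve_segment c u0 r B Ac H p L (cmap c y) u0 yr.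
  - by rewrite subrr normr0.
  - by rewrite (cmapK Ac cy).
  - by exists L'; rewrite E (cmapK Ac cx) in yL'.
have : A = [set: M].
  apply: cM; [exists p|exists A|exists A]; rewrite ?setTI//.
  by exists 0; exact: curve_nil.
by move/seteqP => [_ /(_ q I)].
Qed.

(** A bump [b] around [u0], extended by zero, is Lipschitz along curves. Along a curve of length
    less than [k] it loses at most half of [b0], so the end point, where it is still positive, lies
    in the chart. There the Lipschitz bounds for (u_i - u0_i) b, divided by [b0 / 2], bound the
    displacement. *)
Lemma curve_chart_lower c x : atlas S c -> cdom c x -> exists k C : R,
  [/\ 0 < k, 0 <= C & forall q L, curve_length S x q L -> L < k ->
    cdom c q /\ `|cmap c q - cmap c x| <= C * L].
Proof.
move=> Ac cx; set u0 := cmap c x.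
have [r' [B [r'0 B0 HB]]] := chart_bounds Ac (cimg_cmap cx).
pose r := r' / 2.
have r0 : 0 < r by rewrite divr_gt0.
have rr' : r < r' by rewrite /r ltr_pdivrMr// mulr_natr mulr2n ltrDl.
have sq : square u0 r `<=` cimg c by move=> u us; have [] := HB u (le_lt_trans us rr').
pose b (u : R * R) := bumpR u0.1 r u.1 * bumpR u0.2 r u.2.
have Cb k : Ck k [set: R * R] b.
  apply: CkM; [exact: openT| |].
    apply: (Ck_comp_real openT (Ck_bumpR k _ _) (Ck_cfst k _)) => //.
  by apply: (Ck_comp_real openT (Ck_bumpR k _ _) (Ck_csnd k _)).
have b_out u : r <= `|u - u0| -> b u = 0.
  rewrite prod_normE /= le_max => /orP[h|h].
    by rewrite /b bumpR_eq0 ?mul0r.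
  by rewrite /b mulrC bumpR_eq0 ?mul0r.
have b00 : 0 < b u0 by rewrite /b mulr_gt0// bumpR_gt0// subrr normr0.
have Lip (f : R * R -> R) : Ck 1 [set: R * R] f ->
    (forall u, r <= `|u - u0| -> f u = 0) ->
    exists2 K, 0 <= K & forall q L, curve_length S x q L ->
      `|extend0 c f q - f u0| <= K * L.
  move=> Cf f_out.
  have [K K0 HK] := Ck1_gradient_bound openT (@subsetT _ _) (@compact_square u0 r) Cf.
  exists (K * B); first by rewrite mulr_ge0// ltW.
  move=> q L /(@curve_lipschitz (extend0 c f) (K * B)).
  rewrite (extend0E _ cx); apply.
  - by rewrite mulr_ge0// ltW.
  - by move=> c' Ac'; exact: (Ck_extend0 Ac sq f_out Ac' Cf).
  - move=> c' u v Ac' c'u; apply: (extend0_gradient Ac sq f_out) => //.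
    + exact: ltW.
    + by move=> w z wr; have [] := HB w (le_lt_trans wr rr').
have [K0 K00 HK0] := Lip b (Cb 1) b_out.
have [K1 K10 HK1] := Lip (fun u => (u.1 - u0.1) * b u)
  (CkM openT (CkB openT (Ck_cfst 1 _) (Ck_cst _ _ _)) (Cb 1))
  (fun u ur => etrans (congr1 _ (b_out u ur)) (mulr0 _)).
have [K2 K20 HK2] := Lip (fun u => (u.2 - u0.2) * b u)
  (CkM openT (CkB openT (Ck_csnd 1 _) (Ck_cst _ _ _)) (Cb 1))
  (fun u ur => etrans (congr1 _ (b_out u ur)) (mulr0 _)).
pose b0 := b u0.
exists (b0 / 2 / (K0 + 1)), (2 * (K1 + K2) / b0).
have K1p : 0 < K0 + 1 by rewrite ltr_wpDl.
split; first by rewrite !divr_gt0.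
  by apply: divr_ge0 (ltW b00); rewrite mulr_ge0// addr_ge0.
move=> q L qL; rewrite ltr_pdivlMr// => Lk.
have L0 := curve_length_ge0 qL.
have bq : b0 / 2 <= extend0 c b q.
  have kl : K0 * L <= b0 / 2.
    apply: le_trans (ltW Lk); rewrite mulrC ler_wpM2l// lerDl; exact: ler01.
  have := HK0 _ _ qL; rewrite -/b0 ler_norml => /andP[+ _].
  by move: (K0 * L) (extend0 c b q) kl => y z; lra.
have cq : cdom c q.
  apply: contrapT => ncq; move: bq; rewrite /extend0 asboolF// leNgt.
  by rewrite divr_gt0.
split=> //.
have b20 : 0 < b0 / 2 by rewrite divr_gt0.
rewrite (extend0E _ cq) in bq.
have est (z K : R) : 0 <= K -> `|z * b (cmap c q) - 0| <= K * L ->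
    `|z| <= 2 * K / b0 * L.
  move=> K_0; rewrite subr0 normrM (ger0_norm (le_trans (ltW b20) bq)) => zK.
  have : `|z| * (b0 / 2) <= K * L.
    by apply: le_trans zK; rewrite ler_wpM2l.
  rewrite -ler_pdivlMr// => /le_trans; apply.
  by rewrite invf_div mulrCA mulrA (mulrAC _ _ L) mulrA.
have := HK1 _ _ qL; have := HK2 _ _ qL.
rewrite !(extend0E _ cq) !subrr !mul0r => /(est _ _ K20) h2 /(est _ _ K10) h1.
rewrite square_norm; apply/andP; split.
  apply: le_trans h1 _; rewrite ler_wpM2r// ler_pM2r ?invr_gt0// ler_pM2l//.
  by rewrite lerDl.
apply: le_trans h2 _; rewrite ler_wpM2r// ler_pM2r ?invr_gt0// ler_pM2l//.
by rewrite lerDr.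
Qed.

End curves.

(** * The geodesic distance *)

Section geodesic_distance.
Context {R : realType} {M : topologicalType} (S : riemannian_surface R M).
Hypothesis Mconnected : connected [set: M].
Implicit Types (c : chart R M) (p q x : M).
#[local] Opaque derive.
Notation dist := (geodesic_dist S).

Let lengths_lb p q : lbound [set L | curve_length S p q L] 0.
Proof. by move=> L /curve_length_ge0. Qed.

Let lengths_inf p q : has_inf [set L | curve_length S p q L].
Proof.
by split; [exact: curve_reachable|exists 0; exact: lengths_lb].
Qed.

Lemma geodesic_dist_ge0 p q : 0 <= dist p q.
Proof.
by apply: lb_le_inf; [have [] := lengths_inf p q|exact: lengths_lb].
Qed.

Lemma geodesic_dist_le p q L : curve_length S p q L -> dist p q <= L.
Proof. by move=> pqL; apply: ge_inf => //; exists 0; exact: lengths_lb. Qed.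

Lemma geodesic_dist_lt p q e : dist p q < e ->
  exists2 L, L < e & curve_length S p q L.
Proof.
rewrite -subr_gt0 => e0; have [L pqL] := inf_adherent e0 (lengths_inf p q).
by rewrite -/(dist p q) addrC subrK => Le; exists L.
Qed.

Lemma geodesic_dist_refl p : dist p p = 0.
Proof.
by apply/le_anti; rewrite geodesic_dist_ge0 geodesic_dist_le//; exact: curve_nil.
Qed.

(** A curve to [q] of length L < e can be prolonged within the remaining length e - L to every point
    near [q]. *)
Lemma open_geodesic_ball p e : open (geodesic_ball S p e).
Proof.
rewrite openE => q /geodesic_dist_lt[L Le pqL].
have [Ac cq] := chart_atP S q; set c := chart_at S q in Ac cq.
have [r [B [r0 B0 H]]] := chart_bounds Ac (cimg_cmap cq).
have Le0 : 0 < (e - L) / B by rewrite divr_gt0// subr_gt0.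
have r'0 : 0 < Num.min r ((e - L) / B) by rewrite lt_min r0.
apply: filterS (chart_ball_nbhs Ac cq erefl r'0) => y [cy].
rewrite lt_min ltr_pdivlMr// => /andP[yr yB].
have [|||L' L'B] := @curve_segment _ _ S c (cmap c q) r B Ac _ p L (cmap c q) (cmap c y) _ yr.
- by move=> u /H[].
- by rewrite subrr normr0.
- by rewrite (cmapK Ac cq).
rewrite (cmapK Ac cy) => pyL'.
apply: le_lt_trans (geodesic_dist_le pyL') _; apply: le_lt_trans L'B _.
by rewrite -ltrBrDl mulrC.
Qed.

(** Passage to the infimum in [curve_chart_lower]; as no minimising curve is available, one with a
    small excess is used and the excess is sent to 0. *)
Lemma geodesic_dist_lower c x : atlas S c -> cdom c x -> exists k C : R,
  [/\ 0 < k, 0 <= C & forall q, dist x q < k ->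
     cdom c q /\ `|cmap c q - cmap c x| <= C * dist x q].
Proof.
move=> Ac cx; have [k [C [k0 C0 H]]] := curve_chart_lower Ac cx.
exists k, C; split=> // q qk; have [L Lk xL] := geodesic_dist_lt qk.
split; first by have [] := H _ _ xL Lk.
apply/ler_addgt0Pr => e e0.
have C1 : 0 < C + 1 by rewrite ltr_wpDl.
have : dist x q < Num.min k (dist x q + e / (C + 1)).
  by rewrite lt_min qk ltrDl divr_gt0.
move=> /geodesic_dist_lt[L']; rewrite lt_min => /andP[L'k L'e] xL'.
have [_ /le_trans] := H _ _ xL' L'k; apply.
apply: (@le_trans _ _ (C * (dist x q + e / (C + 1)))).
  by rewrite ler_wpM2l// ltW.
rewrite mulrDr lerD2l mulrA ler_pdivrMr// mulrC ler_wpM2l ?(ltW e0)//.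
by rewrite lerDl ler01.
Qed.

Lemma geodesic_dist_gt0 x q : x <> q -> 0 < dist x q.
Proof.
move=> xq; rewrite lt_neqAle geodesic_dist_ge0 andbT; apply/negP => /eqP d0.
have [Ac cx] := chart_atP S x; set c := chart_at S x in Ac cx.
have [k [C [k0 C0 H]]] := geodesic_dist_lower Ac cx.
have [|cq] := H q; first by rewrite -d0.
rewrite -d0 mulr0 normr_le0 subr_eq0 => /eqP E.
by apply: xq; rewrite -(cmapK Ac cx) -E (cmapK Ac cq).
Qed.

(** Together with [open_geodesic_ball], this says that the geodesic distance induces the topology of
    M. *)
Lemma near_geodesic_ball x (A : set M) : nbhs x A ->
  exists2 k, 0 < k & forall q, dist x q < k -> A q.
Proof.
move=> xA; have [Ac cx] := chart_atP S x; set c := chart_at S x in Ac cx.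
have [k [C [k0 C0 H]]] := geodesic_dist_lower Ac cx.
have cu := cimg_cmap cx.
have : \forall u \near cmap c x, A (cinv c u).
  by apply: (cinv_continuous Ac cu); rewrite (cmapK Ac cx).
move=> /nearN_P[r r0 Hr].
have C1 : 0 < C + 1 by rewrite ltr_wpDl.
exists (Num.min k (r / (C + 1))); first by rewrite lt_min k0 divr_gt0.
move=> q; rewrite lt_min => /andP[/H[cq qC] qr].
rewrite -(cmapK Ac cq); apply: Hr; apply: le_lt_trans qC _.
rewrite ltr_pdivlMr// in qr; apply: le_lt_trans qr.
by rewrite mulrC ler_wpM2l ?geodesic_dist_ge0// lerDl ler01.
Qed.

Section regular_part.
Variables (E P : M -> M -> R) (x0 : M).
Hypotheses (Esym : forall x y, E x y = E y x) (hP : is_regular_part S E P).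

Lemma slice_Ck2 k (D : set (M * M)) (F : M -> M -> R) c : Ck2 S k D F -> atlas S c ->
  Ck k [set u | cimg c u /\ D (x0, cinv c u)] (fun u => F x0 (cinv c u)).
Proof.
move=> CF Ac; have [Ac0 cx] := chart_atP S x0; set c0 := chart_at S x0 in Ac0 cx.
have := @Ck_slice _ _ _ _ _ _ _ (cmap c0 x0) (CF c0 c Ac0 Ac).
rewrite /= (cmapK Ac0 cx); apply: Ck_sub => u [cu Du]; split=> //=.
exact: cimg_cmap.
Qed.

(** The mean value theorem on a straight segment in the chart; [geodesic_dist_lower] converts its
    coordinate length into geodesic distance. *)
Lemma regular_part_lipschitz : exists k C : R, [/\ 0 < k, 0 <= C &
  forall x, dist x0 x < k -> `|P x0 x - P x0 x0| <= C * dist x0 x].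
Proof.
have [CP _ _] := hP.
have [Ac cx] := chart_atP S x0; set c := chart_at S x0 in Ac cx.
have [k [C [k0 C0 H]]] := geodesic_dist_lower Ac cx.
have [r [B [r0 B0 HB]]] := chart_bounds Ac (cimg_cmap cx).
have C1 : 0 < C + 1 by rewrite ltr_wpDl.
pose r2 := r / 2.
have r20 : 0 < r2 by rewrite divr_gt0.
have rr : r2 < r by rewrite /r2 ltr_pdivrMr// mulr_natr mulr2n ltrDl.
have CPc : Ck 1 (cimg c) (fun u => P x0 (cinv c u)).
  by apply: Ck_sub (slice_Ck2 CP Ac) => u cu.
have sq : square (cmap c x0) r2 `<=` cimg c.
  by move=> u ur; have [] := HB u (le_lt_trans ur rr).
have [G G0 HG] := Ck1_gradient_bound (cimg_open Ac) sq
  (@compact_square _ (cmap c x0) r2) CPc.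
exists (Num.min k (r2 / (C + 1))), (G * C); split.
- by rewrite lt_min k0 divr_gt0.
- exact: mulr_ge0.
move=> x; rewrite lt_min ltr_pdivlMr// => /andP[/H[cq qC] qr].
set u0 := cmap c x0 in HB sq HG qC *; pose v := cmap c x - u0.
have vr : `|v| <= r2.
  apply: le_trans qC _; apply: le_trans (ltW qr); rewrite mulrC.
  by rewrite ler_wpM2l ?geodesic_dist_ge0// lerDl ler01.
have inS (t : R) : 0 <= t <= 1 -> square u0 r2 (t *: v + u0).
  move=> /andP[t0 t1]; rewrite /square/= addrK normrZ ger0_norm//.
  by apply: le_trans vr; rewrite ler_piMl.
have [t t01|t t01] := @MVT_line _ _ (fun u => P x0 (cinv c u)) u0 v.
  have [_ /(_ v)[d _]] := CPc; apply: d; exact/sq/inS.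
rewrite /v subrK (cmapK Ac cq) (cmapK Ac cx) -/v => ->.
apply: le_trans (HG _ v (inS _ t01)) _; rewrite -mulrA.
exact: ler_wpM2l.
Qed.

Lemma green_expansion : exists k C : R, [/\ 0 < k, 0 <= C &
  forall x, x0 <> x -> dist x0 x < k ->
   `|E x0 x - (- (2 * pi)^-1 * ln (dist x0 x) + P x0 x0)| <= C * dist x0 x].
Proof.
have [k [C [k0 C0 HL]]] := regular_part_lipschitz.
have [_ _ [N [oN diagN HN]]] := hP.
have : \forall y \near x0, N (x0, y).
  have [[A B] /= [xA xB] AB] := open_nbhs_nbhs (conj oN (diagN x0)).
  by apply: filterS xB => y By; apply: AB; split=> //=; exact: nbhs_singleton.
move=> /near_geodesic_ball[k' k'0 Hk'].
exists (Num.min k k'), C; split=> //; first by rewrite lt_min k0.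
move=> x x0x; rewrite lt_min => /andP[xk /Hk' xN].
rewrite HN// opprD addrACA subrr add0r; exact: HL.
Qed.

End regular_part.

End geodesic_distance.

(** * Integration on squares *)

Section disintegration.
Import HBNNSimple.
Local Open Scope ereal_scope.
Context {d1 d2 : measure_display} {T1 : measurableType d1} {T2 : measurableType d2}
  {R : realType}.
Variables (m1 : {measure set T1 -> \bar R}) (m2 : {measure set T2 -> \bar R})
  (k : T1 -> {measure set T2 -> \bar R}).
Hypothesis mk : forall U, measurable U -> measurable_fun [set: T1] (k ^~ U).
Hypothesis kE : forall U, measurable U -> m2 U = \int[m1]_x k x U.

Let disintegration_nnsfun (f : {nnsfun T2 >-> R}) :
  \int[m2]_y (f y)%:E = \int[m1]_x \int[k x]_y (f y)%:E.
Proof.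
have mf r : measurable (f @^-1` [set r]) by [].
have E (m : {measure set T2 -> \bar R}) :
    \int[m]_y (f y)%:E = \sum_(r \in range f) (r%:E * m (f @^-1` [set r])).
  by rewrite integralT_nnsfun sintegralE.
rewrite E; under [in RHS]eq_integral do rewrite E.
rewrite ge0_integral_fsum//.
- apply: eq_fsbigr => r /set_mem[y _ <-]; rewrite kE// ge0_integralZl//.
  + exact: mk.
  + by rewrite lee_fin.
- by move=> r; apply: measurable_funeM; exact: mk.
- move=> r x _; have [r0|r0] := leP 0%R r; first by rewrite mule_ge0// lee_fin.
  by rewrite preimage_nnfun0// measure0 mule0.
Qed.

(** Linearity gives simple functions, monotone convergence the rest. It serves twice: for the volume
    in a chart, with weighted point masses as [k], and for the Markov property, with the laws of a
    restarted process as [k]. *)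
Lemma ge0_integral_disintegration (f : T2 -> \bar R) :
  (forall y, 0 <= f y) -> measurable_fun [set: T2] f ->
  \int[m2]_y f y = \int[m1]_x \int[k x]_y f y.
Proof.
move=> f0 mf; pose f_ := nnsfun_approx measurableT mf.
have mf_ n : measurable_fun [set: T2] (fun y => (f_ n y)%:E).
  exact/measurable_EFinP.
have f_0 n y : 0 <= (f_ n y)%:E by rewrite lee_fin.
have nd y : {homo (fun n => (f_ n y)%:E) : a b / (a <= b)%N >-> a <= b}.
  by move=> a b ab; rewrite lee_fin; exact/lefP/nd_nnsfun_approx.
have lim_f y : limn (fun n => (f_ n y)%:E) = f y.
  by apply/cvg_lim => //; exact: cvg_nnsfun_approx.
have mc (m : {measure set T2 -> \bar R}) :
    \int[m]_y f y = limn (fun n => \int[m]_y (f_ n y)%:E).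
  rewrite -monotone_convergence//.
  by apply: eq_integral => y _; rewrite lim_f.
rewrite mc; under [in RHS]eq_integral do rewrite mc.
rewrite monotone_convergence//.
- by congr (limn _); apply/funext => n; exact: disintegration_nnsfun.
- by move=> n; exact: measurable_fun_integral_kernel.
- by move=> n x _; exact: integral_ge0.
- move=> x _ a b ab; apply: ge0_le_integral => // y _; exact: nd.
Qed.

End disintegration.

(** * Measurability and the divergence theorem on coordinate squares *)

Section plane_measure.
Context {R : realType}.
#[local] Opaque derive.
Notation leb := (@lebesgue_measure R).
Notation leb2 := (leb \x leb)%E.

(** Measurability refers to the product sigma-algebra, so an open set is exhibited as a countable
    union of rational boxes. *)
Lemma measurable_open_plane (A : set (R * R)) : open A -> measurable A.
Proof.
move=> oA.
pose box (q : rat * rat * nat) : set (R * R) :=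
  ball (ratr q.1.1 : R) (q.2.+1%:R^-1) `*` ball (ratr q.1.2 : R) (q.2.+1%:R^-1).
have mbox q : measurable (box q) by apply: measurableX; exact: measurable_ball.
(* The boxes that are not contained in [A] are replaced by the empty set, which leaves the index set
   a plain countable type. *)
have -> : A = \bigcup_q (if `[< box q `<=` A >] then box q else set0).
  apply/seteqP; split=> [[u1 u2] Au|u [q _]]; last first.
    by case: asboolP => // qA; exact: qA.
  have [e /= e0 He] := (nearN_P _ _).1 (open_nbhs_nbhs (conj oA Au)).
  have [n n0] : exists n : nat, n.+1%:R^-1 < e / 2 :> R.
    exists (Num.truncn (e / 2)^-1); rewrite -[ltRHS]invrK ltf_pV2 ?posrE//.
      exact: truncnS_gt.
    by rewrite invr_gt0 divr_gt0.
  have n1 : 0 < n.+1%:R^-1 :> R by [].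
  have rd (x : R) : exists q, `|x - ratr q| < n.+1%:R^-1.
    have xn : x < x + n.+1%:R^-1 by rewrite ltrDl.
    have [q] := rat_in_itvoo xn.
    rewrite in_itv/= => /andP[h1 h2]; exists q.
    by rewrite distrC ger0_norm ?subr_ge0 ?(ltW h1)// ltrBlDl.
  have [q1 H1] := rd u1; have [q2 H2] := rd u2.
  exists (q1, q2, n) => //; rewrite asboolT.
    by split; rewrite /ball/= distrC.
  move=> [v1 v2] [/= w1 w2]; apply: He.
  rewrite square_normlt /=.
  rewrite /ball/= distrC in w1; rewrite /ball/= distrC in w2.
  have tri (x y z : R) : `|x - z| < n.+1%:R^-1 -> `|y - z| < n.+1%:R^-1 -> `|y - x| < e.
    move=> h1 h2; rewrite -(subrKA z) (le_lt_trans (ler_normD _ _))//.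
    by rewrite (splitr e) ltrD// ?(lt_trans h2)// distrC (lt_trans h1).
  by apply/andP; split; [exact: tri H1 w1|exact: tri H2 w2].
apply: countable_bigcupT_measurable => [|q]; first exact: countableP.
by case: ifP => _ //; exact: measurable0.
Qed.

Lemma measurable_square u (r : R) : measurable (square u r).
Proof. by rewrite squareE; apply: measurableX; exact: measurable_itv. Qed.

Lemma continuous_measurable_plane (U : set (R * R)) (f : R * R -> R) : open U ->
  (forall u, U u -> {for u, continuous f}) ->
  measurable_fun U f.
Proof.
move=> oU cf mU; apply: (measurability _ (RGenOpens.measurableE R)).
  move=> _ [_ [a [b ->] <-]]; apply: measurable_open_plane.
  rewrite openE => u [Uu fu].
  have : \forall v \near u, `]a, b[%classic (f v).
    by apply: (cf _ Uu); apply: open_nbhs_nbhs; split => //; exact: interval_open.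
  by apply: filterS2 (open_nbhs_nbhs (conj oU Uu)) => v; split.
exact: mU.
Qed.

Lemma leb2_square u (r : R) : 0 < r -> leb2 (square u r) = ((r + r) * (r + r))%:E.
Proof.
move=> r0; rewrite squareE product_measure1E; try exact: measurable_itv.
have E (a : R) : leb `[a - r, a + r]%classic = (r + r)%:E.
  rewrite lebesgue_measure_itv/= lte_fin ltrD2l gtrN// -EFinB; congr (_%:E); ring.
exact: etrans (congr2 mule (E u.1) (E u.2)) _.
Qed.

Lemma integrable_square (U : set (R * R)) (f : R * R -> R) u (r : R) : 0 < r ->
  open U -> square u r `<=` U -> (forall v, U v -> {for v, continuous f}) ->
  leb2.-integrable (square u r) (EFin \o f).
Proof.
move=> r0 oU SU cf.
have mS := measurable_square u r.
have mf : measurable_fun (square u r) f.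
  apply: measurable_funS SU (continuous_measurable_plane oU cf).
  exact: measurable_open_plane.
have [B B0 HB] := compact_bound (@compact_square _ u r) (fun v Sv => cf v (SU v Sv)).
apply: measurable_bounded_integrable => //.
  have L := leb2_square u r0.
  apply: (@le_lt_trans _ _ (((r + r) * (r + r))%:E)); last exact: ltry.
  rewrite -L; exact: lexx.
exists B; split; first exact: num_real.
by move=> x Bx v Sv; apply: le_trans (HB v Sv) (ltW Bx).
Qed.

Lemma patch_square (u : R * R) (r : R) (f : R * R -> R) (x y : R) :
  ((EFin \o f) \_ (square u r)) (x, y) =
  if (x \in `[u.1 - r, u.1 + r]%classic) && (y \in `[u.2 - r, u.2 + r]%classic)
  then (f (x, y))%:E else 0%E.
Proof. by rewrite /patch squareE in_setX. Qed.

Lemma integral_square21 (D : R * R -> R) u (r : R) :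
  leb2.-integrable (square u r) (EFin \o D) ->
  (\int[leb2]_(v in square u r) (D v)%:E = \int[leb]_(y in `[(u.2 - r)%R, (u.2 + r)%R])
    \int[leb]_(x in `[(u.1 - r)%R, (u.1 + r)%R]) (D (x, y))%:E)%E.
Proof.
move=> iD; have mS := measurable_square u r.
have iD' : leb2.-integrable setT ((EFin \o D) \_ (square u r)).
  by have [H _] := @integrable_mkcond _ _ _ leb2 (square u r) (EFin \o D) mS; apply: H.
rewrite [LHS]integral_mkcond.
rewrite -(integral21_prod_meas1 iD').
rewrite [RHS]integral_mkcond.
apply: eq_integral => y _; rewrite /fubini_G [RHS]/patch.
case: ifPn => yI; last first.
  apply: integral0_eq => x _.
  by rewrite [LHS]patch_square (negbTE yI) andbF.
rewrite [RHS]integral_mkcond; apply: eq_integral => x _.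
by rewrite [LHS]patch_square yI andbT.
Qed.

Lemma integral_square12 (D : R * R -> R) u (r : R) :
  leb2.-integrable (square u r) (EFin \o D) ->
  (\int[leb2]_(v in square u r) (D v)%:E = \int[leb]_(x in `[(u.1 - r)%R, (u.1 + r)%R])
    \int[leb]_(y in `[(u.2 - r)%R, (u.2 + r)%R]) (D (x, y))%:E)%E.
Proof.
move=> iD; have mS := measurable_square u r.
have iD' : leb2.-integrable setT ((EFin \o D) \_ (square u r)).
  by have [H _] := @integrable_mkcond _ _ _ leb2 (square u r) (EFin \o D) mS; apply: H.
rewrite [LHS]integral_mkcond.
rewrite -(integral12_prod_meas1 iD').
rewrite [RHS]integral_mkcond.
apply: eq_integral => x _; rewrite /fubini_F [RHS]/patch.
case: ifPn => xI; last first.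
  apply: integral0_eq => y _.
  by rewrite [LHS]patch_square (negbTE xI).
rewrite [RHS]integral_mkcond; apply: eq_integral => y _.
by rewrite [LHS]patch_square xI.
Qed.

(** One half of the divergence theorem: by Fubini the first coordinate is integrated first, and the
    fundamental theorem of calculus leaves only values on two faces, where [f] vanishes. *)
Lemma integral_square_derive1 (U : set (R * R)) (f : R * R -> R) u (r : R) :
  0 < r -> open U -> square u r `<=` U -> Ck 1 U f ->
  (forall v, square u r v -> `|v.1 - u.1| = r -> f v = 0) ->
  (\int[leb2]_(v in square u r) ('D_(Defs.basis R 0) f v)%:E = 0)%E.
Proof.
move=> r0 oU SU Cf f0; have [_ df] := Cf; have [d1 c1] := df (Defs.basis R 0).
pose D (v : R * R) : R := 'D_(Defs.basis R 0) f v.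
have cD (v : R * R) : U v -> {for v, continuous D} := c1.1 v.
have iD := integrable_square r0 oU SU cD.
rewrite integral_square21//; apply: integral0_eq => y /=; rewrite in_itv/= => yI.
have inS x : u.1 - r <= x <= u.1 + r -> square u r (x, y).
  move=> xI; rewrite squareE; by split; rewrite /= in_itv.
have ab : u.1 - r < u.1 + r by rewrite ltrD2l gtrN.
have dF x : u.1 - r <= x <= u.1 + r -> is_derive x 1 (fun x => f (x, y)) (D (x, y)).
  move=> /inS/SU Uxy; apply/is_derive_line.
  have /is_derive_line := derivableP (d1 _ Uxy).
  congr (is_derive _ _ _ _); apply/funext => h; congr f.
  rewrite scale_e1; apply: pair_ext; last exact: add0r.
  by change (h + x = h * 1 + x); rewrite mulr1.
rewrite (@continuous_FTC2 _ (fun x => D (x, y)) (fun x => f (x, y)) _ _ ab).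
- rewrite !f0 ?subee//=.
  + by apply: inS; rewrite lexx ltW.
  + by rewrite addrAC subrr add0r normrN gtr0_norm.
  + by apply: inS; rewrite lexx ltW.
  + by rewrite addrAC subrr add0r gtr0_norm.
- apply: continuous_in_subspaceT => x /set_mem/=; rewrite in_itv/= => /inS/SU Uxy.
  apply: (@continuous_comp _ _ _ (fun x => (x, y)) D); last exact: cD.
  exact: cvg_pair cvg_id (cvg_cst _).
- have cF x : u.1 - r <= x <= u.1 + r -> {for x, continuous (fun x => f (x, y))}.
    by move=> /dF[H _]; apply/differentiable_continuous/derivable1_diffP.
  split.
  + by move=> x; rewrite in_itv/= => /andP[x0 x1]; have [] := dF x; rewrite ?ltW.
  + by apply: cvg_at_right_filter; apply: cF; rewrite lexx ltW.
  + by apply: cvg_at_left_filter; apply: cF; rewrite lexx ltW.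
- move=> x; rewrite in_itv/= => /andP[x0 x1]; rewrite derive1E.
  by have [|_ ->] := dF x; rewrite ?ltW.
Qed.

(** The other half, with the order of integration exchanged. *)
Lemma integral_square_derive2 (U : set (R * R)) (f : R * R -> R) u (r : R) :
  0 < r -> open U -> square u r `<=` U -> Ck 1 U f ->
  (forall v, square u r v -> `|v.2 - u.2| = r -> f v = 0) ->
  (\int[leb2]_(v in square u r) ('D_(Defs.basis R 1) f v)%:E = 0)%E.
Proof.
move=> r0 oU SU Cf f0; have [_ df] := Cf; have [d1 c1] := df (Defs.basis R 1).
pose D (v : R * R) : R := 'D_(Defs.basis R 1) f v.
have cD (v : R * R) : U v -> {for v, continuous D} := c1.1 v.
have iD := integrable_square r0 oU SU cD.
rewrite integral_square12//; apply: integral0_eq => x /=; rewrite in_itv/= => xI.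
have inS y : u.2 - r <= y <= u.2 + r -> square u r (x, y).
  move=> yI; rewrite squareE; by split; rewrite /= in_itv.
have ab : u.2 - r < u.2 + r by rewrite ltrD2l gtrN.
have dF y : u.2 - r <= y <= u.2 + r -> is_derive y 1 (fun y => f (x, y)) (D (x, y)).
  move=> /inS/SU Uxy; apply/is_derive_line.
  have /is_derive_line := derivableP (d1 _ Uxy).
  congr (is_derive _ _ _ _); apply/funext => h; congr f.
  rewrite scale_e2; apply: pair_ext; first exact: add0r.
  by change (h + y = h * 1 + y); rewrite mulr1.
rewrite (@continuous_FTC2 _ (fun y => D (x, y)) (fun y => f (x, y)) _ _ ab).
- rewrite !f0 ?subee//=.
  + by apply: inS; rewrite lexx ltW.
  + by rewrite addrAC subrr add0r normrN gtr0_norm.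
  + by apply: inS; rewrite lexx ltW.
  + by rewrite addrAC subrr add0r gtr0_norm.
- apply: continuous_in_subspaceT => y /set_mem/=; rewrite in_itv/= => /inS/SU Uxy.
  apply: (@continuous_comp _ _ _ (fun y => (x, y)) D); last exact: cD.
  exact: cvg_pair (cvg_cst _) cvg_id.
- have cF y : u.2 - r <= y <= u.2 + r -> {for y, continuous (fun y => f (x, y))}.
    by move=> /dF[H _]; apply/differentiable_continuous/derivable1_diffP.
  split.
  + by move=> y; rewrite in_itv/= => /andP[x0 x1]; have [] := dF y; rewrite ?ltW.
  + by apply: cvg_at_right_filter; apply: cF; rewrite lexx ltW.
  + by apply: cvg_at_left_filter; apply: cF; rewrite lexx ltW.
- move=> y; rewrite in_itv/= => /andP[x0 x1]; rewrite derive1E.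
  by have [|_ ->] := dF y; rewrite ?ltW.
Qed.

End plane_measure.

(** * Integration in a chart *)

Section chart_integral.
Context {R : realType} {M : ptopologicalType} (S : riemannian_surface R M)
  (vol : {measure set (borel M) -> \bar R}).
Hypothesis hvol : is_volume S vol.
Implicit Types (c : chart R M).
#[local] Opaque derive.
Notation leb2 := (@lebesgue_measure R \x @lebesgue_measure R)%E.

Lemma borel_open (A : set (borel M)) : open (A : set M) -> measurable A.
Proof. by move=> oA; exact: sub_sigma_algebra. Qed.

Lemma borel_closed (A : set (borel M)) : closed (A : set M) -> measurable A.
Proof.
by move=> /closed_openC /borel_open /measurableC; rewrite setCK.
Qed.

Lemma borel_measurable_fun (U : set M) (f : M -> R) : open U ->
  (forall p, U p -> {for p, continuous f}) ->
  measurable_fun (U : set (borel M)) (f : borel M -> R).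
Proof.
move=> oU cf mU; apply: (measurability _ (RGenOpens.measurableE R)).
  move=> _ [_ [a [b ->] <-]]; apply: borel_open.
  rewrite openE => p [Up fp].
  have : \forall q \near p, `]a, b[%classic (f q).
    by apply: (cf _ Up); apply: open_nbhs_nbhs; split => //; exact: interval_open.
  by apply: filterS2 (open_nbhs_nbhs (conj oU Up)) => q; split.
exact: mU.
Qed.

Section square_in_chart.
Variables (c : chart R M) (u0 : R * R) (r : R).
Hypotheses (Ac : atlas S c) (sq : square u0 r `<=` cimg c).
Let Q := square u0 r.

Definition chart_square : set M := cinv c @` Q.

Lemma closed_chart_square : closed chart_square.
Proof.
apply: compact_closed; first exact: (surface_hausdorff S).
apply: (@continuous_compact _ _ (cinv c) Q); last exact: compact_square.
apply: continuous_in_subspaceT => u /set_mem /sq cu.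
exact: cinv_continuous Ac u cu.
Qed.

Lemma chart_squareE p : chart_square p <-> cdom c p /\ Q (cmap c p).
Proof.
split=> [[u Qu <-]|[cp Qp]].
  by rewrite (cinvK Ac (sq Qu)); split=> //; exact: cdom_cinv Ac _ (sq Qu).
by exists (cmap c p) => //; exact: cmapK Ac _ cp.
Qed.

Let mA : measurable (chart_square : set (borel M)).
Proof. exact: borel_closed closed_chart_square. Qed.

Let w (u : R * R) : R := if `[< Q u >] then vdensity S c u else 0.

Let w_ge0 u : 0 <= w u.
Proof.
by rewrite /w; case: asboolP => // Qu; apply/ltW/(vdensity_gt0 Ac); exact: sq.
Qed.

(** The default [point] is harmless: outside [Q] it carries weight 0. *)
Let phi (u : R * R) : borel M := if `[< Q u >] then cinv c u else point.

(** The volume on the chart square is the superposition over [u] of point masses at [cinv c u]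
    weighted by the density. *)
Let k (u : R * R) : {measure set (borel M) -> \bar R} :=
  mscale (NngNum (w_ge0 u)) (dirac (phi u)).

Let kE u (U : set (borel M)) : k u U =
  ((EFin \o vdensity S c) \_ (Q `&` [set u | U (cinv c u)])) u.
Proof.
rewrite /k /= /mscale /= diracE /phi /w /patch in_setI.
have -> : (u \in Q) = `[< Q u >] by rewrite /in_mem.
case: asboolP => Qu /=; last by rewrite mul0e.
have -> : (u \in [set u | U (cinv c u)]) = (cinv c u \in U) by rewrite /in_mem.
by case: (_ \in U); rewrite ?mule1 ?mule0.
Qed.

Let mQU (U : set (borel M)) : measurable U ->
  measurable (Q `&` [set u | U (cinv c u)]).
Proof.
suff : measurable_fun Q (cinv c : R * R -> borel M).
  by move=> /(_ (@measurable_square _ u0 r) U); apply.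
move=> mQ; apply: (@measurability _ _ _ _ Q (cinv c : R * R -> borel M) open erefl _ mQ).
move=> _ [V oV <-].
have -> : Q `&` cinv c @^-1` V = Q `&` [set u | cimg c u /\ V (cinv c u)].
  by apply/seteqP; split=> u [Qu]; [move=> Vu; split=> //; split=> //; exact: sq|case].
apply: measurableI => //; apply: measurable_open_plane.
exact: open_chart_preimage Ac _ oV.
Qed.

Lemma measurable_vdensity : measurable_fun Q (vdensity S c).
Proof.
apply: measurable_funS sq (continuous_measurable_plane (cimg_open Ac) _).
  by apply: measurable_open_plane; exact: cimg_open Ac.
by move=> u cu; exact: Ck_continuous (Ck_vdensity 0 Ac) cu.
Qed.

Let mk (U : set (borel M)) : measurable U -> measurable_fun [set: R * R] (k ^~ U).
Proof.
move=> mU; have -> : k ^~ U =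
    (EFin \o vdensity S c) \_ (Q `&` [set u | U (cinv c u)]).
  by apply/funext => u; rewrite kE.
apply/(measurable_restrictT _ (mQU mU)); apply/measurable_EFinP.
apply: measurable_funS measurable_vdensity; last by move=> u [].
exact: measurable_square.
Qed.

Let volE (U : set (borel M)) : measurable U -> (mrestr vol mA U = \int[leb2]_u k u U)%E.
Proof.
move=> mU; rewrite /mrestr (hvol Ac); last 2 first.
- exact: measurableI.
- by move=> p [_ /chart_squareE[]].
rewrite (_ : cmap c @` _ = Q `&` [set u | U (cinv c u)]).
  by rewrite integral_mkcond; apply: eq_integral => u _; rewrite kE.
apply/seteqP; split=> [_ [p [Up /chart_squareE[cp Qp]] <-]|u [Qu Uu]].
  by split=> //=; rewrite (cmapK Ac cp).
by exists (cinv c u); [split=> //; exists u|rewrite (cinvK Ac (sq Qu))].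
Qed.

Let ge0_integral_chart0 (f : M -> \bar R) : (forall p, (0 <= f p)%E) ->
  measurable_fun [set: borel M] (f : borel M -> \bar R) ->
  (\int[mrestr vol mA]_p f p =
   \int[leb2]_(u in Q) ((vdensity S c u)%:E * f (cinv c u)))%E.
Proof.
move=> f0 mf.
have H := @ge0_integral_disintegration _ _ _ _ _ leb2 (mrestr vol mA) k mk volE f f0 mf.
rewrite H.
rewrite [RHS]integral_mkcond; apply: eq_integral => u _.
rewrite ge0_integral_mscale// integral_dirac//= diracT mul1e /patch /w /phi.
have -> : (u \in Q) = `[< Q u >] by rewrite /in_mem.
by case: asboolP => //= _; rewrite mul0e.
Qed.

Lemma integral_chart (f : M -> \bar R) :
  measurable_fun (chart_square : set (borel M)) (f : borel M -> \bar R) ->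
  (\int[vol]_(p in chart_square) f p =
   \int[leb2]_(u in Q) (f (cinv c u) * (vdensity S c u)%:E))%E.
Proof.
move=> mf; pose h : borel M -> \bar R := f \_ chart_square.
have mh : measurable_fun [set: borel M] h by apply/(measurable_restrictT _ mA).
have E : (\int[vol]_(p in chart_square) f p = \int[mrestr vol mA]_p h p)%E.
  rewrite /h -integral_mkcond; apply: eq_measure_integral => /= U mU UA.
  by rewrite /mrestr setIidl.
rewrite E integralE !ge0_integral_chart0//; last 2 first.
- exact: measurable_funeneg.
- exact: measurable_funepos.
rewrite [RHS]integralE.
have hE u : Q u -> h (cinv c u) = f (cinv c u) /\ 0 <= vdensity S c u.
  move=> Qu; split; last exact/ltW/(vdensity_gt0 Ac (sq Qu)).
  by rewrite /h /patch mem_set//; exists u.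
have pE u : Q u -> ((vdensity S c u)%:E * h^\+ (cinv c u))%E =
    ((fun v => f (cinv c v) * (vdensity S c v)%:E)^\+ u)%E.
  move=> /hE[hu d0]; rewrite !funeposE hu muleC.
  by rewrite -[in RHS](mul0e (vdensity S c u)%:E) maxe_pMl.
have nE u : Q u -> ((vdensity S c u)%:E * h^\- (cinv c u))%E =
    ((fun v => f (cinv c v) * (vdensity S c v)%:E)^\- u)%E.
  move=> /hE[hu d0]; rewrite !funenegE hu muleC.
  by rewrite -mulNe -[in RHS](mul0e (vdensity S c u)%:E) maxe_pMl.
by apply: (congr2 (fun a b => a - b)%E); apply: eq_integral => u /set_mem Qu; [exact: pE|exact: nE].
Qed.

End square_in_chart.

End chart_integral.

(** * The Green function *)

Section square_integrals.
Context {R : realType}.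
#[local] Opaque derive.
Notation leb2 := (@lebesgue_measure R \x @lebesgue_measure R)%E.

(** By continuity [F] exceeds half of [F u] on a smaller square of positive measure. *)
Lemma integral_square_gt0 (U : set (R * R)) (F : R * R -> R) u (r : R) : 0 < r ->
  open U -> square u r `<=` U -> (forall v, U v -> {for v, continuous F}) ->
  (forall v, square u r v -> 0 <= F v) -> 0 < F u ->
  (0 < \int[leb2]_(v in square u r) (F v)%:E)%E.
Proof.
move=> r0 oU SU cF F0 Fu.
have Su : square u r u by rewrite /square /= subrr normr0 ltW.
have [s0 s00 Hs] := (continuous_at_P u F).1 (cF _ (SU _ Su)) (F u / 2) (divr_gt0 Fu (ltr0n _ 2)).
pose s := Num.min (s0 / 2) r.
have s_gt0 : 0 < s by rewrite lt_min r0 divr_gt0.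
have ss0 : s < s0 by rewrite /s gt_min; apply/orP; left; lra.
have sr : s <= r by rewrite /s ge_min lexx orbT.
have Ssub : square u s `<=` square u r by move=> v /= /le_trans; apply.
have mF : measurable_fun (square u r) (EFin \o F).
  apply/measurable_EFinP.
  apply: measurable_funS SU (continuous_measurable_plane oU cF).
  exact: measurable_open_plane.
have F0' (v : R * R) : square u r v -> (0 <= (EFin \o F) v)%E.
  by move=> Sv; rewrite lee_fin; exact: F0.
have := @ge0_subset_integral _ _ _ leb2 _ _ (measurable_square u s) (measurable_square u r)
  (EFin \o F) mF F0' Ssub.
apply: lt_le_trans.
have mF' : measurable_fun (square u s) (EFin \o F).
  by apply: measurable_funS mF => //; exact: measurable_square.
apply: (@lt_le_trans _ _ (\int[leb2]_(v in square u s) (cst (F u / 2)%:E v))%E).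
  have L := leb2_square u s_gt0.
  have E := integral_cst leb2 (measurable_square u s) (F u / 2)%:E.
  apply: (@lt_le_trans _ _ ((F u / 2)%:E * ((s + s) * (s + s))%:E)%E).
    by rewrite -EFinM lte_fin !mulr_gt0// ?invr_gt0// addr_gt0.
  by rewrite E -L; exact: lexx.
apply: (@ge0_le_integral _ _ _ leb2 _ (measurable_square u s)).
- by move=> v _; rewrite lee_fin divr_ge0// ltW.
- exact: measurable_cst.
- exact: mF'.
- move=> v Sv; rewrite lee_fin.
  have := Hs v (le_lt_trans Sv ss0).
  by rewrite ltr_distlC => /andP[h1 h2]; lra.
Qed.

Definition bump2 (u : R * R) (r : R) (v : R * R) : R :=
  bumpR u.1 r v.1 * bumpR u.2 r v.2.

Lemma Ck_bump2 k u r : Ck k [set: R * R] (bump2 u r).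
Proof.
apply: CkM; first exact: openT.
- exact: (Ck_comp_real openT (Ck_bumpR k u.1 r) (Ck_cfst _ _)).
- exact: (Ck_comp_real openT (Ck_bumpR k u.2 r) (Ck_csnd _ _)).
Qed.

Lemma bump2_eq0 u r v : r <= `|v - u| -> bump2 u r v = 0.
Proof.
rewrite leNgt square_normlt negb_and -!leNgt => /orP[/bumpR_eq0 E|/bumpR_eq0 E].
  by rewrite /bump2 E mul0r.
by rewrite /bump2 E mulr0.
Qed.

(** If G(u) were positive, G would be positive near [u] and its integral against a narrow bump would
    be positive too. The square is twice as wide as the bump, so that in the application the test
    function vanishes near the boundary. *)
Lemma fundamental_lemma (U : set (R * R)) (G : R * R -> R) u (k : R) : open U -> U u ->
  (forall v, U v -> {for v, continuous G}) -> 0 < k ->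
  (forall r, 0 < r -> r + r < k ->
     (\int[leb2]_(v in square u (r + r)) (bump2 u r v * G v)%:E = 0)%E) ->
  G u = 0.
Proof.
(* One inequality is enough: it is applied to [G] and to its opposite. *)
suff pos (k' : R) (H : R * R -> R) : open U -> U u -> (forall v, U v -> {for v, continuous H}) ->
    0 < k' -> (forall r, 0 < r -> r + r < k' ->
     (\int[leb2]_(v in square u (r + r)) (bump2 u r v * H v)%:E = 0)%E) -> H u <= 0.
  move=> oU Uu cG k0 HG; apply/le_anti; rewrite (pos k G)//= -oppr_le0.
  have [s s0 Hs] := (nearN_P u U).1 (open_nbhs_nbhs (conj oU Uu)).
  apply: (pos (Num.min k s) (fun v => - G v)) => //.
  - by move=> v Uv; apply: continuousN; exact: cG.
  - by rewrite lt_min k0.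
  - move=> r r0; rewrite lt_min => /andP[rk rs].
    have SU : square u (r + r) `<=` U by move=> v Sv; apply: Hs; exact: le_lt_trans rs.
    have I : leb2.-integrable (square u (r + r)) (EFin \o (fun v => bump2 u r v * G v)).
      apply: (integrable_square (addr_gt0 r0 r0) oU SU) => v Uv; apply: continuousM; last exact: cG.
      exact: (Ck_continuous (Ck_bump2 0 u r)).
    have A := @integrable_add_def _ _ _ leb2 _ (measurable_square u (r + r)) _ I.
    have E := @integralN _ _ _ leb2 (square u (r + r)) (EFin \o (fun v => bump2 u r v * G v)) A.
    transitivity (- (0 : \bar R))%E; last exact: oppe0.
    rewrite -(HG r r0 rk); apply: etrans _ E.
    by apply: eq_integral => v _; rewrite /= mulrN.
move=> {}oU {}Uu cH k0 HH; rewrite leNgt; apply/negP => Hu.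
have [s1 s10 H1] := (nearN_P u U).1 (open_nbhs_nbhs (conj oU Uu)).
have [s2 s20 H2] := (continuous_at_P u H).1 (cH _ Uu) _ Hu.
pose r := Num.min k' (Num.min s1 s2) / 4.
have m0 : 0 < Num.min k' (Num.min s1 s2) by rewrite !lt_min k0 s10 s20.
have : Num.min k' (Num.min s1 s2) <= k' by rewrite ge_min lexx.
have : Num.min k' (Num.min s1 s2) <= s1 by rewrite !ge_min lexx orbT.
have : Num.min k' (Num.min s1 s2) <= s2 by rewrite !ge_min lexx !orbT.
move=> ms2 ms1 mk.
have r0 : 0 < r by rewrite divr_gt0.
have rE : r * 4 = Num.min k' (Num.min s1 s2) by rewrite /r; lra.
have r20 := addr_gt0 r0 r0.
have rk : r + r < k' by lra.
have SU : square u (r + r) `<=` U by move=> v Sv; apply: H1; apply: (le_lt_trans Sv); lra.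
have := @integral_square_gt0 U (fun v => bump2 u r v * H v) u (r + r) r20 oU SU.
rewrite HH// ltxx => C; suff : false by []; apply: C.
- move=> v Uv; apply: continuousM; last exact: cH.
  exact: (Ck_continuous (Ck_bump2 0 u r)).
- move=> v Sv; rewrite mulr_ge0//; first by rewrite mulr_ge0 ?bumpR_ge0.
  have : `|v - u| < s2 by apply: (le_lt_trans Sv); lra.
  by move=> /H2; rewrite ltr_distl => /andP[? ?]; lra.
- by apply: mulr_gt0 => //; apply: mulr_gt0; apply: bumpR_gt0; rewrite subrr normr0.
Qed.

End square_integrals.

Lemma sube0_eq (R : realDomainType) (x y : \bar R) :
  y \is a fin_num -> (x - y = 0)%E -> x = y.
Proof.
case: y => // y _; case: x => [x|//|//] /eqP.
by rewrite -EFinB eqe subr_eq0 => /eqP ->.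
Qed.

(** In the divergence of a grad h - b grad f the products of first derivatives cancel; the
    hypothesis expresses the symmetry of the metric. *)
Lemma green_algebra (R : comRingType) (a b h1 h2 f1 f2 p0 p1 q0 q1 x1 x2 y1 y2 : R) :
  p0 * x1 + p1 * x2 = q0 * y1 + q1 * y2 ->
  (a * h1 + p0 * x1 - (b * f1 + q0 * y1)) + (a * h2 + p1 * x2 - (b * f2 + q1 * y2)) =
  a * (h1 + h2) - b * (f1 + f2).
Proof. by move=> E; rewrite -[RHS]addr0 -(subrr (q0 * y1 + q1 * y2)) -{1}E; ring. Qed.

Section weak_to_strong.
Context {R : realType} {M : ptopologicalType} (S : riemannian_surface R M)
  (vol : {measure set (borel M) -> \bar R}).
Hypothesis hvol : is_volume S vol.
Implicit Types (c : chart R M) (f h : M -> R).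
#[local] Opaque derive.
Notation e1 := (Defs.basis R 0).
Notation e2 := (Defs.basis R 1).
Notation leb2 := (@lebesgue_measure R \x @lebesgue_measure R)%E.

Definition chart_laplacian c f (u : R * R) : R := divergence S c (gradient S c f) u.

(** Frees the Laplacian from the selected chart: any chart around the point may be used. *)
Lemma laplacian_chart c (U : set (R * R)) f p : atlas S c -> cdom c p -> open U ->
  U `<=` cimg c -> U (cmap c p) -> Ck 2 U (f \o cinv c) ->
  laplacian S f p = chart_laplacian c f (cmap c p).
Proof.
move=> Ac cp oU UC Up Cf; have [Ac' c'p] := chart_atP S p.
rewrite /laplacian /chart_laplacian.
by apply: (divergence_change Ac' Ac c'p cp oU UC Up Cf).
Qed.

Lemma chart_laplacian_near c f h u : atlas S c -> cimg c u ->
  {near u, f \o cinv c =1 h \o cinv c} ->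
  chart_laplacian c f u = chart_laplacian c h u.
Proof.
move=> Ac cu fh.
have F i : {near u, flux S c f i =1 flux S c h i}.
  have oC := cimg_open Ac.
  apply: filterS2 (open_nbhs_nbhs (conj oC cu)) (near_join fh) => v cv fhv.
  by rewrite (fluxE f i Ac cv) (fluxE h i Ac cv) (near_eq_derive e1 fhv) (near_eq_derive e2 fhv).
by rewrite /chart_laplacian !divergence_flux (near_eq_derive _ (F 0)) (near_eq_derive _ (F 1)).
Qed.

Lemma laplacian_near f h p : {near p, f =1 h} -> laplacian S f p = laplacian S h p.
Proof.
move=> fh; have [Ac cp] := chart_atP S p; set c := chart_at S p in Ac cp.
apply: (chart_laplacian_near Ac (cimg_cmap cp)).
have cK := cinv_continuous Ac (cimg_cmap cp).
by apply: (cK [set q | f q = h q]); rewrite (cmapK Ac cp).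
Qed.

Lemma chart_laplacianE c (U : set (R * R)) f u : atlas S c -> U `<=` cimg c -> U u ->
  vdensity S c u * chart_laplacian c f u =
  'D_e1 (flux S c f 0) u + 'D_e2 (flux S c f 1) u.
Proof.
move=> Ac UC Uu; rewrite /chart_laplacian divergence_flux mulrA mulfV ?mul1r//.
by rewrite gt_eqF// (vdensity_gt0 Ac)//; exact: UC.
Qed.

Lemma Ck_chart_laplacian c (U : set (R * R)) f k : atlas S c -> open U -> U `<=` cimg c ->
  Ck k.+2 U (f \o cinv c) -> Ck k U (chart_laplacian c f).
Proof.
move=> Ac oU UC Cf.
have D i j : Ck k U ('D_(Defs.basis R j) (flux S c f i)).
  by have [_ /(_ (Defs.basis R j))[]] := Ck_flux i Ac oU UC Cf.
have V : Ck k U (fun u => (vdensity S c u)^-1).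
  apply: (Ck_comp_real oU (Ck_inv k) (Ck_sub UC (Ck_vdensity k Ac))).
  by move=> u /UC cu; exact: vdensity_gt0 Ac cu.
apply: Ck_eq oU _ (CkM oU V (CkD oU (D 0 0) (D 1 1))) => u _.
by rewrite /chart_laplacian divergence_flux.
Qed.

(** The divergence theorem for the field [Z], which vanishes on the boundary of the square because
    [h] vanishes near it. *)
Lemma green_identity c (U : set (R * R)) u (r : R) f h : atlas S c -> open U ->
  U `<=` cimg c -> 0 < r -> square u r `<=` U ->
  Ck 2 U (f \o cinv c) -> Ck 2 U (h \o cinv c) ->
  (forall v, `|v - u| = r -> \forall w \near v, h (cinv c w) = 0) ->
  (\int[leb2]_(v in square u r)
     (f (cinv c v) * chart_laplacian c h v * vdensity S c v)%:E =
   \int[leb2]_(v in square u r)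
     (h (cinv c v) * chart_laplacian c f v * vdensity S c v)%:E)%E.
Proof.
move=> Ac oU UC r0 SU Cf Ch h0.
pose Z i v := f (cinv c v) * flux S c h i v - h (cinv c v) * flux S c f i v.
have Cflux (k : M -> R) i : Ck 2 U (k \o cinv c) -> Ck 1 U (flux S c k i).
  by move=> Ck2k; exact: (Ck_flux i Ac oU UC Ck2k).
have CZ i : Ck 1 U (Z i).
  exact: (CkB oU (CkM oU (Ck_S Cf) (Cflux h i Ch)) (CkM oU (Ck_S Ch) (Cflux f i Cf))).
have Z0 i v : square u r v -> `|v - u| = r -> Z i v = 0.
  move=> Sv /h0 hv; have E := nbhs_singleton hv.
  have D w : 'D_w (h \o cinv c) v = 0.
    transitivity ('D_w (fun=> 0 : R) v); last by rewrite (derive_cst 0).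
    by apply: near_eq_derive; apply: filterS hv => z /= ->.
  by rewrite /Z E mul0r subr0 (fluxE _ _ Ac (UC _ (SU _ Sv))) !D !mulr0 subrr if_same !mulr0.
have face1 v : square u r v -> `|v.1 - u.1| = r -> Z 0 v = 0.
  move=> Sv vr; apply: (Z0) => //; apply/le_anti; rewrite Sv/=.
  by rewrite -[X in X <= _]vr prod_normE le_max lexx.
have face2 v : square u r v -> `|v.2 - u.2| = r -> Z 1 v = 0.
  move=> Sv vr; apply: (Z0) => //; apply/le_anti; rewrite Sv/=.
  by rewrite -[X in X <= _]vr prod_normE le_max lexx orbT.
have I1 := integral_square_derive1 r0 oU SU (CZ 0) face1.
have I2 := integral_square_derive2 r0 oU SU (CZ 1) face2.
have cL (k : M -> R) : Ck 2 U (k \o cinv c) -> forall g : M -> R, Ck 2 U (g \o cinv c) ->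
    forall v, U v -> {for v, continuous (fun w : R * R => g (cinv c w) * chart_laplacian c k w * vdensity S c w)}.
  move=> Ck2k g Cg v Uv; apply: (@Ck_continuous _ _ _ U 0) => //.
  apply: (CkM oU _ (Ck_sub UC (Ck_vdensity 0 Ac))).
  apply: (CkM oU _ (Ck_chart_laplacian Ac oU UC Ck2k)).
  exact: (Ck_le _ Cg).
pose A v := f (cinv c v) * chart_laplacian c h v * vdensity S c v.
pose B v := h (cinv c v) * chart_laplacian c f v * vdensity S c v.
have iA := integrable_square r0 oU SU (cL h Ch f Cf).
have iB := integrable_square r0 oU SU (cL f Cf h Ch).
have cD i j v : U v -> {for v, continuous ('D_(Defs.basis R j) (Z i))}.
  by have [_ /(_ (Defs.basis R j))[_ [cD _]]] := CZ i; exact: cD.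
have iD1 := integrable_square r0 oU SU (cD 0 0).
have iD2 := integrable_square r0 oU SU (cD 1 1).
have key v : square u r v -> 'D_e1 (Z 0) v + 'D_e2 (Z 1) v = A v - B v.
  move=> /SU Uv.
  have dD k w : Ck 1 U k -> is_derive v w k ('D_w k v).
    by move=> [_ /(_ w)[dk _]]; apply: derivableP; exact: dk.
  have dZ i w : 'D_w (Z i) v = (f (cinv c v) * 'D_w (flux S c h i) v + flux S c h i v * 'D_w (f \o cinv c) v)
     - (h (cinv c v) * 'D_w (flux S c f i) v + flux S c f i v * 'D_w (h \o cinv c) v).
    apply: derive_val; apply: is_derive_sub; apply: is_derive_mul.
    - exact: dD (Ck_S Cf).
    - exact: dD (Cflux h i Ch).
    - exact: dD (Ck_S Ch).
    - exact: dD (Cflux f i Cf).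
  have EA : A v = f (cinv c v) * ('D_e1 (flux S c h 0) v + 'D_e2 (flux S c h 1) v).
    by rewrite -(chart_laplacianE h Ac UC Uv) mulrCA mulrC.
  have EB : B v = h (cinv c v) * ('D_e1 (flux S c f 0) v + 'D_e2 (flux S c f 1) v).
    by rewrite -(chart_laplacianE f Ac UC Uv) mulrCA mulrC.
  rewrite EA EB (dZ 0 e1) (dZ 1 e2).
  have Fh i := fluxE h i Ac (UC _ Uv); have Ff i := fluxE f i Ac (UC _ Uv).
  have sym : flux S c h 0 v * 'D_e1 (f \o cinv c) v + flux S c h 1 v * 'D_e2 (f \o cinv c) v =
             flux S c f 0 v * 'D_e1 (h \o cinv c) v + flux S c f 1 v * 'D_e2 (h \o cinv c) v.
    rewrite (Fh 0) (Fh 1) (Ff 0) (Ff 1) /= (metric_symE 1 0 Ac (UC _ Uv)).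
    set x1 := metric _ _ _ _ _; set x2 := metric _ _ _ _ _; set x3 := metric _ _ _ _ _.
    set w1 := 'D__ _ _; set w2 := 'D__ _ _; set w3 := 'D__ _ _; set w4 := 'D__ _ _.
    set n := _^-1; ring.
  exact: green_algebra sym.
have eqAB : (\int[leb2]_(v in square u r) (A v)%:E - \int[leb2]_(v in square u r) (B v)%:E = 0)%E.
  have EB := @integralB _ _ _ leb2 _ (measurable_square u r) _ _ iA iB.
  have ED := @integralD _ _ _ leb2 _ (measurable_square u r) _ _ iD1 iD2.
  apply: etrans (esym EB) _.
  transitivity (\int[leb2]_(v in square u r) ('D_e1 (Z 0) v)%:E +
                \int[leb2]_(v in square u r) ('D_e2 (Z 1) v)%:E)%E; last first.
    by rewrite I1 I2 adde0.
  apply: etrans _ ED; apply: eq_integral => v /set_mem Sv.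
  by rewrite /= -EFinB -EFinD key.
have := @integrable_fin_num _ _ _ leb2 _ (measurable_square u r) _ iB => fB.
exact: sube0_eq fB eqAB.
Qed.

Lemma chart_laplacian_cst c (k : R) u : atlas S c -> cimg c u ->
  chart_laplacian c (fun=> k) u = 0.
Proof.
move=> Ac cu.
have F i : {near u, flux S c (fun=> k) i =1 (fun=> 0)}.
  apply: filterS (open_nbhs_nbhs (conj (cimg_open Ac) cu)) => v cv.
  have D w : 'D_w ((fun=> k) \o cinv c) v = 0 by rewrite (derive_cst k).
  by rewrite (fluxE _ _ Ac cv) !D !mulr0 subrr if_same mulr0.
rewrite /chart_laplacian divergence_flux (near_eq_derive e1 (F 0)) (near_eq_derive e2 (F 1)).
by rewrite !(derive_cst 0) addr0 mulr0.
Qed.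

Lemma laplacian_cst (k : R) p : laplacian S (fun=> k) p = 0.
Proof.
have [Ac cp] := chart_atP S p.
exact: (chart_laplacian_cst k Ac (cimg_cmap cp)).
Qed.

Lemma integral_chart_continuous c (U : set (R * R)) u (r : R) (F : M -> R)
    (G : R * R -> R) : atlas S c -> open U -> U `<=` cimg c -> square u r `<=` U ->
  (forall v, U v -> {for v, continuous G}) ->
  (forall v, square u r v -> F (cinv c v) = G v) ->
  (\int[vol]_(p in chart_square c u r) (F p)%:E =
   \int[leb2]_(v in square u r) (G v * vdensity S c v)%:E)%E.
Proof.
move=> Ac oU UC SU cG FG; have SC := subset_trans SU UC.
have FE p : chart_square c u r p -> F p = G (cmap c p).
  by move=> [v Sv <-]; rewrite (cinvK Ac (SC _ Sv)) FG.
have mF : measurable_fun (chart_square c u r : set (borel M)) (EFin \o F : borel M -> \bar R).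
  apply/measurable_EFinP.
  apply: (@eq_measurable_fun _ _ _ _ _ (G \o cmap c : borel M -> R)).
    by move=> p /set_mem /FE ->.
  have oW := open_chart_image Ac oU.
  have mS : measurable (chart_square c u r : set (borel M)).
    exact: borel_closed (closed_chart_square Ac SC).
  apply: (measurable_funS (borel_open oW)).
    by move=> p /(chart_squareE Ac SC)[cp Sp]; split=> //; exact: SU.
  apply: borel_measurable_fun oW _ => p [cp Up].
  apply: continuous_comp; first exact: cmap_continuous Ac _ cp.
  exact: cG.
rewrite (integral_chart hvol Ac SC mF); apply: eq_integral => v /set_mem Sv.
by rewrite /= FG// -EFinM.
Qed.

Section green_function.
Variable E : M -> M -> R.
Hypothesis hE : is_green S vol E.
Variable x0 : M.
Let a := (fine (vol setT))^-1.

Lemma open_neq : open [set p : M | x0 <> p].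
Proof.
have := @accessible_closed_set1 _ (hausdorff_accessible (surface_hausdorff S)) x0.
by move=> /closed_openC; congr open; apply/seteqP; split=> p /= np pE; apply: np.
Qed.

Definition punctured c := [set u | cimg c u /\ x0 <> cinv c u].

Lemma open_punctured c : atlas S c -> open (punctured c).
Proof. by move=> Ac; exact: open_chart_preimage Ac _ open_neq. Qed.

Lemma Ck_green c k : atlas S c -> Ck k (punctured c) (E x0 \o cinv c).
Proof.
by move=> Ac; have [CE _ _ _ _] := hE; exact: (slice_Ck2 x0 (CE k) Ac).
Qed.

(** The equation is tested against a bump [h] supported in a chart square that avoids [x0], so the
    point mass contributes nothing. [green_identity] moves the Laplacian onto [E x0], and
    [fundamental_lemma] removes the test function. *)
Lemma laplacian_green p : x0 <> p -> laplacian S (E x0) p = a.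
Proof.
move=> xp; have [Ac cp] := chart_atP S p; set c := chart_at S p in Ac cp.
have [CE iE EL Esym _] := hE.
have oU := open_punctured Ac; have CU k := Ck_green k Ac.
have UC : punctured c `<=` cimg c by move=> u [].
have Up : punctured c (cmap c p) by split; [exact: cimg_cmap|rewrite (cmapK Ac cp)].
set u := cmap c p in Up *; set U := punctured c in oU CU UC Up *.
have [k k0 kU] := (nearN_P _ _).1 (open_nbhs_nbhs (conj oU Up)).
rewrite /laplacian -/c -/u -/(chart_laplacian c (E x0) u).
pose G v := (chart_laplacian c (E x0) v - a) * vdensity S c v.
have cL : Ck 0 U (chart_laplacian c (E x0)) := Ck_chart_laplacian Ac oU UC (CU 2%N).
have CG : Ck 0 U G.
  apply: (CkM oU _ (Ck_sub UC (Ck_vdensity 0 Ac))).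
  exact: (CkB oU cL (Ck_cst _ _ _)).
have : G u = 0.
  apply: (fundamental_lemma oU Up (fun v Uv => Ck_continuous CG Uv) k0) => r r0 rk.
  have r20 := addr_gt0 r0 r0.
  have SU : square u (r + r) `<=` U by move=> v Sv; apply: kU; exact: le_lt_trans rk.
  have Sr : square u r `<=` square u (r + r) by move=> v /= Sv; apply: le_trans Sv _; lra.
  have SC := subset_trans SU UC.
  have sC := subset_trans Sr SC.
  pose B := bump2 u r; pose h := extend0 c B.
  have B0 v : r <= `|v - u| -> B v = 0 := @bump2_eq0 _ u r v.
  have Sh : smooth_fun S h by move=> c' Ac' n; exact: (Ck_extend0 Ac sC B0 Ac' (Ck_bump2 n u r)).
  have hB v : cimg c v -> h (cinv c v) = B v.
    by move=> cv; rewrite /h extend0E ?(cinvK Ac cv)//; exact: cdom_cinv Ac _ cv.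
  have Ch n : Ck n U (h \o cinv c) := Ck_sub UC (Sh c Ac n).
  have h0 q : ~ (cinv c @` square u r) q -> h q = 0 := @extend0_out _ _ S c u r B Ac B0 q.
  have hx0 : h x0 = 0.
    by apply: h0 => -[v /Sr /SU[_ xv] vE]; apply: xv.
  have lap_out q : ~ chart_square c u (r + r) q -> laplacian S h q = 0.
    move=> nq; rewrite (@laplacian_near _ (fun=> 0)) ?laplacian_cst//.
    have oC := closed_openC (closed_chart_square Ac SC).
    apply: filterS (open_nbhs_nbhs (conj oC nq)) => z nz; apply: h0.
    by move=> -[v /Sr Sv vE]; apply: nz; exists v.
  have h_out q : ~ chart_square c u (r + r) q -> h q = 0.
    by move=> nz; apply: h0 => -[v /Sr Sv vE]; apply: nz; exists v.
  have mk (F : M -> R) : (forall q, ~ chart_square c u (r + r) q -> F q = 0) ->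
      (\int[vol]_q (F q)%:E = \int[vol]_(q in chart_square c u (r + r)) (F q)%:E)%E.
    move=> F0; rewrite [RHS]integral_mkcond; apply: eq_integral => q _; rewrite /patch.
    by case: ifPn => // /negP nq; rewrite F0// => Sq; apply: nq; exact/mem_set.
  have I1 := mk _ h_out.
  have I2 : (\int[vol]_q (E q x0 * laplacian S h q)%:E =
      \int[vol]_(q in chart_square c u (r + r)) (E q x0 * laplacian S h q)%:E)%E.
    by apply: mk => q /lap_out ->; rewrite mulr0.
  have cB v : U v -> {for v, continuous B}.
    by move=> _; exact: (Ck_continuous (Ck_bump2 0 u r) I).
  have cLh := Ck_chart_laplacian Ac oU UC (Ch 2%N).
  have CV := Ck_sub UC (Ck_vdensity 0 Ac).
  have J1 : (\int[vol]_(q in chart_square c u (r + r)) (h q)%:E =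
      \int[leb2]_(v in square u (r + r)) (B v * vdensity S c v)%:E)%E.
    by apply: (integral_chart_continuous Ac oU UC SU cB) => v /SC cv; exact: hB.
  have J2 : (\int[vol]_(q in chart_square c u (r + r)) (E q x0 * laplacian S h q)%:E =
      \int[leb2]_(v in square u (r + r))
        (E x0 (cinv c v) * chart_laplacian c h v * vdensity S c v)%:E)%E.
    apply: (integral_chart_continuous Ac oU UC SU) => v.
      by apply: Ck_continuous; exact: (CkM oU (CU 0%N) cLh).
    move=> Sv; have Uv := SU _ Sv; have cv := UC _ Uv.
    rewrite (laplacian_chart Ac (cdom_cinv Ac cv) oU UC _ (Ch 2%N)).
      by rewrite (cinvK Ac cv) Esym.
    by rewrite (cinvK Ac cv).
  (* The bump lives in the square of half-width [r], while the integrals run over half-width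
     [r + r]. *)
  have bdry v : `|v - u| = r + r -> \forall w \near v, h (cinv c w) = 0.
    move=> vr; have Uv : U v by apply: SU; rewrite /square /= vr.
    have near_r : \forall w \near v, r <= `|w - u|.
      apply/(nearN_P _ _).2; exists r => // w wv.
      by have := ler_distD w v u; rewrite vr (distrC v w); lra.
    apply: filterS2 (open_nbhs_nbhs (conj oU Uv)) near_r => w Uw rw.
    by rewrite (hB _ (UC _ Uw)); exact: B0.
  have GI := green_identity Ac oU UC r20 SU (CU 2%N) (Ch 2%N) bdry.
  have iY := integrable_square r20 oU SU
    (fun v Uv => Ck_continuous (CkM oU (Ck_sub (@subsetT _ U) (Ck_bump2 0 u r)) CV) Uv).
  have iX := integrable_square r20 oU SU (fun v Uv => Ck_continuous
    (CkM oU (CkM oU (Ck_sub (@subsetT _ U) (Ck_bump2 0 u r)) cL) CV) Uv).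
  have mQ := measurable_square u (r + r).
  have hBX : (\int[leb2]_(v in square u (r + r))
      (h (cinv c v) * chart_laplacian c (E x0) v * vdensity S c v)%:E =
      \int[leb2]_(v in square u (r + r)) (B v * chart_laplacian c (E x0) v * vdensity S c v)%:E)%E.
    by apply: eq_integral => v /set_mem Sv; rewrite (hB v (SC _ Sv)).
  have := EL h x0 Sh; rewrite /Rintegral hx0 oppr0 add0r I1 I2 J1 J2 GI hBX.
  have fX := @integrable_fin_num _ _ _ leb2 _ mQ _ iX.
  have fY := @integrable_fin_num _ _ _ leb2 _ mQ _ iY.
  move=> XY.
  have iaY := @integrableZl _ _ _ leb2 _ mQ a _ iY.
  have EB := @integralB _ _ _ leb2 _ mQ _ _ iX iaY.
  have EZ := @integralZl _ _ _ leb2 _ mQ _ iY a.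
  transitivity (\int[leb2]_(v in square u (r + r)) (B v * chart_laplacian c (E x0) v * vdensity S c v)%:E
     - a%:E * \int[leb2]_(v in square u (r + r)) (B v * vdensity S c v)%:E)%E.
    apply: etrans (etrans EB _); last by congr (_ - _)%E; exact: EZ.
    apply: eq_integral => v _; rewrite /G /=; congr (_%:E); ring.
  rewrite -(fineK fX) -(fineK fY) -EFinM -EFinB; congr (_%:E).
  by apply/eqP; rewrite subr_eq0; apply/eqP; exact: XY.
move=> /eqP; rewrite mulf_eq0 subr_eq0 => /orP[/eqP//|].
by rewrite gt_eqF// (vdensity_gt0 Ac (UC _ Up)).
Qed.

(** For the constant test function 1 the equation reads 0 = -1 + area^-1 area. Since the inverse of
    0 is 0, this fails for area 0. *)
Lemma area_gt0 : 0 < fine (vol [set: borel M]).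
Proof.
have [_ _ EL _ _] := hE.
have S1 : smooth_fun S (fun=> 1 : R) by move=> c Ac k; exact: Ck_cst.
have := EL (fun=> 1) x0 S1; rewrite /Rintegral integral0_eq; last first.
  by move=> p _; rewrite laplacian_cst mulr0.
have -> : (\int[vol]_x (1 : R)%:E = vol [set: borel M])%E.
  by rewrite integral_cst// mul1e.
move=> H; rewrite lt_neqAle fine_ge0 ?measure_ge0// andbT eq_sym.
by apply/eqP => v0; move: H; rewrite v0 mulr0 addr0 /= => /eqP; rewrite eq_sym oppr_eq0 oner_eq0.
Qed.

(** [fine] sends infinity to 0, so [area_gt0] excludes an infinite volume as well. *)
Lemma vol_fin_num : vol [set: borel M] \is a fin_num.
Proof.
have := area_gt0; rewrite fin_numE.
by case: (vol _) => //=; rewrite ltxx.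
Qed.

End green_function.

End weak_to_strong.

(** * Hitting times along a grid *)

Section bounded_integrals.
Context {d : measure_display} {T : measurableType d} {R : realType}.
Variable m : {measure set T -> \bar R}.
Hypothesis fin_m : (m setT < +oo)%E.

Lemma bounded_integrable (A : set T) (f : T -> R) (K : R) : measurable A ->
  measurable_fun A f -> (forall x, A x -> `|f x| <= K) -> m.-integrable A (EFin \o f).
Proof.
move=> mA mf fK; apply: measurable_bounded_integrable => //.
  by apply: le_lt_trans fin_m; apply: le_measure; rewrite ?inE.
exists K; split; first exact: num_real.
by move=> y Ky x Ax; apply: le_trans (fK x Ax) (ltW Ky).
Qed.

Lemma Rintegral_itv (A : set T) (f : T -> R) (K a b : R) : measurable A ->
  measurable_fun A f -> (forall x, A x -> `|f x| <= K) ->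
  (forall x, A x -> a <= f x <= b) ->
  a * fine (m A) <= \int[m]_(x in A) f x <= b * fine (m A).
Proof.
move=> mA mf fK fab; have If := bounded_integrable mA mf fK.
have Ic (c : R) : m.-integrable A (EFin \o (fun=> c)).
  by apply: (@bounded_integrable _ _ `|c|).
rewrite -!(Rintegral_cst m mA).
by apply/andP; split; apply: le_Rintegral => // x Ax; have /andP[] := fab x Ax.
Qed.

End bounded_integrals.

Section hitting.
Context {R : realType} {M : ptopologicalType} {Omega : Type} (X : R -> Omega -> M)
  (G : set M).
Hypothesis X_cont : forall w, {within `[0, +oo[, continuous (fun t => X t w)}.
Hypothesis oG : open G.

Definition never (h : R) (k : nat) : set Omega :=
  [set w | forall j, (j <= k)%N -> ~ G (X (h * j%:R) w)].

(* The first multiple of [h] at which X is in [G], see [grid_time_attained]; as a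
   series, its expectation is a series of probabilities. *)
Definition grid_time (h : R) (w : Omega) : \bar R :=
  (\sum_(0 <= k <oo) (h * \1_(never h k) w)%:E)%E.

Lemma grid_time_cvg h w : 0 <= h ->
  (fun n => (\sum_(0 <= k < n) (h * \1_(never h k) w)%:E)%E) @ \oo --> grid_time h w.
Proof.
by move=> h0; apply: is_cvg_ereal_nneg_natsum => k _; rewrite lee_fin mulr_ge0// indicE.
Qed.

Lemma grid_time_le h w j : 0 <= h -> G (X (h * j%:R) w) -> (grid_time h w <= (h * j%:R)%:E)%E.
Proof.
move=> h0 Gj; apply: lime_le; first by apply/cvg_ex; eexists; exact: grid_time_cvg.
near=> n; have jn : (j <= n)%N by near: n; exact: nbhs_infty_ge.
have tail0 : (\sum_(j <= k < n) (h * \1_(never h k) w)%:E = 0)%E.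
  apply: big1_seq => k; rewrite mem_index_iota => /andP[_ /andP[jk _]].
  by rewrite indicE memNset ?mulr0// => /(_ j jk).
rewrite (big_cat_nat (leq0n j) jn)/= tail0 adde0.
apply: (@le_trans _ _ (\sum_(0 <= k < j) h%:E)%E).
  by apply: lee_sum => k _; rewrite lee_fin ler_piMr// indicE; case: (_ \in _).
by rewrite sumEFin lee_fin big_const_nat iter_addr subn0 addr0 mulr_natr.
Unshelve. all: by end_near. Qed.

Lemma grid_time_ge h w n : 0 <= h -> (forall k, (k < n)%N -> ~ G (X (h * k%:R) w)) ->
  ((h * n%:R)%:E <= grid_time h w)%E.
Proof.
move=> h0 nG; apply: le_trans (nneseries_lim_ge n _); last first.
  by move=> i _ _; rewrite lee_fin mulr_ge0// indicE.
rewrite big_nat_cond (eq_bigr (fun=> h%:E)).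
  by rewrite -big_nat_cond sumEFin lee_fin big_const_nat iter_addr subn0 addr0 mulr_natr.
move=> i /andP[/andP[_ ik] _]; rewrite indicE mem_set ?mulr1// => l li.
by apply: nG; exact: leq_ltn_trans ik.
Qed.

Lemma grid_time_attained h w : 0 < h -> (grid_time h w < +oo)%E ->
  exists j, G (X (h * j%:R) w) /\ grid_time h w = (h * j%:R)%:E.
Proof.
move=> h0; have [[j Gj] _|nG fin] := pselect (exists j, G (X (h * j%:R) w)); last first.
  have H n : ((h * n%:R)%:E <= grid_time h w)%E.
    by apply: grid_time_ge; [exact: ltW|move=> k _ Gk; apply: nG; exists k].
  have := H (Num.truncn (fine (grid_time h w) / h)).+1; have := H 0%N.
  case: (grid_time h w) fin => // t _ _; rewrite lee_fin leNgt => /negP; case.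
  by rewrite mulrC -ltr_pdivrMr// truncnS_gt.
pose P j := `[< G (X (h * j%:R) w) >].
have exP : exists j, P j by exists j; exact/asboolP.
pose k := ex_minn exP.
have [Gk kmin] : G (X (h * k%:R) w) /\ forall i, G (X (h * i%:R) w) -> (k <= i)%N.
  by rewrite /k; case: ex_minnP => i /asboolP Gi imin; split=> // l /asboolP /imin.
exists k; split=> //; apply/le_anti/andP; split.
  by apply: grid_time_le => //; exact: ltW.
apply: grid_time_ge; first exact: ltW.
by move=> l lk /kmin; rewrite leqNgt lk.
Qed.

Lemma hitting_time_le_grid h w : 0 < h -> (hitting_time X G w <= grid_time h w)%E.
Proof.
move=> h0; have [->|] := eqVneq (grid_time h w) +oo%E; first exact: leey.
rewrite -ltey => /(grid_time_attained h0)[j [Gj ->]].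
apply: ereal_inf_lbound; exists (h * j%:R) => //; split=> //.
by rewrite mulr_ge0// ltW.
Qed.

Lemma hitting_time_ge0 w : (0 <= hitting_time X G w)%E.
Proof. by apply: le_ereal_inf_tmp => _ [t [t0 _] <-]; rewrite lee_fin. Qed.

(** Dyadic grids are nested: a visit seen on the coarse grid is seen on the finer one. *)
Lemma grid_time_refine h n m w : 0 < h -> (n <= m)%N ->
  (grid_time (h / 2 ^+ m) w <= grid_time (h / 2 ^+ n) w)%E.
Proof.
move=> h0 nm; have p0 k : 0 < h / 2 ^+ k by rewrite divr_gt0// exprn_gt0.
have [->|] := eqVneq (grid_time (h / 2 ^+ n) w) +oo%E; first exact: leey.
rewrite -ltey => /(grid_time_attained (p0 n))[j [Gj ->]].
have E : h / 2 ^+ n * j%:R = h / 2 ^+ m * (2 ^ (m - n) * j)%:R.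
  have -> : (2 : R) ^+ m = 2 ^+ n * 2 ^+ (m - n) by rewrite -exprD subnKC.
  by rewrite natrM natrX; field; rewrite !expf_neq0.
by rewrite E; apply: grid_time_le; [exact/ltW|rewrite -E].
Qed.

(** A path that is in the open set [G] at a time s < t stays there on some interval after s, and
    every sufficiently fine grid has a point in this interval before t. *)
Lemma grid_time_lt h w (t : R) : 0 < h -> (hitting_time X G w < t%:E)%E ->
  \forall n \near \oo, (grid_time (h / 2 ^+ n) w < t%:E)%E.
Proof.
move=> h0 /ereal_inf_lt[_ [s [s0 Gs] <-]]; rewrite lte_fin => st.
have [r r0 Hr] : exists2 r, 0 < r & forall t', s <= t' -> t' < s + r -> G (X t' w).
  have Is : `[0, +oo[%classic s by rewrite /= in_itv/= s0.
  have /subspace_continuousP/(_ s Is) C := @X_cont w.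
  have /nearN_P[r r0 Hr] := C _ (open_nbhs_nbhs (conj oG Gs)).
  exists r => // t' st' t'r.
  apply: Hr; last by rewrite /= in_itv/= (le_trans s0 st').
  by rewrite ger0_norm ?subr_ge0// ltrBlDl.
near=> n.
have n0 : 0 < h / 2 ^+ n by rewrite divr_gt0// exprn_gt0.
have nr : h / 2 ^+ n < Num.min r (t - s).
  near: n.
  have m0 : 0 < Num.min r (t - s) by rewrite lt_min r0 subr_gt0.
  have half : `|2^-1 : R| < 1 by rewrite ger0_norm ?invr_ge0// invf_lt1// ltr1n.
  have /cvgrPdist_lt/(_ _ m0) := cvg_geometric h half.
  by apply: filterS => n; rewrite /geometric/= sub0r normrN exprVn => /ltr_normlW.
move: nr; rewrite lt_min => /andP[nr nts].
(* The first grid index whose time is strictly after [s]. *)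
pose j := (Num.truncn (s / (h / 2 ^+ n))).+1.
have j1 : s < h / 2 ^+ n * j%:R by rewrite mulrC -ltr_pdivrMr// truncnS_gt.
have j2 : h / 2 ^+ n * j%:R <= s + h / 2 ^+ n.
  rewrite /j -[X in _ * X]natr1 mulrDr mulr1 lerD2r mulrC -ler_pdivlMr//.
  by rewrite truncn_le// divr_ge0// ltW.
apply: (@le_lt_trans _ _ (h / 2 ^+ n * j%:R)%:E).
  by apply: grid_time_le; [exact: ltW|apply: Hr; lra].
by rewrite lte_fin; lra.
Unshelve. all: by end_near. Qed.

Lemma grid_time_cvg_hitting h w : 0 < h ->
  (fun n => grid_time (h / 2 ^+ n) w) @ \oo --> hitting_time X G w.
Proof.
move=> h0; have p0 k : 0 < h / 2 ^+ k by rewrite divr_gt0// exprn_gt0.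
have ge n := hitting_time_le_grid w (p0 n).
have := hitting_time_ge0 w; case E : (hitting_time X G w) => [r| |] // _; last first.
  rewrite (_ : (fun n => _) = cst +oo%E); first exact: cvg_cst.
  by apply/funext => n; have := ge n; rewrite E leye_eq => /eqP.
have lt t : r < t -> \forall n \near \oo, (grid_time (h / 2 ^+ n) w < t%:E)%E.
  by move=> rt; apply: grid_time_lt => //; rewrite E lte_fin.
apply/fine_cvgP; split.
  have r1 : r < r + 1 by rewrite ltrDl.
  apply: filterS (lt _ r1) => n ln; rewrite fin_numE.
  by have := ge n; rewrite E; case: (grid_time _ _) ln.
apply/cvgrPdist_lt => e e0; have re : r < r + e by rewrite ltrDl.
apply: filterS (lt _ re) => n; have := ge n; rewrite E /=.
case: (grid_time _ _) => // t; rewrite lee_fin lte_fin /= => rt te.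
by rewrite distrC ger0_norm ?subr_ge0// ltrBlDl.
Qed.

End hitting.

(** * Dynkin's formula *)

Lemma ge0_integral_mrestr (d : measure_display) (T : measurableType d) (R : realType)
    (m : {measure set T -> \bar R}) (A : set T) (mA : measurable A) (f : T -> \bar R) :
  measurable_fun [set: T] f -> (forall x, (0 <= f x)%E) ->
  (\int[mrestr m mA]_x f x = \int[m]_(x in A) f x)%E.
Proof.
move=> mf f0; rewrite -(setUv A) ge0_integral_setU//; last 3 first.
- exact: measurableC.
- by rewrite setUv.
- by rewrite disj_set2E setICr.
rewrite [X in (_ + X)%E](_ : _ = 0%E).
  rewrite adde0; apply: eq_measure_integral => U mU UA.
  by rewrite /= /mrestr setIidl.
transitivity (\int[mzero]_(x in ~` A) f x)%E; last by rewrite integral_measure_zero.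
apply: eq_measure_integral => U mU UA; rewrite /= /mrestr /mzero.
by rewrite (_ : U `&` A = set0) ?measure0//; apply/disjoints_subset.
Qed.

Section markov.
Context {R : realType} {M : ptopologicalType} (S : riemannian_surface R M)
  {d : measure_display} {Omega : measurableType d} (P : R.-pker (borel M) ~> Omega)
  (X : R -> Omega -> M).
Hypothesis hX : is_brownian S P X.

Lemma measurable_position t : 0 <= t -> measurable_fun [set: Omega] (X t : Omega -> borel M).
Proof. by case: hX => mX _ _ _ _; exact: mX. Qed.

Lemma measurable_preimage t (B : set (borel M)) : 0 <= t -> measurable B ->
  measurable (X t @^-1` B).
Proof.
by move=> t0 mB; rewrite -[X in measurable X]setTI; exact: measurable_position.
Qed.

Lemma history_measurable s A : history X s A -> measurable A.
Proof.
apply: smallest_sub; first exact: sigma_algebra_measurable.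
by move=> _ [r [B [/andP[r0 _] mB ->]]]; exact: measurable_preimage.
Qed.

Lemma total_probability x : P x [set: Omega] = 1%E.
Proof. exact: prob_kernel. Qed.

Lemma prob_lty x : (P x [set: Omega] < +oo)%E.
Proof. by rewrite total_probability ltry. Qed.

(** [is_brownian] states the Markov property for events; disintegration carries it to nonnegative
    functions. *)
Lemma markov_integral x s t A (g : borel M -> \bar R) : 0 <= s -> 0 <= t ->
  history X s A -> measurable_fun [set: borel M] g -> (forall p, (0 <= g p)%E) ->
  (\int[P x]_(w in A) g (X (s + t) w) =
   \int[P x]_(w in A) \int[P (X s w)]_w' g (X t w'))%E.
Proof.
move=> s0 t0 hA mg g0; have mA := history_measurable hA.
have st0 : 0 <= s + t by rewrite addr_ge0.
have mXt := measurable_position t0; have mXst := measurable_position st0.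
(* [m2] will be the law of [X (s + t)] on the event [A], and [k w] the law of [X t] for the process
   restarted at [X s w]. *)
pose m1 : {measure set Omega -> \bar R} := mrestr (P x) mA.
pose push2 : {measure set (borel M) -> \bar R} := pushforward m1 (X (s + t) : Omega -> borel M).
pose m2 := push2 mXst.
pose push w : {measure set (borel M) -> \bar R} :=
  pushforward (P (X s w)) (X t : Omega -> borel M).
pose k w := push mXt w.
have mk (U : set (borel M)) : measurable U -> measurable_fun [set: Omega] (k ^~ U).
  move=> mU; apply: (measurableT_comp (measurable_kernel P _ (measurable_preimage t0 mU))).
  exact: measurable_position.
have kE (U : set (borel M)) : measurable U -> (m2 U = \int[m1]_w k w U)%E.
  move=> mU; rewrite ge0_integral_mrestr//; last exact: mk.
  case: hX => _ _ _ hM _; have := hM x s t A U s0 t0 hA mU.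
  by rewrite setIC.
have pE u (mu : {measure set Omega -> \bar R}) (u0 : 0 <= u) :
    (\int[pushforward mu (X u : Omega -> borel M)]_y g y = \int[mu]_w g (X u w))%E.
  have H := @ge0_integral_pushforward _ _ _ _ R _ (measurable_position u0) mu setT g
    measurableT mg (fun y _ => g0 y).
  by rewrite preimage_setT in H.
have mgX : measurable_fun [set: Omega] (fun w => g (X (s + t) w)).
  exact: measurableT_comp mg mXst.
have mgk : measurable_fun [set: Omega] (fun w => \int[k w]_y g y)%E.
  exact: measurable_fun_integral_kernel mk g g0 mg.
have k0 w : (0 <= \int[k w]_y g y)%E by exact: integral_ge0.
have D := ge0_integral_disintegration mk kE g0 mg.
have L : (\int[m2]_y g y = \int[P x]_(w in A) g (X (s + t) w))%E.
  apply: etrans (pE _ m1 st0) _; exact: ge0_integral_mrestr.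
rewrite -L D ge0_integral_mrestr//; apply: eq_integral => w _; exact: pE.
Qed.

End markov.

(** In the application [a n] is the probability of not having been in the target up to step n. The
    upper bound makes the series converge, hence [a n] tends to 0 and the boundary terms [c1 * a n]
    and [c2 * a n] disappear in the limit. *)
Lemma series_sandwich (R : realType) (a : R^nat) (h k1 k2 c1 c2 A B : R) :
  0 < h -> 0 < k1 -> (forall n, 0 <= a n <= 1) ->
  (forall n, k1 * series (fun k => h * a k) n <= A + c1 * a n) ->
  (forall n, B <= k2 * series (fun k => h * a k) n + c2 * a n) ->
  exists s, [/\ (\sum_(0 <= k <oo) (h * a k)%:E = s%:E)%E, k1 * s <= A & B <= k2 * s].
Proof.
move=> h0 k0 a01 HA HB; pose u := series (fun k => h * a k).
have ha k : 0 <= h * a k by apply: mulr_ge0; [exact: ltW|have /andP[] := a01 k].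
have ub : has_ubound (range u).
  exists ((A + `|c1|) / k1) => _ [n _ <-]; rewrite ler_pdivlMr// mulrC.
  apply: le_trans (HA n) _; rewrite lerD2l; apply: le_trans (ler_norm _) _.
  rewrite normrM; have /andP[a0 a1] := a01 n.
  by rewrite (ger0_norm a0) ler_piMr.
have cu : cvgn u.
  by apply: nondecreasing_is_cvgn => //; apply: nondecreasing_series => k _ _; exact: ha.
have cha := cvg_series_cvg_0 cu.
have ca : a @ \oo --> (0 : R).
  rewrite -(mulr0 h^-1) (_ : a = (fun k => h^-1 * (h * a k))).
    by apply: cvgMl_tmp; exact: cha.
  by apply/funext => k; rewrite mulrA mulVf ?mul1r// gt_eqF.
exists (limn u); split.
- apply/cvg_lim => //; rewrite (_ : (fun n => _) = EFin \o u).
    by apply: cvg_EFin; [exact: nearW|exact: cu].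
  by apply/funext => n; rewrite /u /series /= -sumEFin.
- have C1 : k1 * u n @[n --> \oo] --> k1 * limn u by apply: cvgMl_tmp; exact: cu.
  have C2 : A + c1 * a n @[n --> \oo] --> A + c1 * 0.
    by apply: cvgD; [exact: cvg_cst|exact: cvgMl_tmp].
  rewrite mulr0 addr0 in C2.
  rewrite -(cvg_lim _ C1)// -(cvg_lim _ C2)//.
  by apply: ler_lim; [apply/cvg_ex; eexists; exact: C1|apply/cvg_ex; eexists; exact: C2|exact: nearW].
- have C1 : k2 * u n + c2 * a n @[n --> \oo] --> k2 * limn u + c2 * 0.
    by apply: cvgD; apply: cvgMl_tmp.
  rewrite mulr0 addr0 in C1; rewrite -(cvg_lim _ C1)//.
  apply: limr_ge; first by apply/cvg_ex; eexists; exact: C1.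
  exact: nearW.
Qed.

Section dynkin.
Context {R : realType} {M : ptopologicalType} (S : riemannian_surface R M)
  {d : measure_display} {Omega : measurableType d} (P : R.-pker (borel M) ~> Omega)
  (X : R -> Omega -> M).
Hypothesis hX : is_brownian S P X.
Variables (f : M -> R) (K : R).
Hypotheses (Sf : smooth_fun S f) (fK : forall p, `|f p| <= K).

Lemma smooth_continuous p : {for p, continuous f}.
Proof.
have [Ac cp] := chart_atP S p; set c := chart_at S p in Ac cp.
apply: (@near_eq_continuous_at _ _ ((f \o cinv c) \o cmap c)).
  have [oc _ _ _ _] := atlas_chart Ac.
  by apply: filterS (open_nbhs_nbhs (conj oc cp)) => q cq; rewrite /= (cmapK Ac cq).
apply: continuous_comp; first exact: cmap_continuous Ac _ cp.
exact: (Ck_continuous (Sf Ac 0%N) (cimg_cmap cp)).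
Qed.

Lemma smooth_measurable : measurable_fun [set: borel M] (f : borel M -> R).
Proof. by apply: borel_measurable_fun openT _ => p _; exact: smooth_continuous. Qed.

Let mfX t : 0 <= t -> measurable_fun [set: Omega] (fun w => f (X t w)).
Proof. by move=> t0; exact: measurableT_comp smooth_measurable (measurable_position hX t0). Qed.

Definition semigroup (t : R) (y : M) : R := \int[P y]_w f (X t w).

(** Adding [K] makes the integrand nonnegative, as the lemmas on kernels and disintegration
    require. *)
Let semigroupK t y : 0 <= t ->
  (\int[P y]_w (f (X t w) + K)%:E = (semigroup t y + K)%:E)%E.
Proof.
move=> t0; have If := bounded_integrable (prob_lty P y) measurableT (mfX t0) (fun w _ => fK _).
have Ic : (P y).-integrable [set: Omega] (EFin \o (fun=> K)).
  by apply: (@bounded_integrable _ _ _ _ (prob_lty P y) _ _ `|K|).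
have := integralD measurableT If Ic; rewrite /= => ->.
rewrite integral_cst// total_probability mule1 EFinD; congr (_ + _)%E.
by rewrite /semigroup fineK//; exact: integrable_fin_num If.
Qed.

Lemma semigroup_bound t y : 0 <= t -> `|semigroup t y| <= K.
Proof.
move=> t0.
have := @Rintegral_itv _ _ _ (P y) (prob_lty P y) setT (fun w => f (X t w)) K (- K) K
  measurableT (mfX t0) (fun w _ => fK _).
rewrite total_probability /= !mulr1 -/(semigroup t y) => H.
by rewrite ler_norml; apply: H => w _; rewrite -ler_norml.
Qed.

Lemma measurable_semigroup t : 0 <= t ->
  measurable_fun [set: borel M] (semigroup t : borel M -> R).
Proof.
move=> t0; have -> : semigroup t = (fun y => fine (\int[P y]_w (f (X t w) + K)%:E) - K).
  by apply/funext => y; rewrite semigroupK//= addrK.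
apply: measurable_funB => //; apply: (measurableT_comp (fine_measurable measurableT)).
apply: measurable_fun_integral_kernel.
- exact: measurable_kernel.
- by move=> w; rewrite lee_fin -lerBlDr sub0r; have := fK (X t w); rewrite ler_norml => /andP[].
- by apply/measurable_EFinP; apply: measurable_funD => //; exact: mfX.
Qed.

Lemma markov_semigroup x s t A : 0 <= s -> 0 <= t -> history X s A ->
  \int[P x]_(w in A) f (X (s + t) w) = \int[P x]_(w in A) semigroup t (X s w).
Proof.
move=> s0 t0 hA; have mA := history_measurable hX hA.
have fK0 p : 0 <= f p + K.
  by rewrite -lerBlDr sub0r; have := fK p; rewrite ler_norml => /andP[].
have mg : measurable_fun [set: borel M] (fun p : borel M => (f p + K)%:E).
  by apply/measurable_EFinP; apply: measurable_funD => //; exact: smooth_measurable.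
have H := markov_integral hX x s0 t0 hA mg (fun p => fK0 p).
have mS : measurable_fun [set: Omega] (fun w => semigroup t (X s w)).
  exact: measurableT_comp (measurable_semigroup t0) (measurable_position hX s0).
have I1 : (P x).-integrable A (EFin \o (fun w => f (X (s + t) w))).
  apply: (bounded_integrable (prob_lty P x) mA _ (fun w _ => fK _)).
  by apply: measurable_funTS; apply: mfX; exact: addr_ge0.
have I2 : (P x).-integrable A (EFin \o (fun w => semigroup t (X s w))).
  apply: (bounded_integrable (prob_lty P x) mA _ (fun w _ => semigroup_bound _ t0)).
  exact: measurable_funTS.
have Ic : (P x).-integrable A (EFin \o (fun=> K)).
  by apply: (@bounded_integrable _ _ _ _ (prob_lty P x) _ _ `|K|).
(* The constant [K] is added on both sides to reach the nonnegative Markov identity [H]. *)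
apply: (@addIr _ (\int[P x]_(w in A) K)).
rewrite -!RintegralD//; apply: (congr1 fine); apply: etrans H _.
by apply: eq_integral => w _; rewrite semigroupK.
Qed.

End dynkin.

Lemma add1e_eq1 (R : realDomainType) (a b : \bar R) :
  a = 1%E -> (0 <= b)%E -> (a + b = 1)%E -> b = 0%E.
Proof.
move=> ->; case: b => // b _; rewrite -EFinD => -[] /eqP.
by rewrite -subr_eq0 addrC addKr => /eqP ->.
Qed.

Section dynkin_bounds.
Context {R : realType} {M : ptopologicalType} (S : riemannian_surface R M)
  {d : measure_display} {Omega : measurableType d} (P : R.-pker (borel M) ~> Omega)
  (X : R -> Omega -> M).
Hypothesis hX : is_brownian S P X.
Variables (G : set M) (x : M).
Hypotheses (oG : open G) (xG : ~ G x).

Lemma never_history h k : 0 <= h -> history X (h * k%:R) (never X G h k).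
Proof.
move=> h0; pose gen := [set A | exists r (B : set (borel M)),
  [/\ 0 <= r <= h * k%:R, measurable B & A = X r @^-1` B]].
have -> : never X G h k = \bigcap_(j in `I_k.+1) (~` (X (h * j%:R) @^-1` G)).
  by apply/seteqP; split=> w H j; exact: H.
change (measurable (\bigcap_(j in `I_k.+1) (~` (X (h * j%:R) @^-1` G)) :
  set (g_sigma_algebraType gen))).
apply: bigcap_measurable; first by exists 0%N.
move=> j jk; apply: measurableC; apply: sub_sigma_algebra.
exists (h * j%:R), G; split=> //; last exact: borel_open oG.
by rewrite mulr_ge0// ler_wpM2l// ler_nat.
Qed.

Lemma measurable_never h k : 0 <= h -> measurable (never X G h k).
Proof.
move=> h0; apply: (history_measurable hX); last exact: never_history h0.
Qed.

Let start : P x (X 0 @^-1` [set x]) = 1%E.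
Proof. by case: hX => _ _ H _ _; exact: H. Qed.

Let measurable_start : measurable (X 0 @^-1` [set x]).
Proof.
apply: (measurable_preimage hX (lexx 0)); apply: borel_closed.
exact: accessible_closed_set1 (hausdorff_accessible (surface_hausdorff S)) x.
Qed.

Let start_never h : X 0 @^-1` [set x] `<=` never X G h 0.
Proof. by move=> w /= Xw j; rewrite leqn0 => /eqP ->; rewrite mulr0 Xw. Qed.

(** Almost surely the path starts at [x], which is not in [G]. *)
Lemma never0 h : 0 <= h -> P x (never X G h 0) = 1%E.
Proof.
move=> h0; apply/le_anti/andP; split.
  by rewrite -(total_probability P x); apply: le_measure; rewrite ?inE//; exact: measurable_never.
rewrite -start; apply: le_measure (@start_never h); rewrite ?inE//.
exact: measurable_never.
Qed.

Lemma expectation_grid_time h : 0 <= h ->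
  (\int[P x]_w grid_time X G h w = \sum_(0 <= k <oo) (h * fine (P x (never X G h k)))%:E)%E.
Proof.
move=> h0; rewrite /grid_time integral_nneseries//; last 2 first.
- move=> k; apply/measurable_EFinP; apply: measurable_funM => //.
  exact/measurable_indicP/measurable_never.
- by move=> k w _; rewrite lee_fin mulr_ge0// indicE.
apply: eq_eseriesr => k _.
have mN := measurable_never k h0.
under eq_integral do rewrite EFinM.
rewrite ge0_integralZl//; last by apply/measurable_EFinP; exact/measurable_indicP.
rewrite integral_indic// setIT EFinM fineK// ge0_fin_numE ?measure_ge0//.
by apply: le_lt_trans (prob_lty P x); apply: le_measure; rewrite ?inE.
Qed.

Lemma measurable_grid_time h : 0 <= h -> measurable_fun [set: Omega] (grid_time X G h).
Proof.
move=> h0; apply: ge0_emeasurable_sum.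
  by move=> k w _ _; rewrite lee_fin mulr_ge0// indicE.
move=> k _; apply/measurable_EFinP; apply: measurable_funM => //.
exact/measurable_indicP/measurable_never.
Qed.

Variables (f : M -> R) (K m1 m2 : R).
Hypotheses (Sf : smooth_fun S f) (fK : forall p, `|f p| <= K)
  (lap_f : forall p, ~ G p -> laplacian S f p = -1)
  (fG : forall p, G p -> m1 <= f p <= m2).

Section grid.
Variables (h eta : R).
Hypotheses (h0 : 0 < h)
  (gen : forall y, `|(semigroup P X f h y - f y) / h - laplacian S f y| <= eta).

Let a k := fine (P x (never X G h k)).
Let I k := \int[P x]_(w in never X G h k) f (X (h * k%:R) w).
Let J k := \int[P x]_(w in never X G h k) f (X (h * k.+1%:R) w).
Let hge0 : 0 <= h := ltW h0.
Let mN k : measurable (never X G h k) := measurable_never k hge0.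
Let hk0 k : 0 <= h * k%:R.
Proof. by rewrite mulr_ge0. Qed.
Let mfX k : measurable_fun [set: Omega] (fun w => f (X (h * k%:R) w)).
Proof.
exact: measurableT_comp (smooth_measurable Sf) (measurable_position hX (hk0 k)).
Qed.
Let Pfin A : measurable A -> P x A \is a fin_num.
Proof.
move=> mA; rewrite ge0_fin_numE ?measure_ge0//.
by apply: le_lt_trans (prob_lty P x); apply: le_measure; rewrite ?inE.
Qed.
Let neverS k : never X G h k.+1 `<=` never X G h k.
Proof. by move=> w H j jk; apply: H; exact: leqW. Qed.

Let a01 k : 0 <= a k <= 1.
Proof.
rewrite fine_ge0 ?measure_ge0//= -[X in _ <= X]/(fine 1%E) fine_le// ?Pfin//.
by rewrite -(total_probability P x); apply: le_measure; rewrite ?inE.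
Qed.

(** Outside [G] the Laplacian is -1, so one time step lowers the expectation of [f] by h, up to the
    error h eta. *)
Let generator_step y : ~ G y ->
  f y - h * (1 + eta) <= semigroup P X f h y <= f y - h * (1 - eta).
Proof.
move=> nG; have := gen y; rewrite (lap_f nG) opprK ler_norml => /andP[g1 g2].
have E : semigroup P X f h y - f y = h * ((semigroup P X f h y - f y) / h).
  by rewrite mulrC divfK// gt_eqF.
move: E g1 g2; set z := _ / h => E g1 g2.
have {}E : semigroup P X f h y = f y + h * z by rewrite -E addrC subrK.
have := ler_wpM2l hge0 g1; have := ler_wpM2l hge0 g2; rewrite E mulrDr mulr1 mulrN => h1 h2.
by apply/andP; split; rewrite ?mulrDr ?mulrBr ?mulr1; lra.
Qed.

(** A path that has avoided [G] up to step k but not up to step k + 1 is in [G] at step k + 1, where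
    [f] lies between [m1] and [m2]. *)
Let exit_step k : m1 * (a k - a k.+1) <= J k - I k.+1 <= m2 * (a k - a k.+1).
Proof.
pose D := never X G h k `\` never X G h k.+1.
have mD : measurable D by exact: measurableD.
have IJ A : measurable A -> (P x).-integrable A (EFin \o (fun w => f (X (h * k.+1%:R) w))).
  move=> mA; apply: (bounded_integrable (prob_lty P x) mA _ (fun w _ => fK _)).
  exact: measurable_funTS.
have UE : never X G h k = never X G h k.+1 `|` D by rewrite setDUK.
have JE : J k = I k.+1 + \int[P x]_(w in D) f (X (h * k.+1%:R) w).
  rewrite /J {1}UE Rintegral_setU//; first by rewrite -UE; exact: IJ.
  by rewrite disj_set2E setDIK.
have aE : a k - a k.+1 = fine (P x D).
  rewrite /a {1}UE measureU//; last by rewrite setDIK.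
  by rewrite fineD ?Pfin// addrC addKr.
rewrite JE [_ - I k.+1]addrC addKr aE.
apply: (@Rintegral_itv _ _ _ (P x) (prob_lty P x) D _ K) => //.
  exact: measurable_funTS.
move=> w [Nk nN]; apply: fG; apply: contrapT => nG; apply: nN => j.
by rewrite leq_eqVlt => /predU1P[->//|]; exact: Nk.
Qed.

(** The Markov property at time h k, applied on the event of no visit so far, integrates
    [generator_step]. *)
Let step k : I k - h * (1 + eta) * a k <= J k <= I k - h * (1 - eta) * a k.
Proof.
have JE : J k = \int[P x]_(w in never X G h k) semigroup P X f h (X (h * k%:R) w).
  rewrite -(markov_semigroup hX Sf fK x (hk0 k) hge0 (never_history hge0)) /J.
  by rewrite -natr1 mulrDr mulr1.
have If : (P x).-integrable (never X G h k) (EFin \o (fun w => f (X (h * k%:R) w))).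
  apply: (bounded_integrable (prob_lty P x) (mN k) _ (fun w _ => fK _)).
  exact: measurable_funTS.
have Is : (P x).-integrable (never X G h k)
    (EFin \o (fun w => semigroup P X f h (X (h * k%:R) w))).
  apply: (bounded_integrable (prob_lty P x) (mN k) _
    (fun w _ => semigroup_bound hX Sf fK _ hge0)).
  apply: measurable_funTS.
  exact: measurableT_comp (measurable_semigroup hX Sf fK hge0) (measurable_position hX (hk0 k)).
have Ic (c : R) : (P x).-integrable (never X G h k) (EFin \o (fun=> c)).
  by apply: (@bounded_integrable _ _ _ _ (prob_lty P x) _ _ `|c|).
have Ifc (c : R) : (P x).-integrable (never X G h k)
    (EFin \o (fun w => f (X (h * k%:R) w) - c)).
  by have := integrableB (mN k) If (Ic c); apply: eq_integrable.
have E (c : R) : I k - c * a k = \int[P x]_(w in never X G h k) (f (X (h * k%:R) w) - c).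
  by rewrite (RintegralB (mN k) If (Ic c)) (Rintegral_cst (P x) (mN k)).
rewrite !E JE; apply/andP; split; apply: le_Rintegral => // w Nw;
  by have /andP[] := generator_step (Nw k (leqnn k)).
Qed.

(** The start at [x] is only almost sure, so the remaining null event is split off. *)
Let I0 : I 0 = f x.
Proof.
pose D : set Omega := X 0 @^-1` [set x]; have N0 := never0 hge0.
have mD : measurable D by exact: measurable_start.
have DN : D `<=` never X G h 0 by exact: start_never.
have mD' : measurable (never X G h 0 `\` D) by exact: measurableD.
have IA A : measurable A -> (P x).-integrable A (EFin \o (fun w => f (X (h * 0%:R) w))).
  move=> mA; apply: (bounded_integrable (prob_lty P x) mA _ (fun w _ => fK _)).
  exact: measurable_funTS.
have UE : never X G h 0 = D `|` (never X G h 0 `\` D) by rewrite setDUK.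
have D0 : P x (never X G h 0 `\` D) = 0%E.
  have U1 : (P x D + P x (never X G h 0 `\` D) = 1)%E.
    by rewrite -measureU ?setDIK// -UE.
  exact: add1e_eq1 start (measure_ge0 _ _) U1.
have startD : fine (P x D) = 1 by apply: etrans (congr1 fine start) _.
have E1 : \int[P x]_(w in D) f (X (h * 0%:R) w) = f x.
  have := @Rintegral_itv _ _ _ (P x) (prob_lty P x) D (fun w => f (X (h * 0%:R) w)) K
    (f x) (f x) mD (measurable_funTS (mfX 0)) (fun w _ => fK _).
  rewrite startD !mulr1 => H; apply/esym/le_anti; apply: H => w.
  by rewrite /D /= mulr0 => ->; rewrite lexx.
have E2 : \int[P x]_(w in never X G h 0 `\` D) f (X (h * 0%:R) w) = 0.
  have := @Rintegral_itv _ _ _ (P x) (prob_lty P x) (never X G h 0 `\` D)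
    (fun w => f (X (h * 0%:R) w)) K (- K) K mD' (measurable_funTS (mfX 0)) (fun w _ => fK _).
  rewrite D0 /= !mulr0 => H; apply/esym/le_anti; apply: H => w _.
  by rewrite -ler_norml.
rewrite /I {1}UE Rintegral_setU//; first by rewrite E1 E2 addr0.
  by rewrite -UE; exact: IA.
by rewrite disj_set2E setDIK.
Qed.

(* Dynkin's formula for the chain [X (h * k)] stopped on entering [G], up to the
   error [eta] of the generator. *)
Let sum_bounds n : f x - (1 + eta) * series (fun k => h * a k) n - m2 * (1 - a n) <= I n
  <= f x - (1 - eta) * series (fun k => h * a k) n - m1 * (1 - a n).
Proof.
elim: n => [|n /andP[IH1 IH2]].
  by rewrite I0 /series /= big_geq// /a never0//= subrr !mulr0 !subr0 lexx.
have sE : series (fun k => h * a k) n.+1 = series (fun k => h * a k) n + h * a n.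
  by rewrite /series /= big_nat_recr.
have := step n; have := exit_step n => /andP[e1 e2] /andP[s1 s2].
move: e1 e2 s1 s2 IH1 IH2; rewrite sE; move: (series _ _) => s e1 e2 s1 s2 IH1 IH2.
by apply/andP; split; lra.
Qed.

Lemma grid_time_bounds : eta < 1 -> exists s,
  [/\ (\int[P x]_w grid_time X G h w = s%:E)%E, (1 - eta) * s <= f x - m1 &
      f x - m2 <= (1 + eta) * s].
Proof.
move=> eta1; have Ia n : `|I n| <= K * a n.
  have := @Rintegral_itv _ _ _ (P x) (prob_lty P x) (never X G h n)
    (fun w => f (X (h * n%:R) w)) K (- K) K (mN n) (measurable_funTS (mfX n)) (fun w _ => fK _).
  by rewrite -/(I n) -/(a n) mulNr -ler_norml; apply => w _; rewrite -ler_norml.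
rewrite expectation_grid_time//.
(* The last two constants come from inserting |I n| <= K a n into [sum_bounds] and collecting the
   terms in [a n]. *)
apply: (@series_sandwich _ a h (1 - eta) (1 + eta) (K + m1) (K - m2)) => //.
- by rewrite subr_gt0.
- move=> n; have := sum_bounds n; have := Ia n; rewrite ler_norml => /andP[i1 i2] /andP[b1 b2].
  lra.
- move=> n; have := sum_bounds n; have := Ia n; rewrite ler_norml => /andP[i1 i2] /andP[b1 b2].
  lra.
Qed.

End grid.
Let generator_small eta : 0 < eta -> \forall n \near \oo, forall y,
  `|(semigroup P X f (1 / 2 ^+ n) y - f y) / (1 / 2 ^+ n) - laplacian S f y| <= eta.
Proof.
move=> eta0; case: hX => _ _ _ _ /(_ f Sf eta eta0)/nearN_P[r r0 Hr].
have half : `|2^-1 : R| < 1 by rewrite ger0_norm ?invr_ge0// invf_lt1// ltr1n.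
have /cvgrPdist_lt/(_ _ r0) := cvg_geometric 1 half.
apply: filterS => n; rewrite /geometric/= sub0r normrN exprVn => hr y.
by apply: Hr; rewrite ?subr0 ?divr_gt0 ?exprn_gt0.
Qed.

Let hn0 n : 0 < 1 / 2 ^+ n :> R. Proof. by rewrite divr_gt0// exprn_gt0. Qed.

Let X_cont : forall w, {within `[0, +oo[, continuous (fun t => X t w)}.
Proof. by case: hX. Qed.

Lemma measurable_hitting_time : measurable_fun [set: Omega] (hitting_time X G).
Proof.
apply: (emeasurable_fun_cvg (fun n => grid_time X G (1 / 2 ^+ n))).
  by move=> n; apply: measurable_grid_time; exact: ltW.
by move=> w _; exact: grid_time_cvg_hitting.
Qed.

(** [grid_time_bounds] passes to the limit along the dyadic grids by dominated convergence;
    afterwards [eta] is sent to 0. *)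
Lemma mfpt_bounds : ((f x - m2)%:E <= mfpt P X G x <= (f x - m1)%:E)%E.
Proof.
have B eta : 0 < eta -> eta < 1 -> \forall n \near \oo, exists s,
    [/\ (\int[P x]_w grid_time X G (1 / 2 ^+ n) w = s%:E)%E, (1 - eta) * s <= f x - m1 &
      f x - m2 <= (1 + eta) * s].
  move=> e0 e1; apply: filterS (generator_small e0) => n gen.
  exact: grid_time_bounds gen e1.
have mg n : measurable_fun [set: Omega] (grid_time X G (1 / 2 ^+ n)).
  by apply: measurable_grid_time; exact: ltW.
have g0 n w : (0 <= grid_time X G (1 / 2 ^+ n) w)%E.
  by apply: le_trans (hitting_time_le_grid X G w (hn0 n)); exact: hitting_time_ge0.
have mt := measurable_hitting_time.
have le n : (mfpt P X G x <= \int[P x]_w grid_time X G (1 / 2 ^+ n) w)%E.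
  apply: ge0_le_integral => // w _; first exact: hitting_time_ge0.
  exact: hitting_time_le_grid.
(* The choice eta = 1/2 serves to find one grid whose time has finite expectation; it dominates the
   times of all finer grids. *)
have [n0 _ Hn0] := B 2^-1 (ltac:(lra)) (ltac:(lra)).
have [s0 [Es0 _ _]] := Hn0 n0 (leqnn n0).
have ig : (P x).-integrable [set: Omega] (grid_time X G (1 / 2 ^+ n0)).
  apply/integrableP; split=> //; under eq_integral do rewrite gee0_abs//.
  by rewrite Es0 ltry.
have cv : (\int[P x]_w grid_time X G (1 / 2 ^+ (n + n0)) w)%E @[n --> \oo] --> mfpt P X G x.
  have lim_g w : grid_time X G (1 / 2 ^+ (n + n0)) w @[n --> \oo] --> hitting_time X G w.
    have := grid_time_cvg_hitting X_cont oG (w := w) (ltr01 : 0 < 1 :> R).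
    by rewrite -(cvg_shiftn n0).
  have dom_g w n : (`|grid_time X G (1 / 2 ^+ (n + n0)) w| <= grid_time X G (1 / 2 ^+ n0) w)%E.
    by rewrite gee0_abs//; apply: grid_time_refine => //; exact: leq_addl.
  have [_ _] := @dominated_convergence _ _ _ (P x) setT measurableT
    (fun n w => grid_time X G (1 / 2 ^+ (n + n0)) w) (hitting_time X G)
    (grid_time X G (1 / 2 ^+ n0)) (fun n => mg _) mt (aeW _ (fun w _ => lim_g w)) ig
    (aeW _ (fun w n _ => dom_g w n)).
  exact.
have mufin : mfpt P X G x \is a fin_num.
  rewrite ge0_fin_numE; last by apply: integral_ge0 => w _; exact: hitting_time_ge0.
  by apply: le_lt_trans (le n0) _; rewrite Es0 ltry.
have bnd eta : 0 < eta -> eta < 1 -> (1 - eta) * fine (mfpt P X G x) <= f x - m1 /\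
    f x - m2 <= (1 + eta) * fine (mfpt P X G x).
  move=> e0 e1; have Be := B eta e0 e1; split.
    have [n1 _ /(_ n1 (leqnn n1))[s [Es s1 _]]] := Be.
    apply: le_trans s1; rewrite ler_pM2l ?subr_gt0//.
    by rewrite -lee_fin fineK// -Es.
  rewrite mulrC -ler_pdivrMr ?addr_gt0// -lee_fin fineK//.
  rewrite -(cvg_lim _ cv)//; apply: lime_ge; first by apply/cvg_ex; eexists; exact: cv.
  have [n1 _ Hn1] := Be; exists n1 => // n n1n.
  have [s [-> _ s2]] := Hn1 (n + n0)%N (leq_trans n1n (leq_addr _ _)).
  by rewrite lee_fin ler_pdivrMr ?addr_gt0// mulrC.
rewrite -(fineK mufin) !lee_fin; set mu := fine _ in bnd *.
have mu0 : 0 <= mu.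
  by rewrite fine_ge0// integral_ge0// => w _; exact: hitting_time_ge0.
(* The error eta times the expectation can be made smaller than any e because the expectation is
   finite. *)
have small e : 0 < e -> exists eta, [/\ 0 < eta, eta < 1 & eta * mu <= e].
  move=> e0; exists (Num.min 2^-1 (e / (mu + 1))); split.
  - by rewrite lt_min invr_gt0 ltr0n/= divr_gt0// ltr_wpDl.
  - by rewrite gt_min invf_lt1// ltr1n.
  - apply: (@le_trans _ _ (e / (mu + 1) * mu)).
      by rewrite ler_wpM2r// ge_min lexx orbT.
    rewrite mulrAC ler_pdivrMr ?ltr_wpDl//.
    by apply: ler_wpM2l; [exact: ltW|rewrite lerDl].
apply/andP; split; apply/ler_addgt0Pr => e /small[eta [/bnd b /b[b1 b2] b3]]; lra.
Qed.

End dynkin_bounds.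

(** * Comparison with the Green function *)

Section laplacian_scale.
Context {R : realType} {M : ptopologicalType} (S : riemannian_surface R M).
#[local] Opaque derive.
Notation e1 := (Defs.basis R 0).
Notation e2 := (Defs.basis R 1).

Lemma chart_laplacian_scale c (U : set (R * R)) (g : M -> R) (k : R) u : atlas S c ->
  open U -> U `<=` cimg c -> Ck 2 U (g \o cinv c) -> U u ->
  chart_laplacian S c (fun q => k * g q) u = k * chart_laplacian S c g u.
Proof.
move=> Ac oU UC Cg Uu.
have F i : {near u, flux S c (fun q => k * g q) i =1 (fun v => k * flux S c g i v)}.
  apply: filterS (open_nbhs_nbhs (conj oU Uu)) => v Uv.
  have D w : 'D_w ((fun q => k * g q) \o cinv c) v = k * 'D_w (g \o cinv c) v.
    apply: derive_val; apply: is_derive_cmul; apply: derivableP.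
    by have [_ /(_ w)[dg _]] := Cg; exact: dg.
  rewrite (fluxE _ _ Ac (UC _ Uv)) (fluxE g i Ac (UC _ Uv)) !D.
  set n := _^-1; set d1 := 'D_e1 _ _; set d2 := 'D_e2 _ _.
  by case: (i == 0); rewrite !(mulrCA _ k) -mulrBr mulrCA.
have D i w : 'D_w (fun v => k * flux S c g i v) u = k * 'D_w (flux S c g i) u.
  apply: derive_val; apply: is_derive_cmul; apply: derivableP.
  by have [_ /(_ w)[dg _]] := Ck_flux i Ac oU UC Cg; exact: dg.
rewrite /chart_laplacian !divergence_flux (near_eq_derive e1 (F 0)) (near_eq_derive e2 (F 1)).
by rewrite !D -mulrDr mulrCA.
Qed.

End laplacian_scale.

Lemma ln_ge_1sub (R : realType) (x : R) : 0 < x -> 1 - x^-1 <= ln x.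
Proof.
move=> x0; have xV : -1 < x^-1 - 1 by rewrite ltrBrDr addNr invr_gt0.
by have := le_ln1Dx xV; rewrite addrC subrK lnV ?posrE// lerNl opprB.
Qed.

Lemma shift_le (R : realFieldType) (x y e : R) : 0 <= x -> 0 < e -> y - x - e <= y + x.
Proof. by move=> x0 e0; lra. Qed.

Lemma profile_arith (R : realFieldType) (t y z C e : R) : 0 < e ->
  y - (z + C * e) <= t -> t <= y - (z - C * e - e - e) -> `|t - (y - z)| <= (C + 2) * e.
Proof. by move=> e0 t1 t2; rewrite ler_norml; apply/andP; split; lra. Qed.

Section comparison.
Context {R : realType} {M : ptopologicalType} (S : riemannian_surface R M).
Hypotheses (Mcompact : compact [set: M]) (Mconnected : connected [set: M]).
Variables (vol : {measure set (borel M) -> \bar R}).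
Hypothesis hvol : is_volume S vol.
Variables (E Pm4 : M -> M -> R).
Hypotheses (hE : is_green S vol E) (hP : is_regular_part S E Pm4).
Variables (x0 : M).
Notation dist := (geodesic_dist S).
Notation Gam := (geodesic_ball S x0).
Let area := fine (vol [set: borel M]).
Let a := area / (2 * pi).
Let v q := - area * E x0 q.
Let w eps := a * ln eps - area * Pm4 x0 x0.

Let area0 : 0 < area := area_gt0 hE x0.
Let a0 : 0 < a. Proof. by rewrite divr_gt0// mulr_gt0// pi_gt0. Qed.

Let expansion : exists k C : R, [/\ 0 < k, 0 <= C & forall q, x0 <> q -> dist x0 q < k ->
  `|v q - w (dist x0 q)| <= C * dist x0 q].
Proof.
have [k [C [k0 C0 H]]] := @green_expansion _ _ _ Mconnected _ _ x0 hP.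
exists k, (area * C); split=> //; first by rewrite mulr_ge0// ltW.
move=> q xq /(H _ xq) Hq.
have -> : v q - w (dist x0 q) =
    - area * (E x0 q - (- (2 * pi)^-1 * ln (dist x0 q) + Pm4 x0 x0)).
  by rewrite /v /w /a; ring.
by rewrite normrM normrN (gtr0_norm area0) -mulrA ler_wpM2l// ltW.
Qed.

Let open_ball e : open (Gam e) .
Proof. exact: open_geodesic_ball. Qed.

Let v_continuous q : x0 <> q -> {for q, continuous v}.
Proof.
move=> xq; have [Ac cq] := chart_atP S q; set c := chart_at S q in Ac cq.
pose g (u : R * R) := - area * E x0 (cinv c u).
apply: (@near_eq_continuous_at _ _ (g \o cmap c)).
  have [oc _ _ _ _] := atlas_chart Ac.
  by apply: filterS (open_nbhs_nbhs (conj oc cq)) => y cy; rewrite /= /g (cmapK Ac cy).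
have pq : punctured x0 c (cmap c q) by split; [exact: cimg_cmap|rewrite (cmapK Ac cq)].
apply: continuous_comp; first exact: cmap_continuous Ac _ cq.
have Cg : Ck 0 (punctured x0 c) g.
  exact: (CkM (@open_punctured _ _ _ x0 _ Ac) (Ck_cst _ _ _) (Ck_green hE x0 0 Ac)).
exact: (Ck_continuous Cg pq).
Qed.

Let bounded_below k : 0 < k -> exists B, forall q, k <= dist x0 q -> - B <= v q.
Proof.
move=> k0; have cK : compact (~` Gam k).
  apply: (subclosed_compact _ Mcompact) => //; exact: open_closedC.
have [|B B0 HB] := compact_bound (f := v) cK.
  move=> q nq; apply: v_continuous => xq; apply: nq; rewrite /geodesic_ball /= -xq.
  by rewrite geodesic_dist_refl.
exists B => q kq; have := HB q; rewrite ler_norml => /(_ _)/andP[]//.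
by rewrite /geodesic_ball /= => /lt_geF; rewrite kq.
Qed.

(** Close to [x0] the expansion gives v >= w(t) - C t at distance t, and a ln t - C t is increasing
    as long as C t <= a. Farther away v is bounded below by compactness, while w(e) tends to minus
    infinity. *)
Let outside_bound : exists e0 C : R, [/\ 0 < e0, 0 <= C,
  (forall q, x0 <> q -> dist x0 q < e0 -> `|v q - w (dist x0 q)| <= C * dist x0 q) &
  forall e q, 0 < e -> e < e0 -> e <= dist x0 q -> w e - C * e <= v q].
Proof.
have [k [C [k0 C0 HC]]] := expansion.
(* Small enough for the expansion to hold and for C k1 <= a. *)
pose k1 := Num.min k (a / (C + 1)) / 2.
have k10 : 0 < k1 by rewrite divr_gt0// lt_min k0 divr_gt0// ltr_wpDl.
have k1k : k1 < k.
  rewrite /k1 ltr_pdivrMr//; apply: (@le_lt_trans _ _ k); first by rewrite ge_min lexx.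
  by rewrite ltr_pMr// ltr1n.
have k1C : C * k1 <= a.
  have C1 : 0 < C + 1 by rewrite ltr_wpDl.
  have : k1 <= a / (C + 1).
    rewrite /k1 ler_pdivrMr//; apply: (@le_trans _ _ (a / (C + 1))); first by rewrite ge_min lexx orbT.
    by have := divr_gt0 a0 C1; lra.
  rewrite ler_pdivlMr// mulrDr mulr1 mulrC => H; apply: le_trans H.
  by rewrite lerDl ltW.
have [B HB] := bounded_below k10.
(* The exponential is the radius at which [w] equals -B. *)
pose e0 := Num.min k1 (expR ((- B + area * Pm4 x0 x0) / a)).
exists e0, C; split=> //.
- by rewrite lt_min k10 expR_gt0.
- by move=> q xq; rewrite lt_min => /andP[qk _]; apply: HC => //; exact: lt_trans k1k.
move=> e q epos; rewrite lt_min => /andP[ek1 eB] eq.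
have lnB : a * ln e <= - B + area * Pm4 x0 x0.
  rewrite -ler_pdivlMl// mulrC -ler_expR lnK ?posrE//; exact: ltW.
have [qk|qk] := ltP (dist x0 q) k1; last first.
  apply: le_trans (HB q qk); have : 0 <= C * e by rewrite mulr_ge0// ltW.
  by rewrite /w; lra.
have d0 : 0 < dist x0 q := lt_le_trans epos eq.
have xq : x0 <> q by move=> xq; move: d0; rewrite -xq geodesic_dist_refl// ltxx.
have := HC q xq (lt_trans qk k1k); rewrite ler_norml => /andP[H1 _].
set t := dist x0 q in qk d0 H1 eq *.
have H2 : a * (1 - (t / e)^-1) <= a * ln (t / e).
  by apply: ler_wpM2l; [exact: ltW|apply: ln_ge_1sub; rewrite divr_gt0].
(* The right-hand side equals (a / t)(t - e), and a / t >= C because t < k1. *)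
have H3 : C * (t - e) <= a * (1 - (t / e)^-1).
  have -> : a * (1 - (t / e)^-1) = a / t * (t - e) by field; rewrite !gt_eqF.
  apply: ler_wpM2r; first by rewrite subr_ge0.
  rewrite ler_pdivlMr//; apply: le_trans k1C; apply: ler_wpM2l => //; exact: ltW.
have H4 : ln (t / e) = ln t - ln e by rewrite ln_div ?posrE.
move: H1 H2 H3; rewrite H4 /w => H1 H2 H3; lra.
Qed.

Section profile.
Variables (eps C : R).
Hypotheses (eps0 : 0 < eps) (C0 : 0 <= C)
  (inside : forall q, x0 <> q -> dist x0 q < eps -> `|v q - w (dist x0 q)| <= C * dist x0 q)
  (outside : forall q, eps <= dist x0 q -> w eps - C * eps <= v q).

(* [v] tends to -oo at [x0]; cut off below the level [b], it becomes constant near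
   [x0], hence smooth on M, and it is unchanged outside the ball. *)
Let b := w eps - C * eps - eps.
Let f q := if `[< x0 = q >] then b else cutoff b eps (v q).
(** The radius at which the upper bound [w rho + C * eps] for v has come down to [b - eps], where
    the cutoff is constant. *)
Let rho := eps * expR (- (2 * C + 2) * eps / a).

Let v_upper q e : x0 <> q -> e <= eps -> dist x0 q < e -> v q <= w e + C * eps.
Proof.
move=> xq ee de; have d0 : 0 < dist x0 q by exact: geodesic_dist_gt0.
have := inside xq (lt_le_trans de ee); rewrite ler_norml => /andP[_ H].
have H1 : w (dist x0 q) <= w e.
  rewrite /w lerD2r; apply: ler_wpM2l; first exact: ltW.
  by rewrite ler_ln ?posrE ?ltW// (lt_trans d0 de).
have H2 : C * dist x0 q <= C * eps.
  by apply: ler_wpM2l => //; apply: ltW; exact: lt_le_trans de ee.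
lra.
Qed.

Let not_center q : eps <= dist x0 q -> x0 <> q.
Proof.
by move=> + xq; rewrite -xq geodesic_dist_refl// leNgt eps0.
Qed.

Let f_out q : ~ Gam eps q -> f q = v q.
Proof.
move=> /negP; rewrite -leNgt => dq; rewrite /f asboolF; last exact: not_center.
apply: cutoff_id => //; apply: le_trans (outside dq).
by rewrite /b lerBlDr lerDl ltW.
Qed.

Let b_le : b <= w eps + C * eps.
Proof.
have Ce : 0 <= C * eps by rewrite mulr_ge0// ltW.
exact: (@shift_le R).
Qed.

Let b_lt : b - eps <= b.
Proof. by rewrite lerBlDr lerDl ltW. Qed.

Let f_in q : Gam eps q -> b - eps <= f q <= w eps + C * eps.
Proof.
move=> dq; rewrite /f; case: asboolP => [_|xq]; first by rewrite b_lt b_le.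
have := v_upper xq (lexx _) dq => vu.
have [vb|vb] := leP b (v q).
  by rewrite cutoff_id// vu andbT (le_trans b_lt vb).
have /andP[c1 c2] := cutoff_le eps0 (ltW vb); rewrite c1 /=.
exact: le_trans c2 b_le.
Qed.

Let rho0 : 0 < rho. Proof. by rewrite mulr_gt0// expR_gt0. Qed.

Let rho_le : rho <= eps.
Proof.
have C2 : 0 <= 2 * C + 2 by rewrite addr_ge0// mulr_ge0.
have e1 : expR (- (2 * C + 2) * eps / a) <= 1.
  rewrite -[X in _ <= X]expR0 ler_expR !mulNr oppr_le0.
  by apply: divr_ge0; [apply: mulr_ge0 => //; exact: ltW|exact: ltW].
by rewrite /rho -[X in _ <= X]mulr1; apply: ler_wpM2l => //; exact: ltW.
Qed.

Let f_center q : dist x0 q < rho -> f q = b.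
Proof.
move=> dq; rewrite /f; case: asboolP => // xq; apply: cutoff_cst => //.
have := v_upper xq rho_le dq; rewrite {1}/w lnM ?posrE ?expR_gt0// expRK.
have -> : a * (ln eps + - (2 * C + 2) * eps / a) = a * ln eps - (2 * C + 2) * eps.
  by field; rewrite gt_eqF.
by rewrite /b /w; lra.
Qed.

Let Cv c k : atlas S c -> Ck k (punctured x0 c) (v \o cinv c).
Proof.
move=> Ac; exact: (CkM (@open_punctured _ _ _ x0 _ Ac) (Ck_cst _ _ _) (Ck_green hE x0 k Ac)).
Qed.

(** Inside radius [rho] the function is constant; away from [x0] it is a smooth function of [v]. The
    value [b] at [x0] overrides the arbitrary value of [E] on the diagonal. *)
Let Sf : smooth_fun S f.
Proof.
move=> c Ac k; apply: Ck_local => u cu.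
have oP := @open_punctured _ _ _ x0 _ Ac.
have [xu|xu] := pselect (x0 = cinv c u).
  exists [set z | cimg c z /\ Gam rho (cinv c z)].
    by split=> //; rewrite -xu /geodesic_ball /= geodesic_dist_refl.
  apply: (@Ck_eq _ _ _ _ _ (fun=> b)); last exact: Ck_cst.
  - exact: open_chart_preimage Ac _ (open_ball rho).
  - by move=> z [_ dz]; rewrite /= f_center.
exists (punctured x0 c) => //.
apply: (@Ck_eq _ _ _ _ _ (cutoff b eps \o (v \o cinv c))) => //.
- by move=> z [_ xz]; rewrite /= /f asboolF.
- exact: (Ck_comp_real oP (Ck_cutoff k b eps) (Cv k Ac)).
Qed.

Let lap_f q : ~ Gam eps q -> laplacian S f q = -1.
Proof.
move=> nq; have dq : eps <= dist x0 q by rewrite leNgt; exact/negP.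
have xq := not_center dq.
have cv := v_continuous xq.
(* The slack [eps] in [b] makes this strict, so f = v near [q] even when [q] lies on the boundary
   sphere. *)
have bv : b < v q by apply: lt_le_trans (outside dq); rewrite /b ltrBlDr ltrDl.
have vf : {near q, f =1 v}.
  have oN : \forall y \near q, x0 <> y.
    exact: open_nbhs_nbhs (conj (open_neq S x0) xq).
  have nb : \forall y \near q, b < v y by apply: (cv [set t | b < t]); exact: lt_nbhsr.
  by apply: filterS2 oN nb => y xy by0; rewrite /f asboolF//; apply: cutoff_id => //; exact: ltW.
rewrite (@laplacian_near _ _ S f v q vf).
have [Ac cq] := chart_atP S q; set c := chart_at S q in Ac cq.
have oP := @open_punctured _ _ _ x0 _ Ac.
have PC : punctured x0 c `<=` cimg c by move=> z [].
have pq : punctured x0 c (cmap c q) by split; [exact: cimg_cmap|rewrite (cmapK Ac cq)].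
rewrite (laplacian_chart Ac cq oP PC pq (Cv 2 Ac)).
rewrite (chart_laplacian_scale _ Ac oP PC (Ck_green hE x0 2 Ac) pq).
rewrite -(laplacian_chart Ac cq oP PC pq (Ck_green hE x0 2 Ac)).
by rewrite (laplacian_green hvol hE xq) -/area mulNr mulfV// gt_eqF.
Qed.

(** On the ball f stays between [b - eps] = w - (C + 2) eps and w + C eps; the constant is the
    larger of the two deviations. *)
Lemma mfpt_near_profile (d : measure_display) (Omega : measurableType d)
    (P : R.-pker (borel M) ~> Omega) (X : R -> Omega -> M) q :
  is_brownian S P X -> ~ Gam eps q -> exists t, mfpt P X (Gam eps) q = t%:E /\
    `|t - (v q - w eps)| <= (C + 2) * eps.
Proof.
move=> hX nq.
have [|K _ HK] := compact_bound (f := f) Mcompact.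
  by move=> y _; exact: smooth_continuous Sf y.
have Hf := mfpt_bounds hX (open_ball eps) nq Sf (fun y => HK y I) lap_f f_in.
move: Hf; rewrite (f_out nq); case: (mfpt _ _ _ _) => [t| |]; rewrite ?leye_eq ?leeNy_eq ?andbF//.
rewrite !lee_fin => /andP[t1 t2]; exists t; split=> //.
exact: profile_arith t1 t2.
Qed.

End profile.

Lemma mfpt_estimate (d : measure_display) (Omega : measurableType d)
    (P : R.-pker (borel M) ~> Omega) (X : R -> Omega -> M) : is_brownian S P X ->
  exists e0 C : R, [/\ 0 < e0, 0 <= C & forall eps q, 0 < eps < e0 -> ~ Gam eps q ->
    exists t, mfpt P X (Gam eps) q = t%:E /\
      `|t - (- a * ln eps + area * Pm4 x0 x0 - area * E q x0)| <= C * eps].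
Proof.
move=> hX; have [e0 [C [e00 C0 Hin Hout]]] := outside_bound.
exists e0, (C + 2); split=> //; first by rewrite addr_ge0.
move=> eps q /andP[ep ee] nq.
have Hin' y : x0 <> y -> dist x0 y < eps -> `|v y - w (dist x0 y)| <= C * dist x0 y.
  by move=> xy dy; apply: Hin => //; exact: lt_trans ee.
have [t [Et Ht]] := mfpt_near_profile ep C0 Hin' (fun y => Hout eps y ep ee) hX nq.
exists t; split=> //; have [_ _ _ Esym _] := hE.
suff -> : - a * ln eps + area * Pm4 x0 x0 - area * E q x0 = v q - w eps by [].
by rewrite /v /w Esym; ring.
Qed.

End comparison.

(** * Integrals over small balls *)

Section ball_integrals.
Context {R : realType} {M : ptopologicalType} (S : riemannian_surface R M).
Hypothesis Mconnected : connected [set: M].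
Variables (vol : {measure set (borel M) -> \bar R}).
Hypothesis hvol : is_volume S vol.
Variable x0 : M.
Notation dist := (geodesic_dist S).
Notation Gam := (geodesic_ball S x0).
Notation leb2 := (@lebesgue_measure R \x @lebesgue_measure R)%E.

Lemma measurable_ball r : measurable (Gam r : set (borel M)).
Proof. by apply: borel_open; exact: open_geodesic_ball. Qed.

Lemma chart_square_volume c u (s B : R) : atlas S c -> square u s `<=` cimg c -> 0 < s ->
  (forall v, square u s v -> vdensity S c v <= B) ->
  (vol (chart_square c u s) <= (B * ((s + s) * (s + s)))%:E)%E.
Proof.
move=> Ac sC s0 HB; have mQ := measurable_square u s.
have mS : measurable (chart_square c u s : set (borel M)).
  exact: borel_closed (closed_chart_square Ac sC).
have H := @integral_chart R M S vol hvol c u s Ac sC (cst 1%E) (measurable_cst _).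
rewrite integral_cst// mul1e in H; rewrite H.
have E := integral_cst leb2 mQ B%:E; have L := leb2_square u s0.
have V : (\int[leb2]_(v in square u s) (cst 1%E (cinv c v) * (vdensity S c v)%:E) =
    \int[leb2]_(v in square u s) (vdensity S c v)%:E)%E.
  by apply: eq_integral => v _; rewrite mul1e.
have EL : (\int[leb2]_(v in square u s) (cst B%:E v) = (B * ((s + s) * (s + s)))%:E)%E.
  by rewrite EFinM -L; exact: E.
rewrite -EL; apply: le_trans (_ : \int[leb2]_(v in square u s) (vdensity S c v)%:E <= _)%E.
  by rewrite -V; exact: lexx.
have mV : measurable_fun (square u s) (fun v : R * R => (vdensity S c v)%:E).
  by apply/measurable_EFinP; exact: measurable_vdensity Ac sC.
apply: (@ge0_le_integral _ _ _ leb2 _ mQ).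
- by move=> v Sv; rewrite lee_fin; apply/ltW/(vdensity_gt0 Ac); exact: sC.
- exact: mV.
- exact: measurable_cst.
- by move=> v Sv; rewrite /cst lee_fin; exact: HB.
Qed.

(** By [geodesic_dist_lower] the ball lies in a coordinate square of half-width (C + 1) r, whose
    volume is of order r^2; for r < 1 one factor r is dropped. *)
Lemma ball_volume : exists r0 C : R, [/\ 0 < r0, 0 <= C &
  forall r, 0 < r -> r < r0 -> (vol (Gam r) <= (C * r)%:E)%E].
Proof.
have [Ac cx] := chart_atP S x0; set c := chart_at S x0 in Ac cx; set u0 := cmap c x0.
have [k [C [k0 C0 HC]]] := geodesic_dist_lower Mconnected Ac cx.
have [r1 [B [r10 B0 HB]]] := chart_bounds Ac (cimg_cmap cx).
have C1 : 0 < C + 1 by rewrite ltr_wpDl.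
exists (Num.min k (Num.min (r1 / (C + 1)) 1)), (4 * B * (C + 1) ^+ 2); split.
- by rewrite !lt_min k0 ltr01 divr_gt0.
- by rewrite !mulr_ge0 ?sqr_ge0// ltW.
move=> r rpos; rewrite !lt_min => /and3P[rk rr1 r_1].
pose s := (C + 1) * r; have s0 : 0 < s by rewrite mulr_gt0.
have sr1 : s < r1 by rewrite /s mulrC -ltr_pdivlMr.
have sB v : square u0 s v -> cimg c v /\ vdensity S c v <= B.
  by move=> Sv; have [] := HB v (le_lt_trans Sv sr1).
have sC : square u0 s `<=` cimg c by move=> v /sB[].
apply: (@le_trans _ _ (vol (chart_square c u0 s))).
  apply: le_measure; rewrite ?inE; first exact: measurable_ball.
    exact: borel_closed (closed_chart_square Ac sC).
  move=> q dq; have [cq Hq] := HC q (lt_trans dq rk).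
  apply/(chart_squareE Ac sC); split=> //; apply: le_trans Hq _.
  by rewrite /s ler_pM// ?geodesic_dist_ge0// ?lerDl// ltW.
apply: le_trans (chart_square_volume Ac sC s0 (fun v Sv => (sB v Sv).2)) _.
rewrite lee_fin /s.
have -> : B * (((C + 1) * r + (C + 1) * r) * ((C + 1) * r + (C + 1) * r)) =
  4 * B * (C + 1) ^+ 2 * r * r by ring.
by rewrite ler_piMr ?(ltW r_1)// !mulr_ge0 ?sqr_ge0// ltW.
Qed.

(* Dominates ln (eps / dist x0 q) on the ball of radius eps, including at the
   centre, where it is infinite. *)
Definition shells (eps : R) (q : M) : \bar R :=
  (\sum_(0 <= j <oo) (ln 2 * \1_(Gam (eps / 2 ^+ j)) q)%:E)%E.

Let ln2_gt0 : 0 < ln 2 :> R.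
Proof. by rewrite ln_gt0// ltr1n. Qed.

Let shells_term (eps : R) j q : (0 <= (ln (2 : R) * \1_(Gam (eps / 2 ^+ j)) q)%:E)%E.
Proof. by rewrite lee_fin; apply: mulr_ge0; [exact: ltW|rewrite indicE]. Qed.

Let shells_partial (eps : R) q n : (forall j, (j < n)%N -> dist x0 q < eps / 2 ^+ j) ->
  ((ln (2 : R) * n%:R)%:E <= shells eps q)%E.
Proof.
move=> H; apply: le_trans (nneseries_lim_ge n _) => //.
rewrite big_nat_cond (eq_bigr (fun=> (ln 2)%:E)).
  by rewrite -big_nat_cond sumEFin lee_fin big_const_nat iter_addr subn0 addr0 mulr_natr.
by move=> i /andP[/andP[_ ik] _]; rewrite indicE mem_set ?mulr1//; exact: H.
Qed.

Lemma shells_center (eps y : R) : 0 < eps -> (y%:E <= shells eps x0)%E.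
Proof.
move=> eps0; apply: le_trans (@shells_partial eps x0 (Num.truncn (y / ln 2)).+1 _).
  by rewrite lee_fin mulrC -ler_pdivrMr// ltW// truncnS_gt.
by move=> j _; rewrite geodesic_dist_refl// divr_gt0// exprn_gt0.
Qed.

(** For n minimal with eps / d <= 2^n, the point lies in the balls of index 0 to n - 1, and ln (eps
    / d) <= n ln 2. *)
Lemma shells_ge (eps : R) q : 0 < eps -> x0 <> q -> ((ln (eps / dist x0 q))%:E <= shells eps q)%E.
Proof.
move=> eps0 xq; have d0 : 0 < dist x0 q by exact: geodesic_dist_gt0.
set t := eps / dist x0 q; have t0 : 0 < t by rewrite divr_gt0.
have exn : exists n, t <= 2 ^+ n.
  exists (Num.truncn t).+1; apply: le_trans (ltW (truncnS_gt t)) _.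
  by rewrite -natrX ler_nat ltnW// ltn_expl.
pose n := ex_minn exn.
have [tn nmin] : t <= 2 ^+ n /\ forall j, t <= 2 ^+ j -> (n <= j)%N.
  by rewrite /n; case: ex_minnP.
apply: (@le_trans _ _ (ln 2 * n%:R)%:E).
  by rewrite lee_fin mulr_natr -lnXn// ler_ln ?posrE// exprn_gt0.
apply: shells_partial => j jn; rewrite ltr_pdivlMr ?exprn_gt0// mulrC -ltr_pdivlMr//.
by rewrite ltNge; apply/negP => /nmin; rewrite leqNgt jn.
Qed.

(** The volumes are bounded by a geometric series of ratio 1/2, and ln 2 <= 1. *)
Lemma integral_shells (r0 C eps : R) : 0 <= C -> 0 < eps -> eps < r0 ->
  (forall r, 0 < r -> r < r0 -> (vol (Gam r) <= (C * r)%:E)%E) ->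
  (\int[vol]_q shells eps q <= (2 * C * eps)%:E)%E.
Proof.
move=> C0 eps0 er0 HC.
have mterm j : measurable_fun [set: borel M] (fun q : borel M => (ln (2 : R) * \1_(Gam (eps / 2 ^+ j)) q)%:E).
  apply/measurable_EFinP; apply: measurable_funM => //.
  apply: measurable_indic; exact: measurable_ball.
rewrite /shells integral_nneseries//.
apply: lime_le.
  by apply: is_cvg_ereal_nneg_natsum => j _; apply: integral_ge0 => q _; exact: shells_term.
apply: nearW => n.
have e2 j : 0 < eps / 2 ^+ j <= eps.
  rewrite divr_gt0 ?exprn_gt0//= ler_pdivrMr ?exprn_gt0//.
  by apply: ler_peMr; [exact: ltW|rewrite exprn_ege1// ler1n].
have ln2 : ln 2 <= 1 :> R by apply: (@le_ln1Dx R 1); rewrite (lt_trans (ltrN10 _)).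
apply: (@le_trans _ _ (\sum_(0 <= j < n) (C * (eps / 2 ^+ j))%:E)%E).
  apply: lee_sum => j _; have /andP[ej0 ej] := e2 j.
  under eq_integral do rewrite EFinM.
  rewrite ge0_integralZl//; last 2 first.
  - by apply/measurable_EFinP; apply: measurable_indic; exact: measurable_ball.
  - by rewrite lee_fin ltW.
  rewrite integral_indic ?setIT//; last exact: measurable_ball.
  apply: (@le_trans _ _ (1%:E * vol (Gam (eps / 2 ^+ j)))%E).
    by apply: lee_wpmul2r; [exact: measure_ge0|rewrite lee_fin].
  by rewrite mul1e; apply: HC => //; exact: le_lt_trans er0.
rewrite sumEFin lee_fin.
have -> : \sum_(0 <= j < n) C * (eps / 2 ^+ j) = C * eps * (2 - 2 / 2 ^+ n).
  elim: n => [|n IH]; first by rewrite big_geq// expr0 divr1 subrr mulr0.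
  rewrite big_nat_recr//= IH exprS; field.
  by rewrite expf_neq0.
have -> : 2 * C * eps = C * eps * 2 by ring.
apply: ler_wpM2l; first by apply: mulr_ge0 => //; exact: ltW.
by rewrite lerBlDr lerDl divr_ge0// exprn_ge0.
Qed.

Variables (E Pm4 : M -> M -> R).
Hypotheses (hE : is_green S vol E) (hP : is_regular_part S E Pm4).

Let integrable_green (A : set (borel M)) : measurable A ->
  vol.-integrable A (fun q => (E q x0)%:E).
Proof.
move=> mA; have [_ iE _ _ _] := hE.
by apply: integrableS (iE x0).
Qed.

Lemma integral_green_ball : exists r0 C : R, [/\ 0 < r0, 0 <= C &
  forall eps, 0 < eps -> eps < r0 ->
    `|(\int[vol]_(q in Gam eps) E q x0)%R| <= C * (eps * (1 + `|ln eps|))].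
Proof.
have [k [D [k0 D0 HD]]] := @green_expansion _ _ _ Mconnected _ _ x0 hP.
have [r0 [C [r00 C0 HC]]] := ball_volume.
pose c := `|Pm4 x0 x0| + D.
have c0 : 0 <= c by rewrite addr_ge0.
exists (Num.min k (Num.min r0 1)), (C * (c + 3)); split.
- by rewrite !lt_min k0 r00 ltr01.
- by rewrite mulr_ge0// addr_ge0.
move=> eps eps0; rewrite !lt_min => /and3P[ek er e1].
have mG := measurable_ball eps; have iG := integrable_green mG.
apply: le_trans (le_normr_Rintegral mG iG) _.
have lnE : `|ln eps| = - ln eps.
  by rewrite ler0_norm// -(ln1 R) ler_ln ?posrE// ltW.
(* Writes -ln d as -ln eps + ln (eps / d). At the centre the value of [E] is arbitrary, but there
   [shells] exceeds every real number. *)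
have bound q : Gam eps q -> (`|E q x0|%:E <= (`|ln eps| + c)%:E + shells eps q)%E.
  move=> dq; have [<-|xq] := pselect (x0 = q).
    apply: (@le_trans _ _ (0 + shells eps x0)%E).
      by rewrite add0e; exact: shells_center.
    by apply: leeD2r; rewrite lee_fin addr_ge0.
  have d0 : 0 < dist x0 q by exact: geodesic_dist_gt0.
  have [_ _ _ Esym _] := hE; rewrite Esym.
  apply: (@le_trans _ _ ((`|ln eps| + c)%:E + (ln (eps / dist x0 q))%:E)%E); last first.
    by apply: leeD2l; exact: shells_ge.
  rewrite -EFinD lee_fin ln_div ?posrE// lnE.
  have := HD q xq (lt_trans dq ek).
  have dD : D * dist x0 q <= D.
    by rewrite ler_piMr// ltW// (lt_trans dq).
  have lnd : ln (dist x0 q) <= 0 by rewrite -(ln1 R) ler_ln ?posrE// ltW// (lt_trans dq).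
  have p1 : (2 * pi)^-1 <= 1 :> R.
    by rewrite invf_le1 ?mulr_gt0 ?pi_gt0//; have := pi_ge2 R; lra.
  have pl : - (2 * pi)^-1 * ln (dist x0 q) <= - ln (dist x0 q).
    by rewrite mulNr lerN2 -[X in X <= _]mul1r ler_wnM2r.
  have pl0 : 0 <= - (2 * pi)^-1 * ln (dist x0 q).
    by rewrite mulr_le0// oppr_le0 invr_ge0 mulr_ge0// pi_ge0.
  move: pl pl0; rewrite /c; set z := - _ * _; set y := ln _ => pl pl0 H.
  have := ler_norm (Pm4 x0 x0); have := ler_norm (- Pm4 x0 x0); rewrite normrN.
  move: H; rewrite ler_norml => /andP[h1 h2] n1 n2.
  by rewrite ler_norml; apply/andP; split; lra.
have mE : measurable_fun (Gam eps : set (borel M)) (fun q : borel M => `|E q x0|%:E).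
  have /integrableP[+ _] := iG => /measurable_EFinP mE'.
  by apply/measurable_EFinP; exact: measurableT_comp.
have msh : measurable_fun [set: borel M] (shells eps).
  apply: ge0_emeasurable_sum => [j q _ _|j _]; first exact: shells_term.
  apply/measurable_EFinP; apply: measurable_funM => //.
  apply: measurable_indic; exact: measurable_ball.
have sh0 q : (0 <= shells eps q)%E by apply: nneseries_ge0 => j _ _; exact: shells_term.
have total : (\int[vol]_(q in Gam eps) (`|E q x0|)%:E <=
    (C * (eps * ((`|ln eps| + c) + 2)))%:E)%E.
  apply: (@le_trans _ _ (\int[vol]_(q in Gam eps) ((`|ln eps| + c)%:E + shells eps q))%E).
    apply: ge0_le_integral => //.
    by apply: emeasurable_funD => //; exact: measurable_funTS.
  rewrite ge0_integralD//; last 2 first.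
  - by move=> q _; rewrite lee_fin addr_ge0.
  - exact: measurable_funTS.
  rewrite integral_cst//.
  apply: (@le_trans _ _ ((`|ln eps| + c)%:E * (C * eps)%:E + (2 * C * eps)%:E)%E); last first.
    by rewrite -EFinM -EFinD lee_fin le_eqVlt; apply/orP; left; apply/eqP; ring.
  apply: leeD.
    by apply: lee_wpmul2l; [rewrite lee_fin addr_ge0|exact: HC].
  apply: le_trans (integral_shells C0 eps0 er HC).
  exact: ge0_subset_integral.
have fin : (\int[vol]_(q in Gam eps) (`|E q x0|)%:E)%E \is a fin_num.
  rewrite ge0_fin_numE; last by apply: integral_ge0 => q _; rewrite lee_fin.
  by apply: le_lt_trans total _; rewrite ltry.
rewrite /Rintegral -lee_fin fineK//; apply: le_trans total _.
rewrite lee_fin -!mulrA ler_wpM2l// mulrCA ler_wpM2l ?ltW//.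
have := normr_ge0 (ln eps); move: `|ln eps| => t t0.
by have : 0 <= c * t by [rewrite mulr_ge0]; lra.
Qed.

End ball_integrals.

(** * The average first-passage time *)

Section average.
Context {R : realType} {M : ptopologicalType} (S : riemannian_surface R M).
Hypotheses (Mcompact : compact [set: M]) (Mconnected : connected [set: M]).
Variables (vol : {measure set (borel M) -> \bar R}).
Hypothesis hvol : is_volume S vol.
Variables (E Pm4 : M -> M -> R).
Hypotheses (hE : is_green S vol E) (hP : is_regular_part S E Pm4).
Context {d : measure_display} {Omega : measurableType d}
  (P : R.-pker (borel M) ~> Omega) (X : R -> Omega -> M).
Hypothesis hX : is_brownian S P X.
Variable x0 : M.
Notation Gam := (geodesic_ball S x0).
Let area := fine (vol [set: borel M]).

Lemma measurable_mfpt (G : set M) : open G ->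
  measurable_fun [set: borel M] (mfpt P X G : borel M -> \bar R).
Proof.
move=> oG; apply: measurable_fun_integral_kernel.
- exact: measurable_kernel.
- by move=> w; exact: hitting_time_ge0.
- exact: (measurable_hitting_time hX oG).
Qed.

Lemma mfpt_average : exists r0 C : R, [/\ 0 < r0, 0 <= C & forall eps, 0 < eps < r0 ->
  exists e, `|e| <= C * (eps * (1 + `|ln eps|)) /\
   ((fine (vol (~` Gam eps)))^-1%:E * \int[vol]_(y in ~` Gam eps) mfpt P X (Gam eps) y)%E =
   (- (area / (2 * pi)) * ln eps + area * Pm4 x0 x0 + e)%:E].
Proof.
have A0 : 0 < area := area_gt0 hE x0.
have vfin := vol_fin_num hE x0.
have [r1 [C1 [r10 C10 H1]]] := mfpt_estimate Mcompact Mconnected hvol hE hP x0 hX.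
have [r2 [C2 [r20 C20 H2]]] := ball_volume Mconnected hvol x0.
have [r3 [C3 [r30 C30 H3]]] := integral_green_ball Mconnected hvol x0 hE hP.
(* Below this radius the ball takes at most half of the area, so dividing by the remaining area
   costs at most a factor 2. *)
pose r4 := area / (2 * (C2 + 1)).
have r40 : 0 < r4 by rewrite divr_gt0// mulr_gt0// ltr_wpDl.
exists (Num.min r1 (Num.min r2 (Num.min r3 r4))), (2 * C3 + C1); split.
- by rewrite !lt_min r10 r20 r30 r40.
- by rewrite addr_ge0// mulr_ge0.
move=> eps; rewrite !lt_min => /andP[e0 /and4P[er1 er2 er3 er4]].
set G := Gam eps; set N := ~` G.
have mG : measurable (G : set (borel M)) by exact: measurable_ball.
have mN : measurable (N : set (borel M)) by exact: measurableC.
have fin_le (A : set (borel M)) : measurable A -> vol A \is a fin_num.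
  move=> mA; rewrite ge0_fin_numE ?measure_ge0//.
  apply: le_lt_trans (_ : vol [set: borel M] < +oo)%E; last by rewrite -ge0_fin_numE ?measure_ge0.
  by apply: le_measure; rewrite ?inE.
have areaE : area = fine (vol G) + fine (vol N).
  rewrite /area -fineD ?fin_le// -measureU//; last by rewrite setICr.
  by rewrite setUv.
have GA : fine (vol G) <= area / 2.
  have : fine (vol G) <= C2 * eps.
    by rewrite -lee_fin fineK ?fin_le//; exact: H2.
  move=> /le_trans; apply; apply: (@le_trans _ _ ((C2 + 1) * r4)).
    by rewrite ler_pM ?lerDl// ltW.
  by rewrite /r4 le_eqVlt; apply/orP; left; apply/eqP; field; rewrite gt_eqF// ltr_wpDl.
have NA : area / 2 <= fine (vol N) by move: areaE GA; lra.
have N0 : 0 < fine (vol N) by apply: lt_le_trans NA; rewrite divr_gt0.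
pose c := - (area / (2 * pi)) * ln eps + area * Pm4 x0 x0.
pose tt y := fine (mfpt P X G y).
pose g y := c - area * E y x0.
have ttE y : N y -> mfpt P X G y = (tt y)%:E /\ `|tt y - g y| <= C1 * eps.
  move=> Ny; have [|t [Et Ht]] := H1 eps y _ Ny; first by rewrite e0.
  by rewrite /tt Et.
have mt : measurable_fun (N : set (borel M)) (tt : borel M -> R).
  apply: measurable_funTS; apply: measurableT_comp (fine_measurable measurableT) _.
  by apply: measurable_mfpt; exact: open_geodesic_ball.
have [_ iE _ Esym E0] := hE.
have iEA (A : set (borel M)) : measurable A -> vol.-integrable A (EFin \o (fun y => E y x0)).
  by move=> mA; apply: integrableS (iE x0).
have finN : (vol [set: borel M] < +oo)%E by rewrite -ge0_fin_numE ?measure_ge0.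
have ic : vol.-integrable N (EFin \o (fun=> c)).
  by apply: (@bounded_integrable _ _ _ _ finN _ _ `|c|).
have iaE : vol.-integrable N (EFin \o (fun y => area * E y x0)).
  by have := integrableZl mN area (iEA N mN); apply: eq_integrable.
have ig : vol.-integrable N (EFin \o g).
  by have := integrableB mN ic iaE; apply: eq_integrable.
have mg : measurable_fun (N : set (borel M)) (g : borel M -> R).
  by have /integrableP[/measurable_EFinP] := ig.
(* The uniform estimate makes the difference bounded; the passage time then inherits integrability
   from the Green function. *)
have idiff : vol.-integrable N (EFin \o (fun y => tt y - g y)).
  apply: (bounded_integrable finN mN _ (fun y Ny => (ttE y Ny).2)).
  exact: measurable_funB.
have it : vol.-integrable N (EFin \o tt).
  have := integrableD mN ig idiff; apply: eq_integrable => // y _.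
  by rewrite /= -EFinD addrC subrK.
pose I := \int[vol]_(y in N) (tt y - g y).
pose J := \int[vol]_(y in G) E y x0.
have intE : \int[vol]_(y in N) E y x0 = - J.
  have : \int[vol]_(y in G `|` N) E y x0 = 0.
    by rewrite setUv; under eq_Rintegral do rewrite Esym; exact: E0.
  rewrite Rintegral_setU//; last 2 first.
  - by rewrite setUv; exact: iEA.
  - by rewrite disj_set2E setICr.
  by rewrite -/J => /eqP; rewrite addrC addr_eq0 => /eqP.
have intT : \int[vol]_(y in N) tt y = c * fine (vol N) + area * J + I.
  have -> : \int[vol]_(y in N) tt y = \int[vol]_(y in N) g y + I.
    by rewrite -RintegralD//; apply: eq_Rintegral => y _; rewrite addrC subrK.
  rewrite RintegralB// Rintegral_cst// RintegralZl//; last exact: iEA.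
  by rewrite intE mulrN opprK.
have Ibound : `|I| <= C1 * eps * fine (vol N).
  have /andP[i1 i2] := @Rintegral_itv _ _ _ vol finN N (fun y => tt y - g y) (C1 * eps)
    (- (C1 * eps)) (C1 * eps) mN (measurable_funB mt mg) (fun y Ny => (ttE y Ny).2)
    (fun y Ny => (etrans (esym (ler_norml _ _)) (ttE y Ny).2)).
  by rewrite ler_norml -mulNr i1.
exists ((area * J + I) / fine (vol N)); split.
  rewrite normrM normfV (gtr0_norm N0) ler_pdivrMr//.
  apply: le_trans (ler_normD _ _) _; rewrite normrM (gtr0_norm A0) mulrDl mulrDl.
  apply: lerD.
    apply: (@le_trans _ _ (area * (C3 * (eps * (1 + `|ln eps|))))).
      by apply: ler_wpM2l; [exact: ltW|exact: H3].
    have T0 : 0 <= C3 * (eps * (1 + `|ln eps|)).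
      by rewrite !mulr_ge0 ?addr_ge0// ltW.
    move: T0; rewrite -[2 * C3 * _]mulrA; set T := C3 * _ => T0.
    by rewrite mulrAC ler_wpM2r//; lra.
  apply: le_trans Ibound _; apply: ler_wpM2r; first exact: ltW.
  by apply: ler_wpM2l => //; apply: ler_peMr; [exact: ltW|rewrite lerDl].
have -> : (\int[vol]_(y in N) mfpt P X G y = (\int[vol]_(y in N) tt y)%:E)%E.
  rewrite /Rintegral fineK; last exact: integrable_fin_num it.
  by apply: eq_integral => y /set_mem Ny; rewrite (ttE y Ny).1.
rewrite -EFinM intT -/c; congr (_%:E); field.
by rewrite gt_eqF.
Qed.

End average.

Theorem theorem1p1 (R : realType) (M : ptopologicalType)
    (S : riemannian_surface R M)
    (Mcompact : compact [set: M]) (Mconnected : connected [set: M])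
    (Morientable : orientable S)
    (vol : {measure set (borel M) -> \bar R}) (hvol : is_volume S vol)
    (E Pm4 : M -> M -> R) (hE : is_green S vol E)
    (hP : is_regular_part S E Pm4)
    (d : measure_display) (Omega : measurableType d)
    (Prob : R.-pker (borel M) ~> Omega) (X : R -> Omega -> M)
    (hX : is_brownian S Prob X)
    (x0 : M) :
  let area := fine (vol [set: M]) in
  let Gam := geodesic_ball S x0 in
  (exists (r : R -> M -> R) (e : R -> R) (eps0 : R),
     [/\ 0 < eps0,
         O_eps_log_eps e,
         (forall eps x, 0 < eps < eps0 -> ~ Gam eps x ->
            mfpt Prob X (Gam eps) x =
            (- (area / (2 * pi)) * ln eps + area * Pm4 x0 x0
             - area * E x x0 + r eps x + e eps)%:E) &
         (forall K : set M, compact K -> exists CK : R,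
            forall eps, 0 < eps < eps0 -> K `&` Gam eps = set0 ->
              forall x, K x -> `|r eps x| <= CK * eps)])
  /\
  (exists e : R -> R,
     O_eps_log_eps e /\
     \forall eps \near 0^'+,
       ((fine (vol (~` Gam eps)))^-1%:E *
        \int[vol]_(y in ~` Gam eps) mfpt Prob X (Gam eps) y)%E =
       (- (area / (2 * pi)) * ln eps + area * Pm4 x0 x0 + e eps)%:E).
Proof.
move=> area Gam; split.
  have [e0 [C [e00 C0 H]]] := mfpt_estimate Mcompact Mconnected hvol hE hP x0 hX.
  (* The whole error is put into [r], and [e] is 0. As the estimate is uniform outside the ball, one
     constant serves every compact K. *)
  exists (fun eps x => fine (mfpt Prob X (Gam eps) x) -
    (- (area / (2 * pi)) * ln eps + area * Pm4 x0 x0 - area * E x x0)), (fun=> 0), e0.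
  split=> //.
  - by exists 0; apply: nearW => eps; rewrite normr0 mul0r.
  - move=> eps x he nx; have [t [-> _]] := H eps x he nx.
    by congr (_%:E); rewrite /= addr0 addrC subrK.
  - move=> K _; exists C => eps he KG x Kx.
    have nx : ~ Gam eps x by move=> Gx; rewrite -[False]/(set0 x) -KG.
    by have [t [-> Ht]] := H eps x he nx.
have [r0 [C [r00 C0 H]]] := mfpt_average Mcompact Mconnected hvol hE hP hX x0.
pose main eps := - (area / (2 * pi)) * ln eps + area * Pm4 x0 x0.
pose average eps := ((fine (vol (~` Gam eps)))^-1%:E *
  \int[vol]_(y in ~` Gam eps) mfpt Prob X (Gam eps) y)%E.
exists (fun eps => fine (average eps) - main eps); split.
  (* For eps < exp(-1) one has |ln eps| > 1, so 1 + |ln eps| is at most 2 |ln eps|. *)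
  exists (C * 2); near=> eps.
  have eps0 : 0 < eps by near: eps; exact: nbhs_right_gt.
  have epsr : eps < r0 by near: eps; exact: nbhs_right_lt.
  have eps1 : eps < expR (- 1) by near: eps; apply: nbhs_right_lt; exact: expR_gt0.
  have [|e [He Ee]] := H eps; first by rewrite eps0.
  have -> : fine (average eps) - main eps = e.
    by rewrite /average Ee /= -/area -/(main eps) addrC addrA addNr add0r.
  apply: le_trans He _; rewrite -mulrA; apply: ler_wpM2l => //.
  rewrite mulrCA; apply: ler_wpM2l; first exact: ltW.
  have : ln eps < - 1 by rewrite -ltr_expR lnK.
  move=> ln1; have := ler_norm (- ln eps); rewrite normrN => ln2.
  by lra.
near=> eps.
have eps0 : 0 < eps by near: eps; exact: nbhs_right_gt.
have epsr : eps < r0 by near: eps; exact: nbhs_right_lt.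
have [|e [He Ee]] := H eps; first by rewrite eps0.
rewrite -/(average eps); have Ea : average eps = (main eps + e)%:E by exact: Ee.
by rewrite Ea /=; congr (_%:E); rewrite /main addrCA subrr addr0.
Unshelve. all: by end_near.
Qed.
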